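(* Let $M$ be a connected split matroid of rank $d$ on the ground set $[n]$, $n\geq 2$, and let $\Lambda M$ be its series-free lift, a matroid of rank $d+1$ on $n+2$ elements. Then the corank vector $\rho(\Lambda M)$ is a ray in the Dressian $\operatorname{Dr}(d+1,n+2)$. Moreover, for an algebraically closed field $\mathbb{K}$, the vector $\rho(\Lambda M)$ can be lifted to an ordinary Plücker vector over the field $\mathbb{K}\{\!\{t\}\!\}$ of formal Puiseux series if and only if $M$ is realizable over $\mathbb{K}$.
   Context: **Series-free lift.** Let $M$ be a connected matroid of rank $d$ on $[n]$. The free extension $M'$ of $M$ by $f\notin[n]$ is the rank-$d$ matroid on $[n]\cup\{f\}$ whose bases are the bases of $M$ together with the sets $I\cup\{f\}$ with $I$ independent in $M$ of size $d-1$. The parallel extension of a matroid $N$ at an element $e$ by a new element $s$ is the extension of the same rank in which $s$ is parallel to $e$. The series extension of $N$ at $e$ by $s$ is the dual of the parallel extension of $N^*$ at $e$ by $s$. The series-free lift $\Lambda M$ is the series extension of $M'$ at $f$ by $s$; it has rank $d+1$ and ground set $[n]\cup\{f,s\}$. **Split matroids.** The matroid polytope $P(M)\subset\mathbb{R}^n$ is the convex hull of the characteristic vectors of the bases of $M$; $\Delta(d,n)=P(U_{d,n})=[0,1]^n\cap\{\sum_i x_i=d\}$ is the hypersimplex. For a flat $F$, let $P_M(F)=\{x\in P(M):\sum_{i\in F}x_i=\operatorname{rk}(F)\}$. A flacet of $M$ is a flat $F$ such that $P_M(F)$ is a facet of $P(M)$ and $F$ is inclusion-minimal among all flats defining the same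 facet. The $F$-hyperplane is given by $(d-\operatorname{rk}(F))\sum_{i\in F}x_i=\operatorname{rk}(F)\sum_{j\notin F}x_j$, equivalently (on $\sum_i x_i=d$) by $\sum_{i\in F}x_i=\operatorname{rk}(F)$. A split of a polytope is a polytopal subdivision (without new vertices) with exactly two maximal cells; the affine span of their common codimension-one cell is the split hyperplane. A split flacet is a flacet $F$ such that the $F$-hyperplane defines a split of $\Delta(d,n)$. A connected matroid $M$ is a split matroid if its split flacets form a compatible system of splits of $\Delta(d,n)$, i.e. for any two distinct split flacets $F,G$ the $F$- and $G$-hyperplanes do not meet in a relatively interior point of $\Delta(d,n)$. **Dressian.** For a matroid $N$ of rank $k$ on $m$ elements, the corank vector is $\rho(N):S\mapsto k-\operatorname{rk}_N(S)$ on $k$-element subsets $S$. A lifting function on the vertices of a polytope induces a regular subdivision (project the lower faces of the lifted polytope); lifting functions inducing the same subdivision form relatively open cones, which form the secondary fan. The Dressian $\operatorname{Dr}(k,m)$ is the subfan of the secondary fan of $\Delta(k,m)$ consisting of the lifting functions (tropical Plücker vectors) such that every cell of the induced subdivision is a matroid polytope. Dimensions of cones are taken modulo the lineality space of the secondary fan; a vector is a ray if the cone containing it in its relative interior has dimension one in this sense. **Lifting.** The valuation $\operatorname{val}$ on $\mathbb{K}\{\!\{t\}\!\}$ is the lowest exponent. A vector $\pi\in\mathbb{R}^{\binom{m}{k}}$ can be lifted to an ordinary Plücker vector over $\mathbb{K}\{\!\{t\}\!\}$ if there is a matrix $A\in\mathbb{K}\{\!\{t\}\!\}^{k\times m}$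 with $\operatorname{val}(\det A_I)=\pi_I$ for every $k$-element set $I$ of columns. *)

(* Defs.v *)
From HB Require Import structures.
From mathcomp Require Import all_boot all_order all_algebra.
Set Implicit Arguments. Unset Strict Implicit. Unset Printing Implicit Defensive.

Record matroid (n : nat) := Matroid {
  bases : {set {set 'I_n}};
  bases_neq0 : bases != set0;
  bases_exchange : forall B C x, B \in bases -> C \in bases -> x \in B :\: C ->
    exists2 y, y \in C :\: B & y |: B :\ x \in bases }.

Section MatroidTheory.
Variables (n : nat) (M : matroid n).
Implicit Types (S I J B C : {set 'I_n}).

Definition indep I := [exists B in bases M, I \subset B].

Definition rk S := \max_(B in bases M) #|B :&: S|.

Definition mrank := rk setT.

Definition flat S := [forall (x | x \notin S), rk S < rk (x |: S)].

(* [S] proper and nonempty with [rk S + rk (~: S) = mrank] means that M is the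
   direct sum of its restrictions to S and to the complement of S. *)
Definition mconnected : Prop :=
  forall S, S != set0 -> S != setT -> rk S + rk (~: S) <> mrank.

Lemma bases_card B C : B \in bases M -> C \in bases M -> #|B| = #|C|.
Proof.
move=> Bb Cb; have [k] := ubnP #|B :\: C|; elim: k => // k IH in B Bb *.
case: (set_0Vmem (B :\: C)) => [/eqP|[x xBC]].
  rewrite setD_eq0 => sBC _.
  case: (set_0Vmem (C :\: B)) => [/eqP|[y yCB]].
    by rewrite setD_eq0 => sCB; congr #|pred_of_set _|; apply/eqP; rewrite eqEsubset sBC.
  have [z] := bases_exchange Cb Bb yCB; rewrite inE => /andP[zC zB].
  by rewrite (subsetP sBC) in zC.
move=> lek; have [y yCB yB] := bases_exchange Bb Cb xBC.
have: #|(y |: B :\ x) :\: C| < k.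
  rewrite -ltnS; apply: leq_trans lek; rewrite ltnS; apply/proper_card/properP; split.
    apply/subsetP=> z; rewrite !inE => /andP[zC /orP[/eqP zy|/andP[_ ->]]]; last by rewrite zC.
    by move: yCB; rewrite -zy inE (negPf zC) andbF.
  exists x => //; rewrite !inE eqxx /= orbF.
  by move: xBC yCB; rewrite !inE; case: eqP => [<-|_] /andP[xC xB] /andP[xB' _]; rewrite ?andbF //; rewrite xB in xB'.
move=> /(IH _ yB) <-; rewrite cardsU1 !inE.
move: xBC yCB; rewrite !inE => /andP[_ xB] /andP[/negPf -> _].
by rewrite andbF /= add1n (cardsD1 x B) xB.
Qed.

Lemma mrank_card B : B \in bases M -> #|B| = mrank.
Proof.
move=> Bb; rewrite /mrank /rk (bigmax_eq_arg _ Bb) .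
by case: arg_maxnP => // C Cb _; rewrite setIT; apply: bases_card.
Qed.

Lemma indep_extend I C : indep I -> C \in bases M ->
  exists2 B, B \in bases M & (I \subset B) && (B \subset I :|: C).
Proof.
case/exists_inP=> B Bb sIB Cb; have [k] := ubnP #|B :\: (I :|: C)|.
elim: k => // k IH in B Bb sIB *.
case: (set_0Vmem (B :\: (I :|: C))) => [/eqP|[x xBC]].
  by rewrite setD_eq0 => sBC _; exists B => //; rewrite sIB.
move=> lek; move: (xBC); rewrite !inE negb_or => /andP[/andP[xI xC] xB].
have [|y] := @bases_exchange _ M _ _ x Bb Cb; first by rewrite inE xC.
rewrite inE => /andP[yB yC] yb; apply: (IH _ yb).
  apply/subsetP => z zI; rewrite !inE (subsetP sIB) // andbT.
  by apply/orP; right; apply: contraNneq xI => <-.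
rewrite -ltnS; apply: leq_trans lek; rewrite ltnS; apply/proper_card/properP; split.
  apply/subsetP=> z; rewrite !inE => /andP[zC /orP[/eqP zy|/andP[_ ->]]]; last by rewrite zC.
  by move: zC; rewrite zy yC orbT.
exists x => //; rewrite !inE eqxx /= orbF negb_and; apply/orP; right.
by apply: contraNneq xC => ->.
Qed.

Lemma indep_augment I J : indep I -> indep J -> #|I| < #|J| ->
  exists2 y, y \in J :\: I & indep (y |: I).
Proof.
move=> iI /exists_inP[C Cb sJC] ltIJ.
have [B Bb /andP[sIB sBC]] := indep_extend iI Cb.
case: (set_0Vmem (B :&: (J :\: I))) => [E|[y]]; last first.
  rewrite inE => /andP[yB yJI]; exists y => //; apply/exists_inP; exists B => //.
  by rewrite subUset sub1set yB.
have: B :\: I \subset C :\: J.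
  apply/subsetP=> z; rewrite !inE => /andP[zI zB].
  move: (subsetP sBC z zB); rewrite inE (negPf zI) /= => ->; rewrite andbT.
  by apply/negP=> zJ; move/setP/(_ z): E; rewrite !inE zB zI zJ.
move/subset_leq_card; rewrite !cardsD (setIidPr sIB) (setIidPr sJC).
by rewrite (bases_card Bb Cb) leqNgt ltn_sub2l // (leq_trans ltIJ) // subset_leq_card.
Qed.

Lemma base_indep B : B \in bases M -> indep B.
Proof. by move=> Bb; apply/exists_inP; exists B. Qed.

Lemma indepS I J : I \subset J -> indep J -> indep I.
Proof.
by move=> sIJ /exists_inP[B Bb sB]; apply/exists_inP; exists B => //; apply: subset_trans sB.
Qed.

Lemma indep_base I : indep I -> #|I| = mrank -> I \in bases M.
Proof.
by case/exists_inP=> B Bb sIB; rewrite -(mrank_card Bb) => /eqP; rewrite eqn_leq => /andP[_ h];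
  have /eqP -> : I == B by rewrite eqEcard sIB.
Qed.

End MatroidTheory.

Section Dual.
Variables (n : nat) (M : matroid n).

Definition dual_bases : {set {set 'I_n}} := [set B | ~: B \in bases M].

Lemma dual_bases_neq0 : dual_bases != set0.
Proof.
by have /set0Pn[B Bb] := bases_neq0 M; apply/set0Pn; exists (~: B); rewrite inE setCK.
Qed.

Lemma dual_bases_exchange B C x :
  B \in dual_bases -> C \in dual_bases -> x \in B :\: C ->
  exists2 y, y \in C :\: B & y |: B :\ x \in dual_bases.
Proof.
rewrite !inE => Bb Cb /andP[xC xB].
set I := x |: (~: B :&: ~: C).
have iI : indep M I.
  apply: indepS (base_indep Cb); apply/subsetP=> z; rewrite !inE.
  by case/orP=> [/eqP->|/andP[]].
have [D Db /andP[sID sDB]] := indep_extend iI Bb.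
have sD : D \subset x |: ~: B.
  apply: subset_trans sDB _; apply/subsetP=> z; rewrite !inE.
  by case: (z == x) (z \in B) => [] [].
have: ~~ (~: B \subset D).
  apply/negP=> sBD; have : #|x |: ~: B| <= #|D|.
    apply: subset_leq_card; rewrite subUset sBD andbT sub1set.
    by rewrite (subsetP sID) // !inE eqxx.
  by rewrite cardsU1 !inE xB /= (bases_card Db Bb) ltnn.
case/subsetPn=> y; rewrite inE => yB yD; exists y.
  rewrite !inE yB /=; apply: contraNT yD => yC.
  by rewrite (subsetP sID) // !inE yB yC orbT.
rewrite inE; suff -> : ~: (y |: B :\ x) = D by [].
apply/eqP; rewrite eq_sym eqEcard; apply/andP; split.
  apply/subsetP=> z zD; rewrite !inE negb_or; apply/andP; split.
    by apply: contraNneq yD => <-.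
  by move: (subsetP sD z zD); rewrite !inE; case: (z == x).
have -> : ~: (y |: B :\ x) = x |: (~: B :\ y).
  have xy : x != y by apply: contraNneq yB => <-.
  apply/setP=> z; rewrite !inE negb_or negb_and negbK.
  by case: (altP (z =P x)) => [->|_] //=; rewrite xy.
rewrite cardsU1 (bases_card Db Bb) (cardsD1 y (~: B)) !inE yB xB.
by rewrite andbF.
Qed.

Definition dual : matroid n := Matroid dual_bases_neq0 dual_bases_exchange.

Lemma mrank_dual : mrank dual = n - mrank M.
Proof.
have /set0Pn[B Bb] := bases_neq0 M.
have Db : ~: B \in bases dual by rewrite inE setCK.
by rewrite -(mrank_card Db) -(mrank_card Bb) cardsCs setCK card_ord.
Qed.

End Dual.

Lemma mrank_le n (M : matroid n) : mrank M <= n.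
Proof.
have /set0Pn[B Bb] := bases_neq0 M.
by rewrite -(mrank_card Bb); apply: leq_trans (max_card _) _; rewrite card_ord.
Qed.

(* In an extension of a matroid on ['I_n] by a single element, the old element
   [i] is [lift ord_max i] (same value) and the new one is [ord_max]. *)
Section FreeExt.
Variables (n : nat) (M : matroid n).

Definition old (B : {set 'I_n.+1}) : {set 'I_n} := lift ord_max @^-1: B.

Definition free_ext_bases : {set {set 'I_n.+1}} :=
  [set B : {set 'I_n.+1} | if ord_max \in B
    then indep M (old B) && (#|old B|.+1 == mrank M) else old B \in bases M].

Lemma free_ext_bases_neq0 : free_ext_bases != set0.
Proof.
have /set0Pn[B Bb] := bases_neq0 M; apply/set0Pn; exists (lift ord_max @: B).
rewrite inE; case: imsetP => [[i _ /eqP]|_]; first by rewrite (negPf (neq_lift _ _)).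
suff -> : old (lift ord_max @: B) = B by [].
by apply/setP=> i; rewrite inE mem_imset //; apply: lift_inj.
Qed.

Lemma free_ext_bases_exchange B C x :
  B \in free_ext_bases -> C \in free_ext_bases -> x \in B :\: C ->
  exists2 y, y \in C :\: B & y |: B :\ x \in free_ext_bases.
Proof.
have oldE (D : {set 'I_n.+1}) i : (i \in old D) = (lift ord_max i \in D) by rewrite inE.
have nl i : (lift ord_max i == ord_max :> 'I_n.+1) = false by rewrite eq_sym (negPf (neq_lift _ _)).
have ln i : (ord_max == lift ord_max i :> 'I_n.+1) = false by rewrite (negPf (neq_lift _ _)).
have ll i j : (lift ord_max i == lift ord_max j :> 'I_n.+1) = (i == j) by rewrite (inj_eq (@lift_inj _ _)).
have oldll (D : {set 'I_n.+1}) i j : old (lift ord_max i |: D :\ lift ord_max j) = i |: old D :\ j.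
  by apply/setP=> z; rewrite !inE !ll.
have oldln (D : {set 'I_n.+1}) j : old (ord_max |: D :\ lift ord_max j) = old D :\ j.
  by apply/setP=> z; rewrite !inE !ll nl.
have oldnl (D : {set 'I_n.+1}) i : old (lift ord_max i |: D :\ ord_max) = i |: old D.
  by apply/setP=> z; rewrite !inE !ll nl.
have mll (D : {set 'I_n.+1}) i j : (ord_max \in lift ord_max i |: D :\ lift ord_max j) = (ord_max \in D).
  by rewrite !inE !ln.
have mnl (D : {set 'I_n.+1}) i : (ord_max \in lift ord_max i |: D :\ ord_max) = false.
  by rewrite !inE ln eqxx.
have mln (D : {set 'I_n.+1}) j : (ord_max \in ord_max |: D :\ lift ord_max j) by rewrite !inE eqxx.
rewrite ![_ \in free_ext_bases]inE inE; case: (unliftP ord_max x) => [j|] ->.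
- rewrite -!oldE; case: ifP => [mB|mB].
  + case/andP=> iB /eqP cB CM /andP[jC jB].
    have iBj : indep M (old B :\ j) by apply: indepS iB; apply: subD1set.
    case: ifP CM => [mC /andP[iC /eqP cC]|mC Cb].
    * have [|y] := indep_augment iBj iC; first by rewrite -ltnS cC -cB ltnS (cardsD1 j (old B)) jB.
      rewrite !inE negb_and negbK => /andP[/orP[/eqP yj|yB] yC iy].
        by move: jC; rewrite -yj inE yC.
      exists (lift ord_max y); first by rewrite inE -!oldE; rewrite ?inE yB.
      rewrite inE mll oldll mB iy /=.
      rewrite cardsU1 !inE (negPf yB) andbF /=; apply/eqP; rewrite -cB.
      by rewrite (cardsD1 j (old B)) jB.
    * have [|y] := indep_augment iB (base_indep Cb); first by rewrite (mrank_card Cb) -cB.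
      rewrite !inE => /andP[yB yC iy].
      exists (lift ord_max y); first by rewrite inE -!oldE; rewrite ?inE yB.
      rewrite inE mll oldll mB.
      apply/andP; split; first by apply: indepS iy; apply: setUS; apply: subD1set.
      rewrite cardsU1 !inE (negPf yB) andbF /=; apply/eqP; rewrite -cB.
      by rewrite (cardsD1 j (old B)) jB.
  + move=> Bb; case: ifP => [mC /andP[iC /eqP cC]|mC Cb] /andP[jC jB].
    * exists ord_max; first by rewrite inE mB mC.
      rewrite inE mln oldln; apply/andP; split.
        by apply: indepS (base_indep Bb); apply: subD1set.
      by rewrite -(mrank_card Bb) (cardsD1 j (old B)) jB.
    * have [|y] := @bases_exchange _ M _ _ j Bb Cb; first by rewrite inE jC.
      rewrite !inE => /andP[yB yC yb]; exists (lift ord_max y); first by rewrite inE -!oldE; rewrite ?inE yB.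
      by rewrite inE mll oldll mB.
- move=> BM CM /andP[mC mB]; move: BM CM; rewrite mB (negPf mC) => /andP[iB /eqP cB] Cb.
  have [|y] := indep_augment iB (base_indep Cb); first by rewrite (mrank_card Cb) -cB.
  rewrite !inE => /andP[yB yC] iy; exists (lift ord_max y); first by rewrite inE -!oldE; rewrite ?inE yB.
  rewrite inE mnl oldnl; apply: indep_base => //.
  by rewrite cardsU1 inE (negPf yB).
Qed.

Definition free_ext : matroid n.+1 := Matroid free_ext_bases_neq0 free_ext_bases_exchange.

Lemma mrank_free_ext : mrank free_ext = mrank M.
Proof.
have /set0Pn[B Bb] := bases_neq0 M.
have E : old (lift ord_max @: B) = B.
  by apply/setP=> i; rewrite inE mem_imset //; apply: lift_inj.
have Db : lift ord_max @: B \in bases free_ext.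
  rewrite inE E Bb; case: imsetP => // [[i _ /eqP]]; by rewrite (negPf (neq_lift _ _)).
by rewrite -(mrank_card Db) -(mrank_card Bb) card_imset //; apply: lift_inj.
Qed.

End FreeExt.

Section ParallelExt.
Variables (n : nat) (M : matroid n) (e : 'I_n).

Definition collapse (i : 'I_n.+1) : 'I_n := odflt e (unlift ord_max i).

(* the new element is a copy of [e] *)
Definition parallel_ext_bases : {set {set 'I_n.+1}} :=
  [set B : {set 'I_n.+1} | [forall x in B, forall y in B, (collapse x == collapse y) ==> (x == y)]
                           && (collapse @: B \in bases M)].

Lemma collapse_lift i : collapse (lift ord_max i) = i.
Proof. by rewrite /collapse liftK. Qed.

Lemma collapseP (B : {set 'I_n.+1}) : reflect {in B &, injective collapse}
  [forall x in B, forall y in B, (collapse x == collapse y) ==> (x == y)].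
Proof.
apply: (iffP forall_inP) => [h x y xB yB /eqP E|h x xB].
  by move: (h x xB) => /forall_inP/(_ y yB)/implyP/(_ E)/eqP.
by apply/forall_inP=> y yB; apply/implyP=> /eqP /(h _ _ xB yB) ->.
Qed.

Lemma lift_base B : B \in bases M -> lift ord_max @: B \in parallel_ext_bases.
Proof.
move=> Bb; rewrite inE; apply/andP; split.
  apply/collapseP=> _ _ /imsetP[i _ ->] /imsetP[j _ ->].
  by rewrite !collapse_lift => ->.
rewrite -imset_comp (eq_imset (g := id)) ?imset_id // => i /=; exact: collapse_lift.
Qed.

Lemma parallel_ext_bases_neq0 : parallel_ext_bases != set0.
Proof.
by have /set0Pn[B Bb] := bases_neq0 M; apply/set0Pn; exists (lift ord_max @: B); apply: lift_base.
Qed.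

Lemma parallel_ext_bases_exchange B C x :
  B \in parallel_ext_bases -> C \in parallel_ext_bases -> x \in B :\: C ->
  exists2 y, y \in C :\: B & y |: B :\ x \in parallel_ext_bases.
Proof.
rewrite !inE => /andP[/collapseP iB Bb] /andP[/collapseP iC Cb] /andP[xC xB].
suff [y yC [yB yb]] : exists2 y, y \in C & collapse y \notin collapse @: (B :\ x) /\
    collapse y |: (collapse @: B) :\ collapse x \in bases M.
  have yNB : y \notin B.
    apply/negP=> yB'; move: yB; rewrite imset_f // !inE yB' andbT.
    by apply: contraNneq xC => <-.
  exists y; first by rewrite inE yC yNB.
  rewrite inE; apply/andP; split.
    apply/collapseP=> u v; rewrite !inE.
    case/orP=> [/eqP->|/andP[ux uB]] /orP[/eqP->|/andP[vx vB]] // E; last exact: iB.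
      by case/negP: yB; rewrite E imset_f // !inE vx.
    by case/negP: yB; rewrite -E imset_f // !inE ux.
  rewrite imsetU1; suff -> : collapse @: (B :\ x) = (collapse @: B) :\ collapse x by [].
  apply/setP=> z; rewrite !inE; apply/imsetP/andP => [[u]|[zx /imsetP[u uB zu]]].
    rewrite !inE => /andP[ux uB] ->; split; last exact: imset_f.
    by apply: contraNneq ux => /(iB _ _ uB xB) ->.
  by exists u => //; rewrite !inE uB andbT; apply: contraNneq zx => <-; apply/eqP.
case: (boolP (collapse x \in collapse @: C)) => xC'.
  case/imsetP: (xC') => y yC xy; exists y => //; rewrite -xy; split.
    apply/imsetP=> [[u]]; rewrite !inE => /andP[ux uB] /(iB _ _ xB uB) E.
    by rewrite E eqxx in ux.
  by rewrite setD1K // imset_f.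
have [|y'] := @bases_exchange _ M _ _ (collapse x) Bb Cb.
  by rewrite inE xC' imset_f.
rewrite inE => /andP[yB /imsetP[y yC E]] yb; rewrite E in yB yb.
exists y => //; split=> //; apply: contra yB; apply/subsetP/imsetS; exact: subD1set.
Qed.

Definition parallel_ext : matroid n.+1 :=
  Matroid parallel_ext_bases_neq0 parallel_ext_bases_exchange.

Lemma mrank_parallel_ext : mrank parallel_ext = mrank M.
Proof.
have /set0Pn[B Bb] := bases_neq0 M.
have Db : lift ord_max @: B \in bases parallel_ext by apply: lift_base.
by rewrite -(mrank_card Db) -(mrank_card Bb) card_imset //; apply: lift_inj.
Qed.

End ParallelExt.

Definition series_ext n (M : matroid n) (e : 'I_n) : matroid n.+1 :=
  dual (parallel_ext (dual M) e).

(* [f = n] (the image of the new element of [free_ext M]) and [s = n.+1]. *)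
Definition series_free_lift n (M : matroid n) : matroid n.+2 :=
  series_ext (free_ext M) ord_max.

Lemma mrank_series_free_lift n (M : matroid n) :
  mrank (series_free_lift M) = (mrank M).+1.
Proof.
rewrite mrank_dual mrank_parallel_ext mrank_dual mrank_free_ext.
by rewrite subnBA ?(leqW (mrank_le M)) // addSnnS addKn.
Qed.

(* Imported only here: [all_classical] shadows [set0], [setT] of finset. *)
From mathcomp Require Import all_classical all_reals all_analysis.
From mathcomp Require Import ring lra.
Import Order.TTheory GRing.Theory Num.Theory.
Import numFieldNormedType.Exports.

Local Open Scope classical_set_scope.
Local Open Scope ring_scope.

Section Convexity.
Variable R : realType.

(* [U] is the linear span of [A] *)
Definition spans (E : vectType R) (A : set E) (U : {vspace E}) : Prop :=
  (forall x, A x -> x \in U) /\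
  forall W : {vspace E}, (forall x, A x -> x \in W) -> (U <= W)%VS.

Definition conv_hull (T : finType) (E : lmodType R) (v : T -> E) : set E :=
  [set x | exists a : T -> R,
    [/\ forall i, 0 <= a i, \sum_i a i = 1 & x = \sum_i a i *: v i]].

Definition aff_hull (E : lmodType R) (A : set E) : set E :=
  [set x | exists k (a : 'I_k -> R) (v : 'I_k -> E),
    [/\ forall i, A (v i), \sum_i a i = 1 & x = \sum_i a i *: v i]].

Variable n : nat.
Implicit Types (P Q C D F H : set 'rV[R]_n) (Sigma : set (set 'rV[R]_n)).

Definition dotp (a x : 'rV[R]_n) : R := \sum_i a 0 i * x 0 i.

(* affine dimension; it is not defined for the empty set *)
Definition has_dim P (r : nat) : Prop :=
  P !=set0 /\ exists2 U, spans [set x - y | x in P & y in P] U & \dim U = r.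

Definition relint P : set 'rV[R]_n :=
  [set x | P x /\ \forall y \near x, aff_hull P y -> P y].

Definition polytope P : Prop :=
  exists k (v : 'I_k -> 'rV[R]_n), P = conv_hull v.

(* both the empty set and [P] are faces of [P] *)
Definition face P F : Prop := exists (a : 'rV[R]_n) (c : R),
  (forall x, P x -> dotp a x <= c) /\ F = [set x | P x /\ dotp a x = c].

Definition facet P F : Prop :=
  face P F /\ exists r, has_dim P r.+1 /\ has_dim F r.

Definition vertex P (x : 'rV[R]_n) : Prop := face P [set x].

Definition subdivision P Sigma : Prop :=
  [/\ finite_set Sigma,
      forall C, Sigma C -> polytope C,
      forall C F, Sigma C -> face C F -> Sigma F,
      forall C D, Sigma C -> Sigma D -> face C (C `&` D) /\ face D (C `&` D) &
      \bigcup_(C in Sigma) C = P].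

Definition no_new_vertices P Sigma : Prop :=
  forall C x, Sigma C -> vertex C x -> vertex P x.

Definition maximal_cell Sigma C : Prop :=
  Sigma C /\ forall D, Sigma D -> C `<=` D -> D = C.

Definition is_split P Sigma C D : Prop :=
  [/\ subdivision P Sigma, no_new_vertices P Sigma, C <> D &
      forall E, maximal_cell Sigma E <-> E = C \/ E = D].

(* Hyperplanes are taken in the ambient space: the split hyperplane, a subspace
   of the affine hull of [P], is cut out by [H]. *)
Definition defines_split P H : Prop :=
  exists Sigma C D, is_split P Sigma C D /\
    H `&` aff_hull P = aff_hull (C `&` D).

End Convexity.

Section SplitMatroid.
Variable R : realType.

Definition indic n (S : {set 'I_n}) : 'rV[R]_n := \row_i (i \in S)%:R.

Definition matroid_polytope n (M : matroid n) : set 'rV[R]_n :=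
  conv_hull (fun B : {B : {set 'I_n} | B \in bases M} => indic (val B)).

Definition hypersimplex (d n : nat) : set 'rV[R]_n :=
  [set x | (forall i, 0 <= x 0 i <= 1) /\ \sum_i x 0 i = d%:R].
Arguments hypersimplex : clear implicits.

Variables (n : nat) (M : matroid n).
Implicit Types F G : {set 'I_n}.

Definition flat_face F : set 'rV[R]_n :=
  [set x | matroid_polytope M x /\ \sum_(i in F) x 0 i = (rk M F)%:R].

Definition flacet F : Prop :=
  [/\ flat M F, facet (matroid_polytope M) (flat_face F) &
      forall G, flat M G -> G \proper F -> flat_face G <> flat_face F].

Definition flat_hyperplane F : set 'rV[R]_n :=
  [set x | ((mrank M)%:R - (rk M F)%:R) * \sum_(i in F) x 0 i
           = (rk M F)%:R * \sum_(j | j \notin F) x 0 j].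

Definition split_flacet F : Prop :=
  flacet F /\ defines_split (hypersimplex (mrank M) n) (flat_hyperplane F).

Definition split_matroid : Prop :=
  mconnected M /\
  forall F G, split_flacet F -> split_flacet G -> F <> G ->
    flat_hyperplane F `&` flat_hyperplane G `&` relint (hypersimplex (mrank M) n)
    = set0.

End SplitMatroid.

(* The vertices of the hypersimplex are indexed by the [k]-subsets of ['I_m]. *)
Definition ksub (k m : nat) := {S : {set 'I_m} | #|S| == k}.

Section Dressian.
Variables (R : realType) (k m : nat).
Local Notation lifting := {ffun ksub k m -> R^o}.
Implicit Types w u : lifting.

Definition lifted_polytope w : set ('rV[R]_m * R^o) :=
  conv_hull (fun S : ksub k m => (indic R (val S), w S)).

(* The cells are the nonempty lower faces of the lifted polytope, projected:
   [(a, b)] is the inner normal of a supporting hyperplane. *)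
Definition regular_subdivision w : set (set 'rV[R]_m) :=
  [set C | exists (a : 'rV[R]_m) (b c : R),
    [/\ 0 < b,
        forall p, lifted_polytope w p -> c <= dotp a p.1 + b * p.2,
        C = [set p.1 | p in
              [set p | lifted_polytope w p /\ dotp a p.1 + b * p.2 = c]] &
        C !=set0]].

(* the relatively open cone of the secondary fan that contains [w] *)
Definition secondary_cone w : set lifting :=
  [set w' | regular_subdivision w' = regular_subdivision w].

(* the directions along which every cone of the secondary fan is invariant *)
Definition secondary_lineality : set lifting :=
  [set u | forall w (c : R),
    regular_subdivision (w + c *: u) = regular_subdivision w].

Definition dressian : set lifting :=
  [set w | forall C, regular_subdivision w C ->
    exists N : matroid m, mrank N = k /\ C = matroid_polytope N].

(* the cone containing [w] has dimension one modulo lineality *)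
Definition spans_ray w : Prop :=
  exists U L : {vspace lifting},
    [/\ spans (secondary_cone w) U, spans secondary_lineality L &
        \dim U = (\dim L).+1].

Definition ray_of_dressian w : Prop := dressian w /\ spans_ray w.

Definition corank_vector (N : matroid m) : lifting :=
  [ffun S => k%:R - (rk N (val S))%:R].

End Dressian.

Definition puiseux_supp (K : fieldType) (f : rat -> K) : Prop :=
  exists2 N : nat, (0 < N)%N & exists b : rat, forall q, f q != 0 ->
    b <= q /\ q * N%:R \is a Num.int.

(* [sum_q (pcoef x q) t^q]; the exponents have a common denominator and are
   bounded below. *)
Record puiseux (K : fieldType) := Puiseux {
  pcoef :> rat -> K;
  pcoefP : `[< puiseux_supp pcoef >] }.

Section PuiseuxRing.
Variable K : fieldType.
Local Notation P := (puiseux K).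

HB.instance Definition _ := [isSub for @pcoef K].
HB.instance Definition _ := [Choice of P by <:].

Lemma puiseux_suppP (x : P) : puiseux_supp x.
Proof. by case: x => f /= /asboolP. Qed.

Lemma pext (x y : P) : (forall q, x q = y q) -> x = y.
Proof. by move=> h; apply: val_inj; apply/funext. Qed.

Lemma supp2 (f g : rat -> K) : puiseux_supp f -> puiseux_supp g ->
  exists2 N : nat, (0 < N)%N & exists b : rat, forall q, (f q != 0) || (g q != 0) ->
    b <= q /\ q * N%:R \is a Num.int.
Proof.
move=> [N N0 [b hf]] [N' N'0 [b' hg]]; exists (N * N')%N; first by rewrite muln_gt0 N0.
exists (Num.min b b') => q /orP[/hf|/hg] [bq qN]; rewrite ge_min bq ?orbT natrM; split=> //.
  by rewrite mulrA rpredM // natr_int.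
by rewrite mulrCA rpredM // natr_int.
Qed.

Lemma grid_finite (N : nat) (b c : rat) : (0 < N)%N ->
  finite_set [set q : rat | b <= q <= c /\ q * N%:R \is a Num.int].
Proof.
move=> N0; have N0' : (N%:R : rat) != 0 by rewrite pnatr_eq0 -lt0n.
have N0r : 0 < (N%:R : rat) by rewrite ltr0n.
pose k0 := Num.floor (b * N%:R).
pose m := (Num.trunc (c * N%:R - k0%:~R)).+1.
apply: (@sub_finite_set _ _ ((fun i : nat => (k0%:~R + i%:R) / N%:R) @` `I_m)); last first.
  exact/finite_image/finite_II.
move=> q /= [/andP[bq qc] /intrP[k qN]].
have k0k : k0 <= k.
  by rewrite -(ler_int rat) -qN; apply: le_trans (floor_le _) _; rewrite ler_pM2r.
exists `|k - k0|%N; last first.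
  rewrite -[LHS]/((k0%:~R + (`|k - k0|%N)%:R) / N%:R) natr_absz ger0_norm ?subr_ge0 //.
  by rewrite intrB addrC subrK -qN mulfK.
rewrite /m ltnS -(ler_nat rat).
have -> : ((`|k - k0|%N)%:R : rat) = q * N%:R - k0%:~R.
  by rewrite natr_absz ger0_norm ?subr_ge0 // intrB qN.
have : q * N%:R - k0%:~R <= c * N%:R - k0%:~R by rewrite lerD2r ler_pM2r.
rewrite qN -intrB -[k - k0]gez0_abs ?subr_ge0 // -pmulrn.
move=> h; rewrite ler_nat -ltnS -(ltr_nat rat); apply: le_lt_trans h _.
apply: truncnS_gt.
Qed.

Definition cauchy (f g : rat -> K) (q : rat) : K := \sum_(p \in [set: rat]) f p * g (q - p).

Lemma cauchy_grid f g N b : (0 < N)%N ->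
  (forall q, (f q != 0) || (g q != 0) -> b <= q /\ q * N%:R \is a Num.int) ->
  forall q c, q - b <= c ->
  cauchy f g q = \sum_(p \in [set p | b <= p <= c /\ p * N%:R \is a Num.int]) f p * g (q - p).
Proof.
move=> N0 h q c qc; apply/esym/fsbig_widen => // p [_ /=].
move=> np; apply: contra_notP np => /eqP; rewrite mulf_eq0 negb_or => /andP[fp gp].
have [bp pN] : b <= p /\ p * N%:R \is a Num.int by apply: h; rewrite fp.
split=> //; rewrite bp /=.
have [bq _] : b <= q - p /\ (q - p) * N%:R \is a Num.int by apply: h; rewrite gp orbT.
by apply: le_trans qc; lra.
Qed.

Lemma cauchy_neq0 f g q : cauchy f g q != 0 -> exists p, (f p != 0) && (g (q - p) != 0).
Proof.
apply: contra_neqP => /forallNP h; apply: fsbig1 => p _; apply/eqP.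
by rewrite mulf_eq0; move/negP: (h p); rewrite negb_and !negbK.
Qed.

Lemma cauchy_supp f g : puiseux_supp f -> puiseux_supp g -> puiseux_supp (cauchy f g).
Proof.
move=> sf sg; have [N N0 [b h]] := supp2 sf sg; exists N => //; exists (b + b) => q.
case/cauchy_neq0 => p /andP[fp gp].
have [bp pN] : b <= p /\ p * N%:R \is a Num.int by apply: h; rewrite fp.
have [bq qN] : b <= q - p /\ (q - p) * N%:R \is a Num.int by apply: h; rewrite gp orbT.
by split; first lra; rewrite -(subrK p q) mulrDl rpredD.
Qed.

Lemma cauchyC f g : cauchy f g = cauchy g f.
Proof.
apply/funext => q; rewrite /cauchy (reindex_fsbigT (fun p => q - p)).
  by apply: eq_fsbigr => p _; rewrite subKr mulrC.
by exists (fun p => q - p) => p; rewrite subKr.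
Qed.

Lemma supp3 (f g h : rat -> K) : puiseux_supp f -> puiseux_supp g -> puiseux_supp h ->
  exists2 N : nat, (0 < N)%N & exists b : rat, forall q,
    [|| f q != 0, g q != 0 | h q != 0] -> b <= q /\ q * N%:R \is a Num.int.
Proof.
move=> sf sg [N' N'0 [b' hh]]; have [N N0 [b hfg]] := supp2 sf sg.
exists (N * N')%N; first by rewrite muln_gt0 N0.
exists (Num.min b b') => q; rewrite orbA => /orP[/hfg|/hh] [bq qN];
  rewrite ge_min bq ?orbT natrM; split=> //.
  by rewrite mulrA rpredM // natr_int.
by rewrite mulrCA rpredM // natr_int.
Qed.

Lemma fsum_widen (A : set rat) (F : rat -> K) :
  (forall p, F p != 0 -> A p) -> \sum_(p \in [set: rat]) F p = \sum_(p \in A) F p.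
Proof.
move=> h; apply/esym/fsbig_widen => // p [_ /= np].
by apply: contra_notP np => /eqP/h.
Qed.

Lemma cauchyA f g h : puiseux_supp f -> puiseux_supp g -> puiseux_supp h ->
  cauchy f (cauchy g h) = cauchy (cauchy f g) h.
Proof.
move=> sf sg sh; have [N N0 [b H]] := supp3 sf sg sh; apply/funext => q.
have Hf p : f p != 0 -> b <= p /\ p * N%:R \is a Num.int by move=> E; apply: H; rewrite E.
have Hg p : g p != 0 -> b <= p /\ p * N%:R \is a Num.int by move=> E; apply: H; rewrite E orbT.
have Hh p : h p != 0 -> b <= p /\ p * N%:R \is a Num.int by move=> E; apply: H; rewrite E !orbT.
pose A := [set p : rat | Num.min b (b + b) <= p <= Num.max (q - b) (q - b - b) /\ p * N%:R \is a Num.int].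
have fA : finite_set A by apply: grid_finite.
have E1 r : cauchy g h (q - r) = \sum_(p \in [set: rat]) g (p - r) * h (q - p).
  rewrite /cauchy (reindex_fsbigT (fun p => p - r)); last first.
    by exists (fun p => p + r) => p; [rewrite subrK | rewrite addrK].
  by apply: eq_fsbigr => p _; congr (_ * h _); ring.
have -> : cauchy f (cauchy g h) q = \sum_(r \in A) \sum_(p \in A) f r * (g (p - r) * h (q - p)).
  transitivity (\sum_(r \in A) f r * cauchy g h (q - r)).
    apply: fsum_widen => p; rewrite mulf_eq0 negb_or => /andP[/Hf[bp pN]].
    case/cauchy_neq0 => r /andP[/Hg[br rN] /Hh[bs sN]].
    by split=> //; rewrite ge_min bp le_max /=; apply/orP; right; lra.
  apply: eq_fsbigr => r _; rewrite E1 -mulr_fsumr.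
  have [->|/Hf[br rN]] := eqVneq (f r) 0; first by rewrite !mul0r.
  congr (_ * _); apply: fsum_widen => p.
  rewrite mulf_eq0 negb_or => /andP[/Hg[bp pN] /Hh[bs sN]]; split.
    by rewrite ge_min le_max; apply/andP; split; apply/orP; [right|left]; lra.
  by rewrite -(subrK r p) mulrDl rpredD.
rewrite exchange_fsbig //; apply/esym.
transitivity (\sum_(p \in A) cauchy f g p * h (q - p)).
  apply: fsum_widen => p; rewrite mulf_eq0 negb_or => /andP[].
  case/cauchy_neq0 => r /andP[/Hf[br rN] /Hg[bs sN]] /Hh[bt tN].
  split; last by rewrite -(subrK r p) mulrDl rpredD.
  by rewrite ge_min le_max; apply/andP; split; apply/orP; [right|left]; lra.
apply: eq_fsbigr => p _.
have [->|/Hh[bt tN]] := eqVneq (h (q - p)) 0.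
  by rewrite mulr0 fsbig1 // => r _; rewrite !mulr0.
under [in RHS]eq_fsbigr do rewrite mulrA.
rewrite -mulr_fsuml; congr (_ * _); apply: fsum_widen => r.
rewrite mulf_eq0 negb_or => /andP[/Hf[br rN] /Hg[bs sN]]; split=> //.
by rewrite ge_min br le_max /=; apply/orP; right; lra.
Qed.

Lemma cauchyDl f g h : puiseux_supp f -> puiseux_supp g -> puiseux_supp h ->
  cauchy (f \+ g) h = cauchy f h \+ cauchy g h.
Proof.
move=> sf sg sh; have [N N0 [b H]] := supp3 sf sg sh; apply/funext => q /=.
have fA := @grid_finite N b (q - b) N0.
have fE (f' : rat -> K) : (forall p, f' p != 0 -> [|| f p != 0, g p != 0 | h p != 0]) ->
    cauchy f' h q = \sum_(p \in [set p | b <= p <= q - b /\ p * N%:R \is a Num.int]) f' p * h (q - p).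
  by move=> sf'; apply: cauchy_grid => // p /orP[/sf'|E]; last (by apply: H; rewrite E !orbT); apply: H.
rewrite !fE -?fsbig_split //; first by apply: eq_fsbigr => p _; rewrite mulrDl.
- by move=> p ->; rewrite orbT.
- by move=> p ->.
move=> p; apply: contraTT; rewrite !negb_or !negbK.
by case/and3P => /eqP E1 /eqP E2 _; rewrite /= E1 E2 addr0.
Qed.

Definition monomial (c : K) (r : rat) : rat -> K := fun q => if q == r then c else 0.

Lemma monomial_supp c r : puiseux_supp (monomial c r).
Proof.
exists `|denq r|%N; first by rewrite absz_gt0 denq_neq0.
exists r => q; rewrite /monomial; case: (q =P r) => [->|_]; last by rewrite eqxx.
split=> //; rewrite natr_absz ger0_norm ?denq_ge0 //.
by rewrite -numqE intr_int.
Qed.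

Lemma cauchy1 f : cauchy (monomial 1 0) f = f.
Proof.
apply/funext => q; rewrite /cauchy (fsum_widen (A := [set 0])).
  by rewrite fsbig_set1 /monomial eqxx mul1r subr0.
by move=> p; rewrite /monomial; case: (p =P 0) => // _; rewrite mul0r eqxx.
Qed.

Lemma add_supp (f g : rat -> K) : puiseux_supp f -> puiseux_supp g -> puiseux_supp (f \+ g).
Proof.
move=> sf sg; have [N N0 [b H]] := supp2 sf sg; exists N => //; exists b => q E; apply: H.
by move: E; apply: contraTT; rewrite !negb_or !negbK => /andP[/eqP /= -> /eqP ->]; rewrite addr0.
Qed.

Lemma opp_supp (f : rat -> K) : puiseux_supp f -> puiseux_supp (\- f).
Proof. by move=> [N N0 [b H]]; exists N => //; exists b => q; rewrite oppr_eq0; apply: H. Qed.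

Definition mkP f (sf : puiseux_supp f) : P := @Puiseux K f (asboolT sf).

Definition pzero : P := mkP (monomial_supp 0 0).
Definition padd (x y : P) : P := mkP (add_supp (puiseux_suppP x) (puiseux_suppP y)).
Definition popp (x : P) : P := mkP (opp_supp (puiseux_suppP x)).

Lemma paddA : associative padd.
Proof. by move=> x y z; apply: pext => q; apply: addrA. Qed.
Lemma paddC : commutative padd.
Proof. by move=> x y; apply: pext => q; apply: addrC. Qed.
Lemma padd0 : left_id pzero padd.
Proof. by move=> x; apply: pext => q; rewrite /= /monomial if_same add0r. Qed.
Lemma paddN : left_inverse pzero popp padd.
Proof. by move=> x; apply: pext => q; rewrite /= /monomial if_same addNr. Qed.

HB.instance Definition _ := GRing.isZmodule.Build P paddA paddC padd0 paddN.

Definition pone : P := mkP (monomial_supp 1 0).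
Definition pmul (x y : P) : P := mkP (cauchy_supp (puiseux_suppP x) (puiseux_suppP y)).

Lemma pmulA : associative pmul.
Proof. by move=> x y z; apply: val_inj; apply: cauchyA; apply: puiseux_suppP. Qed.
Lemma pmulC : commutative pmul.
Proof. by move=> x y; apply: val_inj; apply: cauchyC. Qed.
Lemma pmul1 : left_id pone pmul.
Proof. by move=> x; apply: val_inj; apply: cauchy1. Qed.
Lemma pmulD : left_distributive pmul +%R.
Proof. by move=> x y z; apply: val_inj; apply: cauchyDl; apply: puiseux_suppP. Qed.
Lemma pone_neq0 : pone != 0.
Proof.
apply/eqP => /(congr1 (fun x : P => x 0)) /eqP.
by rewrite /= /monomial eqxx oner_eq0.
Qed.

HB.instance Definition _ :=
  GRing.Zmodule_isComNzRing.Build P pmulA pmulC pmul1 pmulD pone_neq0.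

Lemma pcoefD (x y : P) q : (x + y) q = x q + y q. Proof. by []. Qed.
Lemma pcoef0 q : (0 : P) q = 0. Proof. exact: if_same. Qed.
Lemma pcoefM (x y : P) q : (x * y) q = \sum_(p \in [set: rat]) x p * y (q - p).
Proof. by []. Qed.

Definition lowest (x : P) (q : rat) : Prop := x q != 0 /\ forall p, x p != 0 -> q <= p.

Lemma lowest_ex x : x != 0 -> exists q, lowest x q.
Proof.
move=> x0; have [q0 xq0] : exists q, x q != 0.
  by apply: contrapT => /forallNP h; move/eqP: x0; apply; apply: pext => q; rewrite pcoef0;
    apply/eqP/negPn/negP/h.
have [N N0 [b H]] := puiseux_suppP x.
have N0' : (N%:R : rat) != 0 by rewrite pnatr_eq0 -lt0n.
have N0r : 0 < (N%:R : rat) by rewrite ltr0n.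
pose e (i : nat) : rat := ((Num.floor (b * N%:R))%:~R + i%:R) / N%:R.
have xe p : x p != 0 -> exists i, p = e i.
  move=> /H[bp pN]; have : p * N%:R - (Num.floor (b * N%:R))%:~R \is a Num.nat.
    rewrite natrEint rpredB ?intr_int //= subr_ge0.
    by apply: le_trans (floor_le _) _; rewrite ler_pM2r.
  by case/natrP=> i E; exists i; rewrite /e -E addrC subrK mulfK.
have ex : exists i, x (e i) != 0 by have [i E] := xe _ xq0; exists i; rewrite -E.
exists (e (ex_minn ex)); case: ex_minnP => m xm hm; split=> // p xp.
have [i E] := xe _ xp; rewrite E ler_pM2r ?invr_gt0 // lerD2l ler_nat hm // -E //.
Qed.

Fixpoint inv_table (a : nat -> K) (n : nat) : nat -> K :=
  if n is n'.+1 then fun k => if (k <= n')%N then inv_table a n' k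
    else - (a 0%N)^-1 * \sum_(i < n'.+1) a i.+1 * inv_table a n' (n' - i)%N
  else fun=> (a 0%N)^-1.

Lemma power_series_inv (a : nat -> K) : a 0%N != 0 ->
  exists b : nat -> K, forall n, \sum_(i < n.+1) a i * b (n - i)%N = (n == 0%N)%:R.
Proof.
move=> a0; pose b n := inv_table a n n.
have tE n k : (k <= n)%N -> inv_table a n k = b k.
  elim: n => [|n IH]; first by rewrite leqn0 => /eqP->.
  by rewrite leq_eqVlt => /orP[/eqP->//|]; rewrite ltnS /= => kn; rewrite kn IH.
exists b => -[|n]; first by rewrite big_ord1 subn0 /b /= mulfV.
rewrite big_ord_recl subn0 {1}/b /= ltnn mulNr mulrN mulrA mulfV // mul1r addrC.
apply/eqP; rewrite subr_eq0; apply/eqP/eq_bigr => i _.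
by rewrite /bump /= ?add1n ?subSS tE ?leq_subr.
Qed.

Lemma pinv_ex (x : P) : x != 0 -> exists y : P, y * x = 1.
Proof.
move=> /lowest_ex[q0 [xq0 low]]; have [N N0 [b0 H]] := puiseux_suppP x.
have N0' : (N%:R : rat) != 0 by rewrite pnatr_eq0 -lt0n.
have N0r : 0 < (N%:R : rat) by rewrite ltr0n.
pose e (i : nat) : rat := q0 + i%:R / N%:R.
have e0 : e 0%N = q0 by rewrite /e mul0r addr0.
have [b hb] : exists b : nat -> K, forall n, \sum_(i < n.+1) x (e i) * b (n - i)%N = (n == 0%N)%:R.
  by apply: (@power_series_inv (fun i => x (e i))); rewrite /= e0.
pose g q := let r := (q + q0) * N%:R in if r \is a Num.nat then b (Num.trunc r) else 0.
have ge (i : nat) : g (i%:R / N%:R - q0) = b i.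
  by rewrite /g subrK divfK // natr_nat natrK.
have gN q : g q != 0 -> exists i : nat, q = i%:R / N%:R - q0.
  rewrite /g; case: ifP => [/natrP[i E] _|_]; last by rewrite eqxx.
  by exists i; rewrite -E mulfK // addrK.
have xe p : x p != 0 -> exists i : nat, p = e i.
  move=> xp; have [_ pN] := H _ xp; have [_ qN] := H _ xq0.
  have : (p - q0) * N%:R \is a Num.nat.
    by rewrite natrEint mulrBl rpredB //= -mulrBl mulr_ge0 ?ler0n // subr_ge0 low.
  by case/natrP=> i E; exists i; rewrite /e -E mulfK // addrC subrK.
have sg : puiseux_supp g.
  exists N => //; exists (- q0) => q /gN[i ->]; split.
    by rewrite lerDr divr_ge0 ?ler0n.
  have [_ qN] := H _ xq0.
  by rewrite mulrBl divfK // rpredB ?natr_int.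
exists (mkP sg); rewrite mulrC; apply: pext => q; rewrite pcoefM /= /monomial.
have [[n qn]|Nq] := pselect (exists n : nat, q = n%:R / N%:R).
  have einj : injective e.
    by move=> i j /addrI /(mulIf (invr_neq0 N0')) /eqP; rewrite eqr_nat => /eqP.
  rewrite (fsum_widen (A := e @` `I_n.+1)).
    rewrite fsbig_image; last by move=> i j _ _; apply: einj.
    rewrite -fsbig_ord; transitivity ((n == 0%N)%:R : K); last first.
      by rewrite qn mulf_eq0 invr_eq0 (negPf N0') orbF pnatr_eq0; case: eqP.
    rewrite -hb; apply: eq_bigr => i _; congr (_ * _).
    rewrite -ge natrB ?leq_ord // qn /e; congr g; rewrite mulrBl; ring.
  move=> p; rewrite mulf_eq0 negb_or => /andP[/xe[i ->] /gN[j E]]; exists i => //=.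
  have : ((i + j)%N%:R : rat) = n%:R.
    have jE : j%:R / N%:R = n%:R / N%:R - i%:R / N%:R :> rat by rewrite -[LHS](subrK q0) -E qn /e; ring.
    by apply: (mulIf (invr_neq0 N0')); rewrite natrD mulrDl jE; ring.
  by move/eqP; rewrite eqr_nat ltnS => /eqP <-; apply: leq_addr.
rewrite fsbig1; first by case: eqP => // q00; case: Nq; exists 0%N; rewrite mul0r.
move=> p _; apply/eqP; apply: contra_notT Nq; rewrite mulf_eq0 negb_or.
case/andP => /xe[i pE] /gN[j E]; exists (i + j)%N.
have jE : j%:R / N%:R = q - i%:R / N%:R :> rat by rewrite -[LHS](subrK q0) -E pE /e; ring.
by rewrite natrD mulrDl jE; ring.
Qed.

Definition pinv (x : P) : P := xget 0 [set y | y * x = 1 \/ (x = 0 /\ y = 0)].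

Lemma pmulV (x : P) : x != 0 -> pinv x * x = 1.
Proof.
move=> x0; have [y yx] := pinv_ex x0.
have : [set y | y * x = 1 \/ (x = 0 /\ y = 0)] (pinv x) by apply: (xgetI _ (x := y)); left.
by case=> // -[E]; rewrite E eqxx in x0.
Qed.

Lemma pinv0 : pinv 0 = 0.
Proof.
have : [set y : P | y * 0 = 1 \/ (0 = 0 :> P /\ y = 0)] (pinv 0) by apply: (xgetI _ (x := 0)); right.
by case=> [/eqP|[]//]; rewrite mulr0 eq_sym oner_eq0.
Qed.

HB.instance Definition _ := GRing.ComNzRing_isField.Build P pmulV pinv0.

Definition pval (x : P) : \bar rat := xget +oo%E [set v | exists2 q, lowest x q & v = q%:E].

Lemma lowest_inj x p q : lowest x p -> lowest x q -> p = q.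
Proof.
by case=> xp hp [xq hq]; apply/eqP; rewrite eq_le hp // hq.
Qed.

Lemma pvalP x q : pval x = q%:E <-> lowest x q.
Proof.
rewrite /pval; case: xgetP => [v _ [p lp ->]|h]; split=> //.
- by case=> <-.
- by move=> /(lowest_inj lp) ->.
- by move=> lq; case: (h q%:E); exists q.
Qed.

End PuiseuxRing.

Definition realizable (F : fieldType) n (M : matroid n) : Prop :=
  exists r (A : 'M[F]_(r, n)), forall S : {set 'I_n},
    indep M S = (\rank (colsub (@enum_val _ (mem S)) A) == #|S|).

(* the elements of [S] in increasing order *)
Definition ksub_enum k m (S : ksub k m) (j : 'I_k) : 'I_m :=
  enum_val (cast_ord (esym (eqP (valP S))) j).

Definition liftable (R : realType) (K : fieldType) k m
    (w : {ffun ksub k m -> R^o}) : Prop :=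
  exists A : 'M[puiseux K]_(k, m), forall S : ksub k m,
    exists2 q : rat, pval (\det (colsub (ksub_enum S) A)) = q%:E & ratr q = w S.

(* Main.v *)
Require Import Defs.
From HB Require Import structures.
From mathcomp Require Import all_boot all_order all_algebra fingroup perm.
From mathcomp Require Import zify ring lra.
Set Implicit Arguments. Unset Strict Implicit. Unset Printing Implicit Defensive.

(** Write [N] for the series-free lift of [M] and [d] for the rank of [M].

    Ray: by compatibility of the splits, every nonbasis [S] of [N] has corank
    [#|S :&: F| - rk F] for the whole ground set [F] of [M] or for some [F]
    defining a split facet of [M].  A lifting function with the same regular
    subdivision can be normalised to vanish on the bases of [N]; on the cell of
    each [F] it is then a multiple of the corank vector, since a linear form that
    is constant on the facet of [N] given by [F] is a combination of the two
    indicator vectors.  Every cell shares a nonbasis with the cell of the whole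
    ground set, so all the factors agree.

    Lifting: if the rows of [A] represent [M] and [v] is generic, then the rows
    [(0, a_i)], [(1, 0)], [(1, v)] represent [N], and perturbing the transpose by [t]
    times a generic matrix gives every maximal minor the corank as its valuation.
    Conversely, normalise a lift so that a basis of [N] becomes the identity.  Its
    entries are then minors, hence of nonnegative valuation, and their residues
    represent [N], hence also its restriction [M]. *)

(** The geometry of splits is used only through combinatorics. A split set is a proper nonempty [F]
    with M|F and M/F connected, [rk F < #|F|] and [rk F < d]. Each one is a split flacet, and an
    interior point lying on the hyperplanes of two of them can be written down unless
    [#|F :&: G| + d <= rk F + rk G]. This inequality says that the amounts by which a set [T]
    exceeds the ranks of [F] and of [G] add up to at most [#|T| - d]. Hence a set of size [d]
    exceeds at most one split set, and repairing that one leaves a basis; this is why a single [F]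
    accounts for the whole corank.

    That a nonbasis exceeds some [F] at all is shown by walking from the barycenter of the bases
    towards it and uncrossing the rank inequalities that become tight.

    The two new elements make every set of [d + 1] old elements a nonbasis of [N]. The cell of the
    old ground set therefore meets the cell of each split set in a nonbasis, which is what ties the
    otherwise independent factors together. *)

(** * Rank, connectivity and facets of matroid polytopes *)

(* Generalizing first makes the atoms syntactically equal, which [lia] needs. *)
Ltac rank_lia := clear; repeat match goal with
  | |- context [Defs.rk ?M ?S] => move: (Defs.rk M S) => ?
  | |- context [#|?A|] => move: #|A| => ?
  end; lia.

Section Rank.
Variables (n : nat) (M : matroid n).
Implicit Types (S I J B C X Y : {set 'I_n}).
Local Notation rk := (rk M).
Local Notation d := (mrank M).

Lemma rk_ge B S : B \in bases M -> #|B :&: S| <= rk S.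
Proof. by move=> Bb; apply: (leq_bigmax_cond (F := fun B => #|B :&: S|)). Qed.

Lemma rk_attained S : exists2 B, B \in bases M & #|B :&: S| = rk S.
Proof.
have /set0Pn[B Bb] := bases_neq0 M.
by exists [arg max_(C > B in bases M) #|C :&: S|]; rewrite /rk ?(bigmax_eq_arg _ Bb) //;
  case: arg_maxnP.
Qed.

(** Augmenting [I] from a basis that is optimal for [S] adds outside [S] only elements of that
    basis. The part outside [S] cannot exceed that of the optimal basis, so the part inside stays
    maximal. *)
Lemma indep_extend_in I S : indep M I -> I \subset S ->
  exists B, [/\ B \in bases M, I \subset B & #|B :&: S| = rk S].
Proof.
move=> iI sIS; have [B0 B0b rB0] := rk_attained S.
have [B Bb /andP[sIB sB]] := indep_extend iI B0b; exists B; split=> //.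
apply/eqP; rewrite eqn_leq rk_ge // -rB0.
have: #|B :\: S| <= #|B0 :\: S|.
  apply/subset_leq_card/subsetP => x; rewrite !inE => /andP[xS /(subsetP sB)].
  by rewrite inE (negPf xS) => /orP[/(subsetP sIS)|//]; rewrite (negPf xS).
have := bases_card Bb B0b; have := cardsID S B; have := cardsID S B0; lia.
Qed.

Lemma rk_le_card S : rk S <= #|S|.
Proof. by have [B _ <-] := rk_attained S; apply/subset_leq_card/subsetIr. Qed.

Lemma rkS X Y : X \subset Y -> rk X <= rk Y.
Proof.
move=> sXY; have [B Bb <-] := rk_attained X.
exact: leq_trans (subset_leq_card (setIS B sXY)) (rk_ge Y Bb).
Qed.

Lemma rk_le_mrank S : rk S <= d.
Proof. exact/rkS/subsetT. Qed.

Lemma rk0 : rk set0 = 0.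
Proof. by apply/eqP; rewrite -leqn0 -(cards0 'I_n) rk_le_card. Qed.

Lemma rk_indep I : indep M I -> rk I = #|I|.
Proof.
move=> iI; have [B [_ sIB <-]] := indep_extend_in iI (subxx I).
by rewrite (setIidPr sIB).
Qed.

Lemma indepE I : indep M I = (rk I == #|I|).
Proof.
apply/idP/eqP => [/rk_indep//|rI]; have [B Bb] := rk_attained I; rewrite rI => cB.
apply/exists_inP; exists B => //.
have /eqP <- : B :&: I == I by rewrite eqEcard subsetIr cB leqnn.
exact: subsetIl.
Qed.

Lemma bases_rk B : (B \in bases M) = (#|B| == d) && (rk B == d).
Proof.
apply/idP/andP => [Bb|[/eqP cB /eqP rB]]; last by apply: indep_base => //; rewrite indepE rB cB.
by rewrite -(mrank_card Bb) (rk_indep (base_indep Bb)).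
Qed.

Lemma rkUI X Y : rk (X :|: Y) + rk (X :&: Y) <= rk X + rk Y.
Proof.
have [B Bb rB] := rk_attained (X :&: Y).
have iI : indep M (B :&: (X :&: Y)) := indepS (subsetIl _ _) (base_indep Bb).
have sI : B :&: (X :&: Y) \subset X :|: Y.
  by apply/subsetP=> x; rewrite !inE => /and3P[_ ->].
have [C [Cb sC rC]] := indep_extend_in iI sI; rewrite -rC.
have -> : rk (X :&: Y) = #|C :&: (X :&: Y)|.
  apply/eqP; rewrite eqn_leq rk_ge // andbT -rB; apply/subset_leq_card.
  by rewrite subsetI sC subsetIr.
have := rk_ge X Cb; have := rk_ge Y Cb.
have := cardsUI (C :&: X) (C :&: Y); rewrite -setIUr.
have -> : C :&: X :&: (C :&: Y) = C :&: (X :&: Y) by rewrite setIACA setIid.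
lia.
Qed.

Lemma rkU X Y : rk (X :|: Y) <= rk X + rk Y.
Proof. by have := rkUI X Y; lia. Qed.

Lemma rkU_card X Y : rk Y <= rk X + #|Y :\: X|.
Proof.
apply: leq_trans (leq_add (leqnn _) (rk_le_card _)).
apply: leq_trans (rkU _ _); apply/rkS/subsetP => x.
by rewrite !inE => ->; case: (x \in X).
Qed.

Lemma rkU1 x X : rk (x |: X) <= (rk X).+1.
Proof. by have := rkU [set x] X; have := rk_le_card [set x]; rewrite cards1; lia. Qed.

Lemma rkU1_span x X Y : X \subset Y -> rk (x |: X) = rk X -> rk (x |: Y) = rk Y.
Proof.
move=> sXY E; have := rkUI (x |: X) Y; have := rkS (subsetUr [set x] Y).
rewrite -setUA (setUidPr sXY).
have : rk X <= rk ((x |: X) :&: Y) by apply/rkS; rewrite subsetI subsetUr sXY.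
by rewrite E; lia.
Qed.

Lemma rk_span X Y : (forall x, x \in Y -> rk (x |: X) = rk X) -> rk (X :|: Y) = rk X.
Proof.
move=> h; have [k] := ubnP #|Y|; elim: k => // k IH in Y h *.
case: (set_0Vmem Y) => [->|[x xY]]; first by rewrite setU0.
move=> lek; rewrite -(setD1K xY) setUCA (rkU1_span (X := X)) ?subsetUl ?h // IH //.
  by move=> y; rewrite !inE => /andP[_ /h].
by move: lek; rewrite (cardsD1 x Y) xY; lia.
Qed.

End Rank.

(** * Connected restrictions and contractions, and exchange within a face *)

Section Connectivity.
Variables (n : nat) (M : matroid n).
Implicit Types (S I J A B C F G X Y : {set 'I_n}).
Local Notation rk := (rk M).
Local Notation d := (mrank M).

Definition restriction_connected S :=
  [forall A : {set 'I_n}, (A != set0) && (A \proper S) ==> (rk A + rk (S :\: A) != rk S)].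

(** In M/S the set [Y :\: S] has rank [rk Y - rk S], its complement has rank
    [rk (S :|: ~: Y) - rk S], and the total is [d - rk S]. The subtractions are cleared. *)
Definition contraction_connected S :=
  [forall Y : {set 'I_n}, (S \proper Y) && (Y \proper setT) ==>
     (rk Y + rk (S :|: ~: Y) != d + rk S)].

Lemma restriction_connectedP S : reflect
  (forall A, A != set0 -> A \proper S -> rk S < rk A + rk (S :\: A)) (restriction_connected S).
Proof.
apply: (iffP forallP) => h A; last first.
  by apply/implyP=> /andP[A0 AS]; have := h A A0 AS; lia.
move=> A0 AS; have := h A; rewrite A0 AS /=.
have : rk S <= rk (A :|: (S :\: A)).
  by apply/rkS/subsetP=> x; rewrite !inE => ->; case: (x \in A).
by have := rkU M A (S :\: A); lia.
Qed.

Lemma contraction_connectedP S : reflect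
  (forall Y, S \proper Y -> Y \proper setT -> d + rk S < rk Y + rk (S :|: ~: Y))
  (contraction_connected S).
Proof.
apply: (iffP forallP) => h Y; last first.
  by apply/implyP=> /andP[A0 AS]; have := h Y A0 AS; lia.
move=> SY YT; have := h Y; rewrite SY YT /=.
have sSY := proper_sub SY.
have := rkUI M Y (S :|: ~: Y); rewrite setUCA setUCr setUT setIUr setICr setU0 (setIidPr sSY).
by rewrite -/d; lia.
Qed.

Lemma mconnectedP : mconnected M <-> restriction_connected setT.
Proof.
split=> [h|/restriction_connectedP h A A0 AT].
  by apply/forallP=> A; apply/implyP; rewrite properT setTD => /andP[A0 AT]; apply/eqP/h.
by have := h A A0; rewrite properT AT setTD => /(_ isT); rewrite -/d; lia.
Qed.

(** Add submodularity for [X] and [A] to that for [X :|: A] and [S :\: A]; the separation of [S]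
    cancels the surplus terms. *)
Lemma separator_restrict S A X : A \subset S -> rk A + rk (S :\: A) <= rk S -> X \subset S ->
  rk (X :&: A) + rk (X :\: A) <= rk X.
Proof.
move=> sAS sep sXS; have := rkUI M X A; have := rkUI M (X :|: A) (S :\: A).
have -> : X :|: A :|: (S :\: A) = S.
  apply/setP=> x; rewrite !inE; move: (introT implyP (subsetP sXS x)) (introT implyP (subsetP sAS x)).
  by case: (x \in X) (x \in A) (x \in S) => [] [] [] //.
have -> : (X :|: A) :&: (S :\: A) = X :\: A.
  apply/setP=> x; rewrite !inE; move: (introT implyP (subsetP sXS x)).
  by case: (x \in X) (x \in A) (x \in S) => [] [] [] //.
lia.
Qed.

Lemma chain_base X Y : X \subset Y ->
  exists2 B, B \in bases M & #|B :&: X| = rk X /\ #|B :&: Y| = rk Y.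
Proof.
move=> sXY; have [C Cb rC] := rk_attained M X.
have iI : indep M (C :&: X) := indepS (subsetIl _ _) (base_indep Cb).
have [B [Bb sB rB]] := indep_extend_in iI (subset_trans (subsetIr _ _) sXY).
exists B => //; split=> //; apply/eqP; rewrite eqn_leq rk_ge // -rC.
by apply/subset_leq_card; rewrite subsetI sB subsetIr.
Qed.

Definition face_base F B := (B \in bases M) && (#|B :&: F| == rk F).

Lemma card_exch B x y : x \in B -> y \notin B -> #|y |: B :\ x| = #|B|.
Proof.
by move=> xB yB; rewrite cardsU1 !inE (negPf yB) andbF [in RHS](cardsD1 x) xB.
Qed.

Lemma card_exchI S B x y : x \in B -> y \notin B ->
  #|(y |: B :\ x) :&: S| + (x \in S) = #|B :&: S| + (y \in S).
Proof.
move=> xB yB; have -> : #|(y |: B :\ x) :&: S| = (y \in S) + #|(B :\ x) :&: S|.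
  case: (boolP (y \in S)) => yS.
    have -> : (y |: B :\ x) :&: S = y |: ((B :\ x) :&: S).
      by rewrite setIUl; congr (_ :|: _); apply/setIidPl; rewrite sub1set.
    by rewrite cardsU1 !inE (negPf yB) andbF.
  congr #|pred_of_set _|; apply/setP=> z; rewrite !inE.
  by case: (z =P y) => [->|//]; rewrite (negPf yS) !andbF.
rewrite (cardsD1 x (B :&: S)) !inE xB /=.
have -> : (B :&: S) :\ x = (B :\ x) :&: S by rewrite setIDAC.
by lia.
Qed.

(** These are the bases of the direct sum of M|F and M/F. For [x] outside [F], an exchange in [M]
    cannot enter [F], where the count is already maximal. For [x] in [F], the partner is found by
    augmenting inside [F], and submodularity shows that the result is a basis. *)
Lemma face_exchange F B C x : face_base F B -> face_base F C -> x \in B :\: C ->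
  exists2 y, y \in C :\: B & face_base F (y |: B :\ x).
Proof.
move=> /andP[Bb /eqP rB] /andP[Cb /eqP rC]; rewrite inE => /andP[xC xB].
have cB := mrank_card Bb.
case: (boolP (x \in F)) => xF; last first.
  have [|y yCB yb] := @bases_exchange _ M _ _ x Bb Cb; first by rewrite inE xC.
  exists y => //; rewrite /face_base yb /=; move: yCB; rewrite inE => /andP[yB _].
  have := card_exchI F xB yB; have := rk_ge F yb; rewrite (negPf xF) rB.
  case: (y \in F) => /= le; rewrite !addn0 ?addn1 => E; last by rewrite E.
  by move: le; rewrite E ltnn.
have iB : indep M ((B :\ x) :&: F).
  by apply: indepS (base_indep Bb); apply: subset_trans (subsetIl _ _) (subD1set _ _).
have iC : indep M (C :&: F) := indepS (subsetIl _ _) (base_indep Cb).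
have cBx : #|(B :\ x) :&: F|.+1 = rk F.
  by rewrite -rB (cardsD1 x (B :&: F)) !inE xB xF setIDAC.
have [|y] := indep_augment iB iC; first by rewrite rC -cBx.
rewrite !inE => /andP[]; case/boolP: (y == x) => [/eqP->|yx] /=.
  by rewrite (negPf xC).
move=> + /andP[yC yF]; rewrite yF andbT => yB iy.
exists y; first by rewrite inE yB.
have sI : (y |: ((B :\ x) :&: F)) \subset F by rewrite subUset sub1set yF subsetIr.
have E : (y |: B :\ x) :&: F = y |: ((B :\ x) :&: F).
  by rewrite setIUl; congr (_ :|: _); apply/setIidPl; rewrite sub1set.
have rI : rk (y |: ((B :\ x) :&: F)) = rk F.
  by rewrite (rk_indep iy) cardsU1 !inE (negPf yB) andbF.
have cE := card_exchI F xB yB; rewrite /face_base; apply/andP; split; last first.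
  by move: cE; rewrite xF yF rB => /addIn ->.
rewrite bases_rk card_exch // cB eqxx /=.
have := rkUI M (y |: B :\ x) F; rewrite E rI.
have : rk B <= rk (y |: B :\ x :|: F).
  apply/rkS/subsetP => z zB; rewrite !inE zB andbT.
  by case: (z =P x) => [->|_]; rewrite ?xF ?orbT.
by rewrite (rk_indep (base_indep Bb)) cB; have := rk_le_mrank M (y |: B :\ x); clear; lia.
Qed.

Lemma face_exchange_side F B x y : face_base F B -> x \in B -> y \notin B ->
  face_base F (y |: B :\ x) -> (y \in F) = (x \in F).
Proof.
move=> /andP[_ /eqP rB] xB yB /andP[_ /eqP rE]; have := card_exchI F xB yB.
by rewrite rB rE; case: (x \in F); case: (y \in F); lia.
Qed.

(** Among the subsets, these are the unions of connected components of the direct sum of M|F and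
    M/F. *)
Definition exchange_closed F S := forall B x y, face_base F B -> x \in B -> y \notin B ->
  face_base F (y |: B :\ x) -> x \in S -> y \in S.

(** Exchanging away an element of [S] brings in another one, so [B] can be moved towards [C] without
    lowering its count in [S] until the surplus is used up. By symmetry all bases of the face meet
    [S] equally often. *)
Lemma exchange_closed_card F S B C : exchange_closed F S ->
  face_base F B -> face_base F C -> #|B :&: S| <= #|C :&: S|.
Proof.
move=> cl; have [k] := ubnP #|B :\: C|; elim: k => // k IH in B *.
move=> lek fB fC; rewrite leqNgt; apply/negP => lt.
have [x] : exists x, x \in (B :&: S) :\: C.
  apply/set0Pn; apply: contraTneq lt => /eqP; rewrite setD_eq0 => sBC.
  by rewrite -leqNgt; apply/subset_leq_card; rewrite subsetI sBC subsetIr.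
rewrite !inE => /and3P[xC xB xS].
have [|y] := face_exchange fB fC (x := x); first by rewrite inE xC.
rewrite inE => /andP[yB yC] fy; have yS := cl _ _ _ fB xB yB fy xS.
have := card_exchI S xB yB; rewrite xS yS => E.
have : #|(y |: B :\ x) :\: C| < k.
  rewrite -ltnS; apply: leq_trans lek; rewrite ltnS; apply/proper_card/properP; split.
    apply/subsetP=> z; rewrite !inE => /andP[zC /orP[/eqP zy|/andP[_ ->]]]; last by rewrite zC.
    by move: zC; rewrite zy yC.
  exists x; first by rewrite !inE xC.
  rewrite !inE xC xB eqxx /= orbF.
  by apply: contraNneq yB => <-.
by move=> /IH /(_ fy fC); lia.
Qed.

(** A basis that is full on both [S] and [F], and one that is full on both [F :\: S] and [F], meet
    [S] equally often. This would make a proper [S] a separator of M|F. *)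
Lemma exchange_closed_restriction F S : restriction_connected F -> S \subset F -> S != set0 ->
  exchange_closed F S -> S = F.
Proof.
move=> /restriction_connectedP conF sSF S0 cl.
apply/eqP; apply: contraT => neq.
have := conF S S0; rewrite properEneq neq sSF => /(_ isT).
have [B Bb [rBS rBF]] := chain_base sSF.
have [C Cb [rCS rCF]] := chain_base (subsetDl F S).
have fB : face_base F B by rewrite /face_base Bb rBF eqxx.
have fC : face_base F C by rewrite /face_base Cb rCF eqxx.
have := exchange_closed_card cl fB fC; rewrite rBS -rCS -rCF.
have := cardsID S (C :&: F).
by rewrite -setIA (setIidPr sSF) setIDA; lia.
Qed.

Lemma exchange_closed_contraction F S : contraction_connected F -> S \subset ~: F ->
  S != set0 -> exchange_closed F S -> S = ~: F.
Proof.
move=> /contraction_connectedP conF sSF S0 cl.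
have dFS : [disjoint S & F] by rewrite disjoints_subset.
apply/eqP; apply: contraT => neq.
have : d + rk F < rk (F :|: S) + rk (F :|: ~: (F :|: S)).
  apply: conF; rewrite ?properT.
  rewrite properE subsetUl subUset subxx /=; apply: contraNN S0 => sF.
  by rewrite -subset0 -(setICr F) subsetI sF.
  apply: contraNneq neq => E; rewrite eqEsubset sSF; apply/subsetP=> x.
  by have := in_setT x; rewrite -E !inE => /orP[->|].
have [B Bb [rBF rBS]] := chain_base (subsetUl F S).
have [C Cb [rCF rCS]] := chain_base (subsetUl F (~: (F :|: S))).
have fB : face_base F B by rewrite /face_base Bb rBF eqxx.
have fC : face_base F C by rewrite /face_base Cb rCF eqxx.
have := exchange_closed_card cl fB fC; rewrite -rBS -rBF -rCS -(mrank_card Cb).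
have -> : #|B :&: (F :|: S)| = #|B :&: F| + #|B :&: S|.
  rewrite setIUr cardsU; suff -> : B :&: F :&: (B :&: S) = set0 by rewrite cards0 subn0.
  by rewrite setIACA (setIC F) (disjoint_setI0 dFS) setI0.
have : #|C| = #|C :&: (F :|: ~: (F :|: S))| + #|C :&: S|.
  rewrite -(cardsID S C) addnC; congr (_ + _); congr #|pred_of_set _|.
  apply/setP=> x; rewrite !inE; move: (introT implyP (subsetP sSF x)); rewrite inE.
  by case: (x \in S) (x \in F) (x \in C) => [] [] [] //.
lia.
Qed.

End Connectivity.

(** * Facet sets and their violation by nonbases *)

Section FacetSets.
Variables (n : nat) (M : matroid n).
Implicit Types (S I J A B C F G X Y T W : {set 'I_n}).
Local Notation rk := (rk M).
Local Notation d := (mrank M).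

(** Combinatorial form of the facets of a connected matroid polytope: the face of [F] is the
    polytope of the direct sum of M|F and M/F, and it has codimension one exactly when both summands
    are connected. *)
Definition facet_set F :=
  [&& F != set0, F != setT, restriction_connected M F & contraction_connected M F].

Hypothesis conM : mconnected M.

Lemma mconnected_lt S : S != set0 -> S != setT -> d < rk S + rk (~: S).
Proof.
move=> S0 ST; have := conM S0 ST; have := rkU M S (~: S).
by rewrite setUCr -/d; lia.
Qed.

(* [p / k] is the point where the segment from the barycenter of the bases to [T]
   leaves the matroid polytope. *)
Lemma violation_tight T : #|T| = d -> T \notin bases M ->
  exists (p : {set 'I_n} -> nat) (k : nat),
  [/\ forall X Y, p (X :|: Y) + p (X :&: Y) = p X + p Y,
      forall X, p X <= k * rk X,
      p set0 = 0 /\ p setT = k * d,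
      exists X, [&& X != set0, X != setT & p X == k * rk X] &
      forall X, X != set0 -> X != setT -> p X = k * rk X -> rk X < #|T :&: X| ].
Proof.
move=> cT Tb; have rT : rk T < d.
  by rewrite ltn_neqAle rk_le_mrank andbT; move: Tb; rewrite bases_rk cT eqxx.
have T0 : T != set0 by apply: contraTneq rT => T0; move: cT; rewrite T0 cards0 => <-.
have TT : T != setT by apply: contraTneq rT => ->; rewrite -/d ltnn.
pose z X := \sum_(B in bases M) #|B :&: X|.
pose g X := \sum_(B in bases M) (rk X - #|B :&: X|).
pose b := #|bases M|.
have gz X : g X + z X = b * rk X.
  rewrite -big_split /= (eq_bigr (fun=> rk X)) ?sum_nat_const // => B Bb.
  by rewrite subnK // rk_ge.
have g_gt0 X : X != set0 -> X != setT -> 0 < g X.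
  move=> X0 XT; rewrite lt0n; apply/eqP => /eqP; rewrite sum_nat_eq0 => /forall_inP h.
  have [B Bb rB] := rk_attained M (~: X).
  have := h B Bb; have := mconnected_lt X0 XT; rewrite -rB -(mrank_card Bb).
  by have := cardsID X B; rewrite setDE; lia.
(* Violation by [T] against slack at the barycenter. The larger this ratio, the earlier the segment
   from the barycenter to [T] meets the hyperplane of [X], so a maximiser gives the first inequality
   to become tight. *)
pose ratio X : rat := ((#|T :&: X|%:R - (rk X)%:R) / (g X)%:R)%R.
pose P X := (X != set0) && (X != setT).
have PT : P T by rewrite /P T0 TT.
case: (@Order.TotalTheory.arg_maxP _ _ _ T P ratio PT) => X /andP[X0 XT] max.
have gX := g_gt0 X X0 XT.
have cross Y Z : P Y -> P Z -> (ratio Y <= ratio Z)%R =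
    (#|T :&: Y| * g Z + rk Z * g Y <= #|T :&: Z| * g Y + rk Y * g Z).
  move=> /andP[Y0 YT] /andP[Z0 ZT]; rewrite /ratio.
  have gY := g_gt0 Y Y0 YT; have gZ := g_gt0 Z Z0 ZT.
  rewrite Num.Theory.ler_pdivrMr ?Num.Theory.ltr0n // GRing.mulrAC.
  rewrite Num.Theory.ler_pdivlMr ?Num.Theory.ltr0n //.
  rewrite -(Num.Theory.ler_nat rat) !GRing.natrD !GRing.natrM.
  by apply/idP/idP; lra.
have PX : P X by rewrite /P X0 XT.
have fX : rk X < #|T :&: X|.
  have := max T PT; rewrite /= (cross T X PT PX) setIid cT.
  have gT := g_gt0 T T0 TT; rewrite (ltnNge (rk X)); apply: contraTN => le.
  have : #|T :&: X| * g T <= rk X * g T by rewrite leq_mul2r le orbT.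
  have : rk T * g X < d * g X by rewrite ltn_pmul2r.
  by rewrite -ltnNge; clear; lia.
pose f := #|T :&: X| - rk X.
(* The exit point with denominators cleared: [T] is weighted by the slack of [X] and the sum of all
   bases by the violation of [X], so that both effects cancel at [X]. *)
exists (fun Y => #|T :&: Y| * g X + f * z Y), (g X + f * b); split.
- move=> Y Z; have := cardsUI (T :&: Y) (T :&: Z).
  rewrite -setIUr setIACA setIid.
  suff: z (Y :|: Z) + z (Y :&: Z) = z Y + z Z by nia.
  rewrite -!big_split; apply: eq_bigr => B _ /=.
  by have := cardsUI (B :&: Y) (B :&: Z); rewrite -setIUr setIACA setIid.
- move=> Y; have := gz Y; case: (eqVneq Y set0) => [->|Y0].
    by rewrite /z setI0 cards0 rk0 big1 ?muln0 // => B _; rewrite setI0 cards0.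
  case: (eqVneq Y setT) => [->|YT].
    by rewrite setIT cT mulnDl -mulnA => <-; rewrite -[rk setT]/d mulnC leq_add2l leq_mul2l leq_addl orbT.
  have PY : P Y by rewrite /P Y0.
  have := max Y PY; rewrite /= (cross Y X PY PX) => h E.
  have {}h : #|T :&: Y| * g X + rk X * g Y <= (f + rk X) * g Y + rk Y * g X.
    by rewrite /f subnK // ltnW.
  have -> : (g X + f * b) * rk Y = g X * rk Y + f * (g Y + z Y) by rewrite E mulnDl mulnA.
  move: h; clear; move: #|T :&: Y| (g X) (rk X) (g Y) (rk Y) (z Y) f => a1 a2 a3 a4 a5 a6 a7.
  nia.
- split; first by rewrite setI0 cards0 /z big1 ?muln0 // => B _; rewrite setI0 cards0.
  have -> : z setT = b * d.
    rewrite /z (eq_bigr (fun=> d)) ?sum_nat_const // => B Bb.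
    by rewrite setIT (mrank_card Bb).
  by rewrite setIT cT mulnDl mulnC mulnA.
- exists X; rewrite X0 XT /=; apply/eqP.
  have -> : #|T :&: X| = f + rk X by rewrite /f; lia.
  by have := gz X; move: (g X) (z X) (rk X) => a1 a2 a3 E; rewrite !mulnDl -mulnA -E; nia.
move=> Y Y0 YT; have gY := g_gt0 Y Y0 YT; have := gz Y => E h.
have fg : 0 < f * g Y by rewrite muln_gt0 subn_gt0 fX.
have {}h : #|T :&: Y| * g X = rk Y * g X + f * g Y.
  by move: h; rewrite mulnDl -mulnA -E mulnDr addnA => /addIn ->; rewrite mulnC.
have : rk Y * g X < #|T :&: Y| * g X by rewrite h -[X in X < _]addn0 ltn_add2l.
by rewrite ltn_pmul2r.
Qed.

(* Separations of tight sets are tight, so a maximal tight set whose restriction is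
   connected also has a connected contraction. *)
Lemma violated_facet_set T : #|T| = d -> T \notin bases M ->
  exists2 F, facet_set F & rk F < #|T :&: F|.
Proof.
move=> cT Tb; have [p [k [pUI pk [p0 pT] [X0 /and3P[X00 X0T /eqP X0t]] tight_viol]]] :=
  violation_tight cT Tb.
pose tight X := p X == k * rk X.
have tight_sep W A : tight W -> A \subset W -> rk A + rk (W :\: A) <= rk W -> tight A.
  move=> /eqP tW sAW sep; have := pUI A (W :\: A); have := pk A; have := pk (W :\: A).
  have -> : A :|: (W :\: A) = W by rewrite -{1}(setIidPr sAW) setID.
  have -> : A :&: (W :\: A) = set0 by rewrite setIDA setIC setDIl setDv setI0.
  rewrite p0 tW /tight => h1 h2 h3; apply/eqP.
  move: sep h1 h2 h3; clear; nia.
have tight_join W Y Z : tight W -> Y :|: Z = setT -> Y :&: Z = W -> rk Y + rk Z = d + rk W -> tight Y.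
  move=> /eqP tW YZ YZW sep; have := pUI Y Z; have := pk Y; have := pk Z.
  rewrite YZ YZW pT tW /tight => h1 h2 h3; apply/eqP.
  move: sep h1 h2 h3; clear; nia.
pose good X := [&& X != set0, X != setT, tight X & restriction_connected M X].
have [X1 goodX1] : exists X, good X.
  have [|X /and3P[X0n X0T' tX] minX] :=
    @arg_minnP _ X0 (fun X => [&& X != set0, X != setT & tight X]) (fun X : {set 'I_n} => #|X|).
    by rewrite X00 X0T /tight X0t eqxx.
  exists X; rewrite /good X0n X0T' tX /=; apply/restriction_connectedP => A A0 AX.
  rewrite ltnNge; apply/negP => sep.
  have AT : A != setT.
    by apply: contraTneq AX => ->; rewrite properE subTset (negPf X0T').
  have := minX A; rewrite A0 AT (tight_sep X A tX (proper_sub AX) sep).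
  by rewrite leqNgt (proper_card AX) => /(_ isT).
case: (@arg_maxnP _ X1 good (fun X : {set 'I_n} => #|X|) goodX1) => X /and4P[Xn0 XnT tX conX] maxX.
(* The smallest separator [A] of M|W containing [X] is tight, and its restriction is connected: the
   connected set [X] would lie in one part of a separation of [A], and that part would be a smaller
   separator. Maximality of [X] then gives [A = X]. *)
have above W : X \subset W -> W != setT -> tight W -> rk W = rk X + rk (W :\: X).
  move=> sXW WT tW.
  have [|A /and3P[sXA sAW /eqP sepA] minA] :=
    @arg_minnP _ W (fun A => [&& X \subset A, A \subset W & rk A + rk (W :\: A) == rk W])
      (fun A : {set 'I_n} => #|A|).
    by rewrite sXW subxx setDv rk0 addn0 eqxx.
  suff -> : X = A by rewrite sepA.
  apply/eqP; rewrite eqEcard sXA /=; apply: maxX; apply/and4P; split.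
  - by apply: contraNneq Xn0 => A0; rewrite -subset0 -A0.
  - by apply: contraNneq WT => AT; rewrite -subTset -AT.
  - by apply: (tight_sep W); rewrite ?sepA.
  apply/restriction_connectedP => A1 A10 A1A; rewrite ltnNge; apply/negP => sep.
  have sA1A := proper_sub A1A.
  have part (D : {set 'I_n}) : D \proper A -> rk D + rk (A :\: D) <= rk A -> ~~ (X \subset D).
    move=> DA sepD; apply/negP => sXD; have sDA := proper_sub DA.
    have := minA D; rewrite sXD (subset_trans sDA sAW) /= leqNgt (proper_card DA).
    suff -> : rk D + rk (W :\: D) == rk W by move/(_ isT).
    rewrite eqn_leq; apply/andP; split; last first.
      apply: leq_trans (rkU M _ _); apply: rkS; apply/subsetP => x.
      by rewrite !inE => ->; case: (x \in D).
    have : rk (W :\: D) <= rk (A :\: D) + rk (W :\: A).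
      apply: leq_trans (rkU M _ _); apply: rkS; apply/subsetP => x.
      by rewrite !inE => /andP[-> ->]; case: (x \in A).
    by move: sepD sepA; clear; lia.
  have sepX : rk (X :&: A1) + rk (X :\: A1) <= rk X := separator_restrict sA1A sep sXA.
  have : ~~ (X \subset A1) by apply: part.
  have : ~~ (X \subset A :\: A1).
    apply: part; last by rewrite setDDr setDv set0U (setIidPr sA1A) addnC.
    rewrite properE subsetDl /=; apply: contraNN A10 => sA.
    by rewrite -subset0; apply/subsetP=> x xA1; have := subsetP sA x (subsetP sA1A x xA1); rewrite !inE xA1.
  move=> nX2 nX1; have := restriction_connectedP _ _ conX (X :&: A1).
  rewrite setDIr setDv set0U ltnNge sepX => /(_ _ _) h; suff : false by []; apply: h.
    apply: contraNneq nX2 => E; apply/subsetP=> x xX; rewrite inE (subsetP sXA) // andbT.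
    by apply/negP=> xA1; move/setP/(_ x): E; rewrite !inE xX xA1.
  by rewrite properE subsetIl /= subsetI subxx.
exists X; last by apply: tight_viol => //; apply/eqP.
rewrite /facet_set Xn0 XnT conX /=; apply/contraction_connectedP => Y XY YT.
rewrite ltnNge; apply/negP => sep; have sXY := proper_sub XY.
have YU : Y :|: (X :|: ~: Y) = setT by rewrite setUCA setUCr setUT.
have YI : Y :&: (X :|: ~: Y) = X by rewrite setIUr setICr setU0 (setIidPr sXY).
have sepE : rk Y + rk (X :|: ~: Y) = d + rk X.
  by apply/eqP; rewrite eqn_leq sep /=; have := rkUI M Y (X :|: ~: Y); rewrite YU YI.
have tY : tight Y by apply: (tight_join X _ (X :|: ~: Y)).
have tZ : tight (X :|: ~: Y).
  by apply: (tight_join X _ Y tX); [rewrite setUC | rewrite setIC | rewrite addnC].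
have ZT : X :|: ~: Y != setT.
  apply: contraTneq XY => E; rewrite properE negb_and negbK; apply/orP; right.
  by rewrite -(setIT Y) -E YI.
(* Applied to both sides of a separation of M/X, [above] would make [X] a separator of [M]. *)
have := above Y sXY (proper_neq YT) tY; have := above _ (subsetUl X _) ZT tZ.
have := mconnected_lt Xn0 XnT.
have : rk (~: X) <= rk (Y :\: X) + rk ((X :|: ~: Y) :\: X).
  apply: leq_trans (rkU M _ _); apply: rkS; apply/subsetP => x.
  by rewrite !inE => ->; case: (x \in Y); rewrite //= orbT.
by move: sepE; clear; lia.
Qed.

Section Nondegenerate.
Hypothesis n_ge2 : 2 <= n.

Lemma ord_set1_neqT (x : 'I_n) : [set x] != setT.
Proof.
by apply: contraTneq n_ge2 => E; have := cardsT 'I_n; rewrite -E cards1 card_ord => <-.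
Qed.

Lemma ord_set1_neq0 (x : 'I_n) : [set x] != set0.
Proof. by apply/set0Pn; exists x; rewrite inE. Qed.

Lemma mconnected_rk_gt0 S : S != set0 -> S != setT -> 0 < rk S.
Proof.
by move=> S0 ST; have := mconnected_lt S0 ST; have := rk_le_mrank M (~: S); clear; lia.
Qed.

Lemma rk_gt0 S : S != set0 -> 0 < rk S.
Proof.
case/set0Pn=> x xS; apply: (@leq_trans (rk [set x])); last by rewrite rkS ?sub1set.
exact: mconnected_rk_gt0 (ord_set1_neq0 x) (ord_set1_neqT x).
Qed.

Lemma mconnected_rkC S : S != set0 -> S != setT -> rk S <= 1 -> rk (~: S) = d.
Proof.
move=> S0 ST; have := mconnected_lt S0 ST; have := rk_le_mrank M (~: S); clear; lia.
Qed.

Lemma rk_setC1 x : rk (~: [set x]) = d.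
Proof.
apply: mconnected_rkC (ord_set1_neq0 x) (ord_set1_neqT x) _.
by rewrite (leq_trans (rk_le_card _ _)) ?cards1.
Qed.

(** Removing one element [x] of [S] from the ground set would leave rank at most
    [rk (~: S) + #|S| - 1 < d], so [x] would be a coloop of a connected matroid. *)
Lemma coloopless S : rk (~: S) + #|S| <= d -> S = set0.
Proof.
move=> h; apply: contraTeq h => /set0Pn[x xS]; rewrite -ltnNge.
have := rkU M (~: S) (S :\ x); have <- : #|S :\ x|.+1 = #|S| by rewrite (cardsD1 x S) xS.
have := rk_le_card M (S :\ x).
have -> : ~: S :|: S :\ x = ~: [set x].
  by apply/setP=> y; rewrite !inE; case: (y =P x) => [->|_]; rewrite ?xS //= orNb.
by rewrite rk_setC1; clear; lia.
Qed.

(** The two strict inequalities discard the facets lying on a coordinate hyperplane [x_i = 1] or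
    [x_i = 0]; these do not cut the interior of the hypersimplex. *)
Definition split_set F := [&& facet_set F, rk F < #|F| & rk F < d].

Lemma nonbasis_split_set T : #|T| = d -> T \notin bases M ->
  exists2 F, split_set F & rk F < #|T :&: F|.
Proof.
move=> cT Tb; have [F fF lt] := violated_facet_set cT Tb; exists F => //.
rewrite /split_set fF (leq_trans lt) ?subset_leq_card ?subsetIr //=.
by rewrite -cT (leq_trans lt) // subset_leq_card ?subsetIl.
Qed.

Lemma split_set_neq0 F : split_set F -> F != set0.
Proof. by case/and3P=> /and4P[]. Qed.

Lemma split_set_neqT F : split_set F -> F != setT.
Proof. by case/and3P=> /and4P[]. Qed.

Lemma split_set_flat F x : split_set F -> x \notin F -> rk F < rk (x |: F).
Proof.
case/and3P => /and4P[F0 FT _ /contraction_connectedP conF] _ rF xF.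
have pF : F \proper x |: F.
  by rewrite properE subsetUr; apply/subsetPn; exists x => //; rewrite !inE eqxx.
case: (eqVneq (x |: F) setT) => [->//|E].
have := conF (x |: F) pF; rewrite properT E => /(_ isT).
by have := rk_le_mrank M (F :|: ~: (x |: F)); clear; lia.
Qed.

Lemma split_set_contraction_card F : split_set F -> d - rk F < #|~: F|.
Proof.
move=> sF; rewrite ltnNge; apply/negP => h.
have := split_set_neqT sF; rewrite -(setCK F) (@coloopless (~: F)) ?setC0 ?eqxx // setCK.
by case/and3P: sF => _ _ lt; move: lt h; clear; lia.
Qed.

(** The hypothesis forces [rk F = rk (F :&: G) + rk (F :\: G)], so connectedness of M|F puts [F]
    inside [G]. Then [rk G <= rk F], and flatness of [F] gives equality. *)
Lemma split_set_setD F G : split_set F -> split_set G -> rk G + #|F :\: G| <= rk F -> F = G.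
Proof.
move=> sF sG h; have /and3P[/and4P[F0 FT /restriction_connectedP conF _] _ _] := sF.
have rG := rk_gt0 (split_set_neq0 sG).
have h1 : rk (F :&: G) <= rk G by rewrite rkS ?subsetIr.
have h2 : rk F <= rk (F :&: G) + rk (F :\: G).
  by apply: leq_trans (rkU M _ _); rewrite setID.
have h3 := rk_le_card M (F :\: G).
case: (eqVneq (F :&: G) set0) => [E|FG0].
  by move: h h1 h2 h3 rG; rewrite E rk0; clear; lia.
have sFG : F \subset G.
  rewrite -setD_eq0; apply: contraT => FG.
  have pr : F :&: G \proper F.
    by rewrite properE subsetIl subsetI subxx /= -setD_eq0.
  have := conF _ FG0 pr; rewrite setDIr setDv set0U.
  by move: h h1 h2 h3; clear; lia.
apply/eqP; rewrite eqEsubset sFG; apply/subsetP=> x xG; apply: contraT => xF.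
have := split_set_flat sF xF.
have : rk (x |: F) <= rk G by rewrite rkS // subUset sub1set xG.
by move: h; clear; lia.
Qed.

(** Otherwise submodularity leaves rank 0 for [F :&: G], which is then empty, and connectedness of
    [M] makes [F :|: G] the ground set. So [F] and [G] would be complementary separators. *)
Lemma split_set_setU F G : split_set F -> split_set G -> d < rk F + rk G + #|~: (F :|: G)|.
Proof.
move=> sF sG; rewrite ltnNge; apply/negP => h.
have F0 := split_set_neq0 sF; have FT := split_set_neqT sF.
have h1 := rkUI M F G; have h2 := rkU M (F :|: G) (~: (F :|: G)).
move: h2; rewrite setUCr -/d => h2; have h3 := rk_le_card M (~: (F :|: G)).
have h4 : rk (F :&: G) = 0 by move: h h1 h2 h3; clear; lia.
have FG0 : F :&: G = set0 by apply: contraTeq (eqxx (rk (F :&: G))) => /rk_gt0; rewrite h4.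
have FGT : F :|: G = setT.
  apply: contraTeq h => FGT.
  have FG1 : F :|: G != set0 by apply: contraNneq F0 => E; rewrite -subset0 -E subsetUl.
  by have := mconnected_lt FG1 FGT; move: h1 h3; clear; lia.
have EG : G = ~: F.
  apply/setP=> x; move/setP/(_ x): FG0; move/setP/(_ x): FGT; rewrite !inE.
  by case: (x \in F); case: (x \in G).
have := mconnected_lt F0 FT; rewrite -EG; move: h; clear; lia.
Qed.

End Nondegenerate.
End FacetSets.

(** * Bases and rank of the series-free lift *)

Section LiftBases.
Variables (n : nat).
Implicit Types (T : {set 'I_n}) (S : {set 'I_n.+2}).

Definition emb (i : 'I_n) : 'I_n.+2 := lift ord_max (lift ord_max i).
Definition elt_f : 'I_n.+2 := lift ord_max ord_max.
Definition elt_s : 'I_n.+2 := ord_max.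

Lemma ord2_cases (P : 'I_n.+2 -> Prop) :
  (forall i, P (emb i)) -> P elt_f -> P elt_s -> forall x, P x.
Proof.
move=> Pe Pf Ps x; case: (unliftP ord_max x) => [y ->|-> //].
by case: (unliftP ord_max y) => [i ->|-> //]; apply: Pe.
Qed.

Lemma emb_inj : injective emb.
Proof. by move=> i j /lift_inj/lift_inj. Qed.

Lemma emb_eq i j : (emb i == emb j) = (i == j). Proof. exact: inj_eq emb_inj _ _. Qed.
Lemma emb_f i : (emb i == elt_f) = false.
Proof. by rewrite /emb /elt_f (inj_eq (@lift_inj _ _)) eq_sym (negPf (neq_lift _ _)). Qed.
Lemma emb_s i : (emb i == elt_s) = false.
Proof. by rewrite eq_sym (negPf (neq_lift _ _)). Qed.
Lemma f_s : (elt_f == elt_s) = false.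
Proof. by rewrite eq_sym (negPf (neq_lift _ _)). Qed.
Lemma f_emb i : (elt_f == emb i) = false. Proof. by rewrite eq_sym emb_f. Qed.
Lemma s_emb i : (elt_s == emb i) = false. Proof. by rewrite eq_sym emb_s. Qed.
Lemma s_f : (elt_s == elt_f) = false. Proof. by rewrite eq_sym f_s. Qed.
Definition ord2E := (emb_eq, emb_f, emb_s, f_s, f_emb, s_emb, s_f).

Definition oldset S : {set 'I_n} := emb @^-1: S.

Definition ext_set T (a b : bool) : {set 'I_n.+2} :=
  [set x | [|| x \in emb @: T, (x == elt_f) && a | (x == elt_s) && b]].

Lemma mem_emb_imset i T : (emb i \in emb @: T) = (i \in T).
Proof. exact/mem_imset/emb_inj. Qed.
Lemma f_emb_imset T : (elt_f \in emb @: T) = false.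
Proof. by apply/imsetP => -[i _ /eqP]; rewrite f_emb. Qed.
Lemma s_emb_imset T : (elt_s \in emb @: T) = false.
Proof. by apply/imsetP => -[i _ /eqP]; rewrite s_emb. Qed.
Definition imsetE := (mem_emb_imset, f_emb_imset, s_emb_imset).

Lemma mem_ext_emb T a b i : (emb i \in ext_set T a b) = (i \in T).
Proof. by rewrite inE imsetE !ord2E orbF. Qed.
Lemma mem_ext_f T a b : (elt_f \in ext_set T a b) = a.
Proof. by rewrite inE imsetE !ord2E eqxx orbF. Qed.
Lemma mem_ext_s T a b : (elt_s \in ext_set T a b) = b.
Proof. by rewrite inE imsetE !ord2E eqxx. Qed.
Definition mem_extE := (mem_ext_emb, mem_ext_f, mem_ext_s).

Lemma ext_setK S : ext_set (oldset S) (elt_f \in S) (elt_s \in S) = S.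
Proof. by apply/setP; elim/ord2_cases => [i||]; rewrite mem_extE // inE. Qed.

Lemma ext_setI T T' a a' b b' :
  ext_set T a b :&: ext_set T' a' b' = ext_set (T :&: T') (a && a') (b && b').
Proof. by apply/setP; elim/ord2_cases => [i||]; rewrite inE !mem_extE ?inE. Qed.

Lemma ext_set_emb T : ext_set T false false = emb @: T.
Proof. by apply/setP; elim/ord2_cases => [i||]; rewrite mem_extE imsetE. Qed.

Lemma card_ext_set T a b : #|ext_set T a b| = #|T| + a + b.
Proof.
rewrite (cardsD1 elt_f) (cardsD1 elt_s) in_setD1 !mem_extE !ord2E /=.
have -> : ext_set T a b :\ elt_f :\ elt_s = emb @: T.
  by apply/setP; elim/ord2_cases => [i||]; rewrite !inE imsetE !ord2E ?eqxx ?orbF.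
by rewrite card_imset; [rewrite addnA addnC addnA | apply: emb_inj].
Qed.

Lemma card_extI_emb T T' a b : #|ext_set T a b :&: emb @: T'| = #|T :&: T'|.
Proof. by rewrite -ext_set_emb ext_setI card_ext_set !andbF !addn0. Qed.

End LiftBases.

Section Lift.
Variables (n : nat) (M : matroid n).
Implicit Types (T F G : {set 'I_n}) (S : {set 'I_n.+2}).
Local Notation rk := (rk M).
Local Notation d := (mrank M).
Local Notation N := (series_free_lift M).

Lemma collapse_emb i : collapse (ord_max : 'I_n.+1) (emb i) = lift ord_max i.
Proof. by rewrite collapse_lift. Qed.
Lemma collapse_f : collapse (ord_max : 'I_n.+1) (elt_f n) = ord_max.
Proof. by rewrite collapse_lift. Qed.
Lemma collapse_s : collapse (ord_max : 'I_n.+1) (elt_s n) = ord_max.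
Proof. by rewrite /collapse unlift_none. Qed.

(** A cobasis contains at most one of the parallel elements [f] and [s], so a basis contains at
    least one of them. It contains both exactly when the corresponding basis of the free extension
    uses [f]. *)
Lemma lift_bases T a b : (ext_set T a b \in bases N) =
  (if a && b then indep M T && (#|T|.+1 == d) else (a || b) && (T \in bases M)).
Proof.
set S := ext_set T a b.
transitivity ([forall x in ~: S, forall y in ~: S, (collapse (ord_max : 'I_n.+1) x == collapse ord_max y) ==> (x == y)]
   && (~: (collapse (ord_max : 'I_n.+1) @: ~: S) \in bases (free_ext M))); first by rewrite !inE.
have -> : [forall x in ~: S, forall y in ~: S,
    (collapse ord_max x == collapse ord_max y) ==> (x == y)] = a || b.
  apply/collapseP/idP => [inj|ab x y].
    apply: contraT; rewrite negb_or => /andP[/negPf a0 /negPf b0].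
    have /eqP : elt_f n = elt_s n; last by rewrite f_s.
    by apply: inj; [rewrite inE mem_extE a0 | rewrite inE mem_extE b0 | rewrite collapse_f collapse_s].
  elim/ord2_cases: x => [i||]; elim/ord2_cases: y => [j||];
    rewrite ?(collapse_emb, collapse_f, collapse_s) // !inE -/S ?mem_extE.
  - by move=> _ _ /lift_inj ->.
  - by move=> _ _ /eqP; rewrite eq_sym (negPf (neq_lift _ _)).
  - by move=> _ _ /eqP; rewrite eq_sym (negPf (neq_lift _ _)).
  - by move=> _ _ /eqP; rewrite (negPf (neq_lift _ _)).
  - by rewrite !imsetE !ord2E !eqxx /= ?orbF; case: (a) (b) ab => [] [].
  - by move=> _ _ /eqP; rewrite (negPf (neq_lift _ _)).
  - by rewrite !imsetE !ord2E !eqxx /= ?orbF; case: (a) (b) ab => [] [].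
have memC (j : 'I_n.+1) : (j \in ~: (collapse ord_max @: ~: S)) =
    [forall x, (collapse ord_max x == j) ==> (x \in S)].
  rewrite inE; apply/negP/forallP => [h x|h /imsetP[x]].
    apply/implyP=> /eqP E; apply: contraT => xS; by case: h; rewrite -E imset_f // inE.
  by rewrite inE => /negP xS E; apply: xS; apply: (implyP (h x)); rewrite -E.
have memM : (ord_max \in ~: (collapse ord_max @: ~: S)) = a && b.
  rewrite memC; apply/forallP/andP => [h|[ha hb]].
    split; first by have := h (elt_f n); rewrite collapse_f eqxx mem_extE.
    by have := h (elt_s n); rewrite collapse_s eqxx mem_extE.
  elim/ord2_cases => [i||]; rewrite ?mem_extE ?ha ?hb ?implybT //.
  by rewrite collapse_emb eq_sym (negPf (neq_lift _ _)).
rewrite [_ \in bases (free_ext M)]inE memM.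
have -> : old (~: (collapse ord_max @: ~: S)) = T.
  apply/setP=> i; rewrite inE memC; apply/forallP/idP => [h|iT].
    by have := h (emb i); rewrite collapse_emb eqxx mem_extE.
  elim/ord2_cases => [j||]; rewrite ?collapse_emb ?collapse_f ?collapse_s ?mem_extE.
  - by apply/implyP=> /eqP/lift_inj ->.
  - by rewrite (negPf (neq_lift _ _)).
  - by rewrite (negPf (neq_lift _ _)).
by case: (a) (b) => [] [] //=; rewrite ?andbF.
Qed.

Lemma lift_base_old S : S \in bases N -> indep M (oldset S).
Proof.
rewrite -{1}(ext_setK S) lift_bases; case: ifP => _ /andP[] //.
by move=> _; apply: base_indep.
Qed.

Lemma rk_lift_emb F : Defs.rk N (@emb n @: F) = rk F.
Proof.
apply/eqP; rewrite eqn_leq; apply/andP; split.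
  have [S Sb <-] := rk_attained N (@emb n @: F).
  rewrite -(ext_setK S) card_extI_emb; have iS := lift_base_old Sb.
  rewrite -(rk_indep (indepS (subsetIl _ _) iS)); exact/rkS/subsetIr.
have [B Bb <-] := rk_attained M F.
have Sb : ext_set B true false \in bases N by rewrite lift_bases.
by rewrite -(card_extI_emb B F true false); apply: rk_ge.
Qed.

Lemma rk_lift_ge S F : #|S :&: @emb n @: F| + Defs.rk N S <= #|S| + rk F.
Proof.
have := rkU_card N (@emb n @: F) S; rewrite rk_lift_emb.
have := cardsID (@emb n @: F) S; rank_lia.
Qed.

Lemma lift_rk_le1 T (a b : bool) : rk T + (a || b) <= Defs.rk N (ext_set T a b).
Proof.
have [B Bb <-] := rk_attained M T.
have Sb : ext_set B a (~~ a) \in bases N by rewrite lift_bases andbN orbN.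
have Sb' : ext_set B (~~ b) b \in bases N by rewrite lift_bases andNb orNb.
have := rk_ge (ext_set T a b) Sb; have := rk_ge (ext_set T a b) Sb'.
rewrite !ext_setI !card_ext_set; case: (a); case: (b) => /=; lia.
Qed.

(** A basis of [M] that is optimal for [T] has an element outside [T], which can be traded for the
    second new element. *)
Lemma lift_rk_le2 T : rk T < d -> rk T + 2 <= Defs.rk N (ext_set T true true).
Proof.
move=> lt; have [B Bb rB] := rk_attained M T.
have [e] : exists e, e \in B :\: T.
  apply/set0Pn; apply: contraTneq lt => /eqP; rewrite setD_eq0 => sBT.
  by rewrite -rB (setIidPl sBT) (mrank_card Bb) ltnn.
rewrite inE => /andP[eT eB].
have Sb : ext_set (B :\ e) true true \in bases N.
  rewrite lift_bases /= (indepS (subD1set _ _) (base_indep Bb)) /=.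
  by rewrite -(mrank_card Bb) (cardsD1 e B) eB.
have := rk_ge (ext_set T true true) Sb; rewrite ext_setI card_ext_set /=.
have -> : (B :\ e) :&: T = B :&: T.
  by apply/setP=> x; rewrite !inE; case: (x =P e) => [->|//]; rewrite (negPf eT) !andbF.
by rewrite rB; lia.
Qed.

Hypotheses (conM : mconnected M) (n_ge2 : 2 <= n).
Hypothesis compatible : forall F G, split_set M F -> split_set M G -> F <> G ->
  #|F :&: G| + d <= rk F + rk G.

(** Compatibility as it is used below: the excesses of [T] over [rk F] and over [rk G] add up to at
    most [#|T| - d]. *)
Lemma two_split_sets T F G : split_set M F -> split_set M G -> F <> G ->
  #|T :&: F| + #|T :&: G| + d <= #|T| + rk F + rk G.
Proof.
move=> sF sG FG; have := compatible sF sG FG.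
have := cardsUI (T :&: F) (T :&: G); rewrite -setIUr setIACA setIid.
have := subset_leq_card (subsetIl T (F :|: G)).
have := subset_leq_card (subsetIr T (F :&: G)); lia.
Qed.

Lemma subset_of_card (A : {set 'I_n}) k : k <= #|A| -> exists2 B : {set 'I_n}, B \subset A & #|B| = k.
Proof.
move=> le; have [E|] := posnP #|[set B : {set 'I_n} | B \subset A & #|B| == k]|.
  by move: E; rewrite cards_draws => /eqP; rewrite -leqn0 leqNgt bin_gt0 le.
by case/card_gt0P=> B; rewrite inE => /andP[sB /eqP cB]; exists B.
Qed.

(* Trade the surplus elements of [T] in [F] for elements outside [F]: the result
   violates no other split set by compatibility, hence is a basis. *)
Lemma rk_split_set T F : split_set M F -> #|T| <= d -> rk F <= #|T :&: F| ->
  #|T| + rk F <= rk T + #|T :&: F|.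
Proof.
move=> sF cT rFT; have [A sA cA] := @subset_of_card (T :&: F) (#|T :&: F| - rk F) (leq_subr _ _).
have sAT : A \subset T := subset_trans sA (subsetIl _ _).
have cTA : #|T :\: A| = #|T| - #|A| by rewrite cardsD (setIidPr sAT).
have cTF : #|T :\: F| + #|T :&: F| = #|T| by rewrite addnC cardsID.
have conF := split_set_contraction_card conM n_ge2 sF.
have cFT : #|~: F :\: T| + #|T :\: F| = #|~: F|.
  by rewrite addnC -(cardsID T (~: F)); congr (#|pred_of_set _| + _); rewrite setDE setIC.
(* There is room outside [F]: [#|~: F|] exceeds [d - rk F], while [T :\: A] consists of [T :\: F]
   and [rk F] elements of [F]. *)
have [D sD cD] := @subset_of_card (~: F :\: T) (d - #|T :\: A|) ltac:(by move: cT cA rFT cTA cTF conF cFT; rank_lia).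
have dD : [disjoint T :\: A & D].
  rewrite disjoint_sym disjoints_subset; apply: subset_trans sD _.
  by apply/subsetP=> x; rewrite !inE => /andP[/negPf -> _]; rewrite andbF.
pose T2 := (T :\: A) :|: D.
have cT2 : #|T2| = d.
  by rewrite cardsU (disjoint_setI0 dD) cards0 cD; move: cT cTA; rank_lia.
have fT2 : #|T2 :&: F| = rk F.
  have -> : T2 :&: F = (T :&: F) :\: A.
    apply/setP=> x; rewrite !inE; move: (introT implyP (subsetP sD x)); rewrite !inE.
    by case: (x \in F) (x \in D) (x \in T) (x \in A) => [] [] [] [].
  by rewrite cardsD (setIidPr sA) cA subKn.
have T2b : T2 \in bases M.
  apply: contraT => nb; have [G sG lt] := nonbasis_split_set conM cT2 nb.
  have FG : F <> G by move=> E; rewrite -E fT2 ltnn in lt.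
  by have := two_split_sets T2 sF sG FG; move: fT2 cT2 lt; rank_lia.
have : #|T :\: A| <= rk T.
  rewrite -(rk_indep (indepS (subsetUl _ D) (base_indep T2b))).
  exact/rkS/subsetDl.
by move: cTA cA rFT; rank_lia.
Qed.

(** For every [e] outside [T] the set [e |: T] exceeds a split set. If [T] exceeds none, that split
    set contains [e] and is met by [T] in exactly its rank. Since [#|T| = d - 1], only one split set
    can be so, hence it contains all of [~: T], and its complement is too small. *)
Lemma split_set_small T : #|T|.+1 = d -> ~~ indep M T ->
  exists2 F, split_set M F & rk F < #|T :&: F|.
Proof.
move=> cT nT.
have ex e : e \notin T -> exists2 F, split_set M F & rk F < #|(e |: T) :&: F|.
  move=> eT; apply: nonbasis_split_set => //; first by rewrite cardsU1 eT.
  by apply: contra nT => /base_indep; apply/indepS/subsetUr.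
have [/exists_inP[F sF lt]|h] := boolP [exists F in split_set M, rk F < #|T :&: F|].
  by exists F.
have no F : split_set M F -> #|T :&: F| <= rk F.
  by move=> sF; rewrite leqNgt; apply: contra h => lt; apply/exists_inP; exists F.
have ex' e : e \notin T -> exists2 F, split_set M F & rk F = #|T :&: F| /\ e \in F.
  move=> eT; have [F sF b] := ex e eT; exists F => //; have := no F sF; move: b.
  case: (boolP (e \in F)) => eF.
    have -> : (e |: T) :&: F = e |: (T :&: F).
      by rewrite setIUl; congr (_ :|: _); apply/setIidPl; rewrite sub1set.
    by rewrite cardsU1 inE (negPf eT) => h1 h2; split=> //; apply/eqP; rewrite eqn_leq h2 andbT -ltnS.
  have -> : (e |: T) :&: F = T :&: F.
    by apply/setP=> x; rewrite !inE; case: (x =P e) => [->|//]; rewrite (negPf eF) !andbF.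
  by move=> lt le; have := leq_trans lt le; rewrite ltnn.
have [e0 e0T] : exists e, e \notin T.
  apply/existsP; rewrite -negb_forall; apply/negP => /forallP all.
  have TT : T = setT by apply/setP=> x; rewrite all inE.
  by have := mrank_le M; rewrite -cT TT cardsT card_ord ltnn.
have [F sF [rF e0F]] := ex' e0 e0T.
have sCF : ~: T \subset F.
  apply/subsetP=> e; rewrite inE => eT; have [G sG [rG eG]] := ex' e eT.
  have [->//|/eqP FG] := eqVneq F G.
  have := two_split_sets T sF sG FG; move: rF rG cT; rank_lia.
have := split_set_contraction_card conM n_ge2 sF.
have : #|~: F| <= #|T :\: F|.
  apply/subset_leq_card/subsetP=> x; rewrite !inE => xF; rewrite xF /=.
  by apply: contraNT xF => xT; apply: (subsetP sCF); rewrite inE.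
have := cardsID F T; move: rF cT; rank_lia.
Qed.

(** For every [e] in [T] the set [T :\ e] exceeds a split set. If no excess of [T] is at least 2,
    that split set misses [e] and has excess exactly 1 on [T]. Since [#|T| = d + 1], only one split
    set can be so, hence it misses all of [T], which is absurd. *)
Lemma split_set_large T : #|T| = d.+1 -> rk T < d ->
  exists2 F, split_set M F & (rk F).+1 < #|T :&: F|.
Proof.
move=> cT rT.
have ex e : e \in T -> exists2 F, split_set M F & rk F < #|(T :\ e) :&: F|.
  move=> eT; have cTe : #|T :\ e| = d by move: cT; rewrite (cardsD1 e T) eT => -[].
  apply: nonbasis_split_set => //; apply/negP => /base_indep/rk_indep; rewrite cTe => E.
  by have := rkS M (subD1set T e); rewrite E leqNgt rT.
have [/exists_inP[F sF lt]|h] := boolP [exists F in split_set M, (rk F).+1 < #|T :&: F|].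
  by exists F.
have no F : split_set M F -> #|T :&: F| <= (rk F).+1.
  by move=> sF; rewrite leqNgt; apply: contra h => lt; apply/exists_inP; exists F.
have ex' e : e \in T -> exists2 F, split_set M F & #|T :&: F| = (rk F).+1 /\ e \notin F.
  move=> eT; have [F sF b] := ex e eT; exists F => //; have := no F sF; move: b.
  rewrite setIDAC; case: (boolP (e \in F)) => eF.
    by rewrite (cardsD1 e (T :&: F)) inE eT eF /=; rank_lia.
  have -> : (T :&: F) :\ e = T :&: F.
    by apply/setP=> x; rewrite !inE; case: (x =P e) => [->|//]; rewrite (negPf eF) !andbF.
  by move=> h1 h2; split=> //; apply/eqP; rewrite eqn_leq h2.
have [e0 e0T] : exists e, e \in T by apply/set0Pn; rewrite -cards_eq0 cT.
have [F sF [rF e0F]] := ex' e0 e0T.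
have : T :&: F = set0.
  apply/setP=> e; rewrite !inE; apply/negbTE; rewrite negb_and -implybE; apply/implyP => eT.
  have [G sG [rG eG]] := ex' e eT.
  have [->//|/eqP FG] := eqVneq F G.
  have := two_split_sets T sF sG FG; move: rF rG cT; rank_lia.
by move=> E; move: rF; rewrite E cards0.
Qed.

Lemma lift_corank_attained S : #|S| = d.+1 -> S \notin bases N ->
  exists2 F, (F == setT) || split_set M F & d.+1 + rk F <= Defs.rk N S + #|S :&: @emb n @: F|.
Proof.
rewrite -(ext_setK S); set T := oldset S.
move: (elt_f n \in S) (elt_s n \in S) => a b; rewrite card_ext_set lift_bases.
have one (a' b' : bool) : a' || b' -> #|T| = d -> T \notin bases M ->
  exists2 F, (F == setT) || split_set M F &
     d.+1 + rk F <= Defs.rk N (ext_set T a' b') + #|ext_set T a' b' :&: @emb n @: F|.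
  move=> ab cT nT; have [F sF lt] := nonbasis_split_set conM cT nT.
  exists F; first by rewrite sF orbT.
  rewrite card_extI_emb; have := lift_rk_le1 T a' b'; rewrite ab.
  by have := rk_split_set sF (eq_leq cT) (ltnW lt); rewrite cT; rank_lia.
case: a b => [] [] /=; rewrite ?addn0 ?addn1.
- move=> [cT]; rewrite cT eqxx andbT => nT; have [F sF lt] := split_set_small cT nT.
  exists F; first by rewrite sF orbT.
  rewrite card_extI_emb; have leT : #|T| <= d by rewrite -cT.
  have rT : rk T < d by rewrite -cT ltnS rk_le_card.
  have := lift_rk_le2 rT; have := rk_split_set sF leT (ltnW lt); rewrite -cT.
  by rank_lia.
- by move=> [cT]; apply: one.
- by move=> [cT]; apply: one.
(* Only here does the old ground set serve as [F]: [S] avoids both new elements and spans [M]. *)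
move=> cT _; case: (ltnP (rk T) d) => rT; last first.
  exists setT; first by rewrite eqxx.
  rewrite card_extI_emb setIT cT; have := lift_rk_le1 T false false.
  by have := rk_le_mrank M setT; rewrite -[rk setT]/d; move: rT; rank_lia.
have [F sF lt] := split_set_large cT rT; exists F; first by rewrite sF orbT.
(* [rk_split_set] speaks of sets of size at most [d], so one surplus element of [F] is dropped; the
   excess 2 leaves enough. *)
have [e] : exists e, e \in T :&: F by apply/set0Pn; rewrite -cards_eq0; move: lt; rank_lia.
rewrite inE => /andP[eT eF]; rewrite card_extI_emb.
have := lift_rk_le1 T false false; have := rkS M (subD1set T e).
have : #|T :\ e| = d by move: cT; rewrite (cardsD1 e T) eT => -[].
have : #|(T :\ e) :&: F|.+1 = #|T :&: F| by rewrite setIDAC (cardsD1 e (T :&: F)) inE eT eF.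
move=> cTF cTe; have := @rk_split_set (T :\ e) F sF (eq_leq cTe).
by move: cTF cTe lt; rank_lia.
Qed.

End Lift.

(** * Exchange property of the rank function *)

Section ValuatedRank.
Variables (n : nat) (M : matroid n).
Implicit Types (S T D X : {set 'I_n}).
Local Notation rk := (rk M).

Lemma rk_coloops X D : D \subset X -> (forall j, j \in D -> rk (X :\ j) < rk X) ->
  rk (X :\: D) + #|D| <= rk X.
Proof.
have [k] := ubnP #|D|; elim: k => // k IH in D * => lek sDX col.
case: (set_0Vmem D) => [->|[j jD]]; first by rewrite cards0 addn0 rkS ?subsetDl.
have cD : #|D| = (#|D :\ j|).+1 by rewrite (cardsD1 j D) jD.
have h1 : rk (X :\: (D :\ j)) + #|D :\ j| <= rk X.
  apply: IH; first by move: lek; rewrite cD.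
    exact: subset_trans (subD1set _ _) sDX.
  by move=> i /setD1P[_ /col].
have := rkUI M (X :\: (D :\ j)) (X :\ j).
have -> : X :\: (D :\ j) :|: X :\ j = X.
  apply/setP=> x; rewrite !inE; move: (introT implyP (subsetP sDX x)).
  by case: (x =P j) => [->|_]; rewrite ?jD; case: (x \in D); case: (x \in X); case: (j \in X).
have -> : (X :\: (D :\ j)) :&: (X :\ j) = X :\: D.
  apply/setP=> x; rewrite !inE.
  have [->|/negPf xj] := eqVneq x j; rewrite ?eqxx ?xj ?jD /= ?andbF //.
  by case: (x \in D); case: (x \in X).
have := col j jD; move: h1; rewrite cD; rank_lia.
Qed.

(* The rank function is an M-concave (valuated matroid) function on the sets of
   a given cardinality. *)
Lemma rk_exchange S T i : #|S| = #|T| -> i \in S :\: T ->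
  exists2 j, j \in T :\: S & rk S + rk T <= rk (j |: S :\ i) + rk (i |: T :\ j).
Proof.
rewrite inE => cST /andP[iT iS]; pose D := T :\: S; pose S' := S :\ i.
have cD : #|D| = (#|S' :\: T|).+1.
  have := cardsID T S; have := cardsID S T; rewrite setIC -cST.
  have -> : S' :\: T = (S :\: T) :\ i by apply/setP=> x; rewrite !inE andbCA.
  have : i \in S :\: T by rewrite inE iT.
  by move=> h; rewrite (cardsD1 i (S :\: T)) h /D; rank_lia.
have [j0 j0D] : exists j, j \in D by apply/set0Pn; rewrite -cards_eq0 cD.
have DS j : j \in D -> j != i by move=> /setDP[_]; apply: contraNneq => ->.
have xE j : j \in D -> i |: T :\ j = (i |: T) :\ j.
  by move=> jD; apply/setP=> x; rewrite !inE; case: (x =P j) => [->|]; rewrite ?(negPf (DS j jD)).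
have S'le : rk S' <= rk S by rewrite rkS ?subD1set.
have leS : rk S <= (rk S').+1 by rewrite -(setD1K iS) rkU1.
have leT : rk T <= rk (i |: T) by rewrite rkS ?subsetUr.
have geT j : j \in D -> rk (i |: T) <= (rk ((i |: T) :\ j)).+1.
  move=> /setDP[jT _]; rewrite -{1}(@setD1K _ j (i |: T)) ?rkU1 // !inE jT orbT.
  done.
have ge1 j : rk S' <= rk (j |: S') by rewrite rkS ?subsetUr.
have S'T : S' :&: T = S :&: T.
  by apply/setP=> x; rewrite !inE; case: (x =P i) => [->|//]; rewrite (negPf iT) !andbF.
have S'rk : rk S' <= rk (S :&: T) + #|S' :\: T|.
  have := rkU_card M (S :&: T) S'; suff -> : S' :\: (S :&: T) = S' :\: T by [].
  by apply/setP=> x; rewrite !inE; case: (x \in S); rewrite ?andbF.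
have sTD : T \subset S' :|: D.
  apply/subsetP=> x xT; rewrite !inE xT; case: (x =P i) => [E|_]; first by rewrite -E xT in iT.
  by case: (x \in S).
have sDT : D \subset T := subsetDl _ _.
have TD : T :\: D = S :&: T by rewrite /D setDDr setDv set0U setIC.
have search (P : pred 'I_n) : (exists2 j, j \in D & P j) \/ (forall j, j \in D -> ~~ P j).
  have [/exists_inP[j jD Pj]|h] := boolP [exists j in D, P j]; first by left; exists j.
  by right=> j jD; apply: contra h => Pj; apply/exists_inP; exists j.
have spanD X : (forall j, j \in X -> rk (j |: S') <= rk S') -> rk (S' :|: X) = rk S'.
  by move=> h; apply: rk_span => j /h le; apply/eqP; rewrite eqn_leq le ge1.
have coT : (forall j, j \in D -> ~~ (rk T <= rk (T :\ j))) -> rk (S :&: T) + #|D| <= rk T.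
  by move=> h; rewrite -TD; apply: rk_coloops => // j /h; rewrite -ltnNge.
(* [D] has one element more than [S' :\: T], so [S'] cannot span [T] while every element of [D] is a
   coloop of [T]. *)
have noT : rk (S' :|: D) = rk S' -> ~ (rk (S :&: T) + #|D| <= rk T).
  by move=> sp; have := rkS M sTD; rewrite sp; move: S'rk cD; rank_lia.
(* The cases are whether [i] is a coloop of [S] and whether [T] spans [i]. Each of the two sets
   changes rank by at most one, so a gain on one side pays for a loss on the other. *)
case: (leqP (rk S) (rk S')) => rS.
  case: (leqP (rk (i |: T)) (rk T)) => riT; last first.
    exists j0 => //; rewrite xE //; have := geT j0 j0D; have := ge1 j0.
    by move: rS riT; rank_lia.
  have [[j jD rj]|col] := search (fun j => rk T <= rk ((i |: T) :\ j)).
    by exists j => //; rewrite xE //; move: (ge1 j) rj rS; rank_lia.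
  have [[j jD rj]|sp] := search (fun j => rk S' < rk (j |: S')).
    exists j => //; rewrite xE //; move: (geT j jD) leT rj rS; rank_lia.
  have {}sp : rk (S' :|: D) = rk S' by apply: spanD => j /sp; rewrite -leqNgt.
  case: (noT sp); apply: coT => j jD; apply: contra (col j jD) => h; apply: leq_trans h _.
  by apply/rkS/setSD/subsetUr.
case: (leqP (rk (i |: T)) (rk T)) => riT; last first.
  have [[j jD rj]|sp] := search (fun j => rk S <= rk (j |: S')).
    by exists j => //; rewrite xE //; move: (geT j jD) riT rj; rank_lia.
  have {}sp : rk (S' :|: D) = rk S'.
    by apply: spanD => j /sp; rewrite -ltnNge; move: leS; rank_lia.
  have [[j jD rj]|col] := search (fun j => rk T <= rk (T :\ j)); last by case: (noT sp); apply: coT.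
  exists j => //; have := ge1 j; suff : rk T < rk (i |: T :\ j) by move: leS; rank_lia.
  rewrite ltnNge; apply/negP => le; have E : rk (i |: T :\ j) = rk (T :\ j).
    apply/eqP; rewrite eqn_leq (leq_trans le rj) /=; exact/rkS/subsetUr.
  by have := rkU1_span (subD1set T j) E; move: riT; rank_lia.
have [[j jD /andP[rj rj']]|sp] := search (fun j => (rk T <= rk ((i |: T) :\ j)) && (rk S <= rk (j |: S'))).
  by exists j => //; rewrite xE //; move: rj rj'; rank_lia.
(* The elements of [J] can leave [i |: T] at no cost and, as no [j] serves both sides, are spanned
   by [S']. The rest of [D] are coloops of [i |: T], so [i] is spanned by what remains of [T], hence
   by [S'], although [i] is a coloop of [S]. *)
pose J := [set j in D | rk T <= rk ((i |: T) :\ j)].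
have sJD : J \subset D by apply/subsetP=> j; rewrite inE => /andP[].
have spJ : rk (S' :|: J) = rk S'.
  apply: spanD => j; rewrite inE => /andP[jD rj].
  by have := sp j jD; rewrite rj /= -ltnNge; move: leS; rank_lia.
have col : rk ((i |: T) :\: (D :\: J)) + #|D :\: J| <= rk (i |: T).
  apply: rk_coloops.
    by apply: subset_trans (subsetUr _ _); apply: subset_trans (subsetDl _ _) sDT.
  move=> j; rewrite in_setD => /andP[nJ jD]; apply: leq_trans leT; rewrite ltnNge.
  by apply: contra nJ; rewrite [j \in J]inE jD.
have sJT : T :\: (D :\: J) \subset S' :|: J.
  apply/subsetP=> x; rewrite [x \in _ :\: _]inE [x \in D :\: J]inE => /andP[h xT].
  have := subsetP sTD x xT; rewrite !(in_setU x S'); case: (x \in S') => //= xD.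
  by move: h; rewrite xD andbT negbK.
have E : (i |: T) :\: (D :\: J) = i |: T :\: (D :\: J).
  apply/setP=> x; rewrite !inE; have [->|_] := eqVneq x i; last by [].
  by rewrite iS.
have rE : rk (i |: T :\: (D :\: J)) = rk (T :\: (D :\: J)).
  apply/eqP; rewrite eqn_leq (rkS _ (subsetUr _ _)) andbT -E.
  have := rkU_card M (T :\: (D :\: J)) T.
  have -> : T :\: (T :\: (D :\: J)) = D :\: J.
    rewrite setDDr setDv set0U; apply/setIidPr.
    by apply: subset_trans (subsetDl _ _) sDT.
  by move: col riT; rank_lia.
have := rkU1_span sJT rE; rewrite spJ.
have : rk S <= rk (i |: (S' :|: J)) by rewrite setUA setD1K // rkS ?subsetUl.
by move: rS; rank_lia.
Qed.

End ValuatedRank.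

Import GRing.Theory.
Local Open Scope ring_scope.

(** * Linear forms that are constant on a face *)

Section ConstantSums.
Variables (V : zmodType) (n : nat).
Implicit Types (B F : {set 'I_n}) (al : 'I_n -> V).

Lemma sum_exch al B x y : x \in B -> y \notin B ->
  \sum_(i in y |: B :\ x) al i = \sum_(i in B) al i - al x + al y.
Proof.
move=> xB yB; rewrite big_setU1 ?inE ?(negPf yB) ?andbF //=.
by rewrite [in RHS](big_setD1 x xB) /= [al x + _]addrC addrK addrC.
Qed.

Lemma face_base_exists (M : matroid n) F : exists B, face_base M F B.
Proof. by have [B Bb rB] := rk_attained M F; exists B; rewrite /face_base Bb rB eqxx. Qed.

(** An exchange inside the face keeps the sum, so it trades elements with equal coefficients on the
    same side of [F]. *)
Lemma exchange_closed_level (M : matroid n) F al (c v : V) (X : {set 'I_n}) :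
  (forall B, face_base M F B -> \sum_(i in B) al i = c) ->
  (X = F \/ X = ~: F) ->
  exchange_closed M F [set i in X | al i == v].
Proof.
move=> h XF B x y fB xB yB fy; rewrite !inE => /andP[xX /eqP ax].
have E := h _ fy; rewrite sum_exch // (h _ fB) in E.
have -> : al y = al x by apply: (addrI (c - al x)); rewrite E subrK.
have side := face_exchange_side fB xB yB fy.
by rewrite ax eqxx andbT; case: XF xX => ->; rewrite ?inE side.
Qed.

Lemma const_restriction (M : matroid n) F al c : restriction_connected M F ->
  (forall B, face_base M F B -> \sum_(i in B) al i = c) ->
  exists x, forall i, i \in F -> al i = x.
Proof.
move=> conF h; case: (set_0Vmem F) => [->|[i0 i0F]]; first by exists 0 => i; rewrite inE.
exists (al i0) => i iF; pose X := [set i in F | al i == al i0].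
have XF : X = F.
  apply: (exchange_closed_restriction conF).
  - by apply/subsetP=> j; rewrite inE => /andP[].
  - by apply/set0Pn; exists i0; rewrite inE i0F eqxx.
  exact: exchange_closed_level h (or_introl erefl).
by move: iF; rewrite -XF inE => /andP[_ /eqP].
Qed.

Lemma const_contraction (M : matroid n) F al c : contraction_connected M F ->
  (forall B, face_base M F B -> \sum_(i in B) al i = c) ->
  exists y, forall i, i \notin F -> al i = y.
Proof.
move=> conF h; case: (set_0Vmem (~: F)) => [E|[i0 i0F]].
  by exists 0 => i; rewrite -in_setC E inE.
exists (al i0) => i iF; pose X := [set i in ~: F | al i == al i0].
have XF : X = ~: F.
  apply: (exchange_closed_contraction conF).
  - by apply/subsetP=> j; rewrite inE => /andP[].
  - by apply/set0Pn; exists i0; rewrite inE i0F eqxx.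
  exact: exchange_closed_level h (or_intror erefl).
by move: iF; rewrite -in_setC -XF inE => /andP[_ /eqP].
Qed.

End ConstantSums.

Section LiftFaces.
Variables (V : zmodType) (n : nat) (M : matroid n).
Hypotheses (conM : mconnected M) (n_ge2 : (2 <= n)%N).
Implicit Types (T F : {set 'I_n}) (al : 'I_n.+2 -> V).

Lemma widen_lift m (i : 'I_m) : widen_ord (leqnSn m) i = lift ord_max i.
Proof. by apply: val_inj; apply: esym (lift_max i). Qed.

Lemma sum_ext_set al T a b : \sum_(j in ext_set T a b) al j =
  \sum_(i in T) al (emb i) + al (elt_f n) *+ a + al (elt_s n) *+ b.
Proof.
rewrite big_mkcond big_ord_recr big_ord_recr /=.
rewrite !widen_lift -/(elt_f n) -/(elt_s n) !mem_extE [in RHS]big_mkcond /=; congr (_ + _ + _); last first.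
- by case: b.
- by case: a.
by apply: eq_bigr => i _; rewrite !widen_lift -/(emb i) mem_extE.
Qed.

Lemma lift_face_const F al c : (F == setT) || split_set M F ->
  (forall S, S \in bases (series_free_lift M) -> #|S :&: @emb n @: F| = rk M F ->
     \sum_(j in S) al j = c) ->
  exists x y, forall j, al j = if j \in @emb n @: F then x else y.
Proof.
move=> hF h.
have hB (a b : bool) B : a != b -> face_base M F B ->
    \sum_(i in B) al (emb i) + al (elt_f n) *+ a + al (elt_s n) *+ b = c.
  move=> ab /andP[Bb /eqP rB]; rewrite -sum_ext_set; apply: h; last by rewrite card_extI_emb.
  by rewrite lift_bases; case: a b ab => [] [].
have [B0 fB0] := face_base_exists M F.
have fs : al (elt_f n) = al (elt_s n).
  have := hB true false B0 isT fB0; rewrite -(hB false true B0 isT fB0) /=.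
  by rewrite !mulr0n !mulr1n !addr0 => /addrI.
have hB' B : face_base M F B -> \sum_(i in B) al (emb i) = c - al (elt_s n).
  by move=> /(hB false true B isT); rewrite mulr0n mulr1n addr0 => <-; rewrite addrK.
have [x hx] : exists x, forall i, i \in F -> al (emb i) = x.
  apply: const_restriction hB'; case/orP: hF => [/eqP->|/and3P[/and4P[]]] //.
  exact/mconnectedP.
exists x, (al (elt_s n)); elim/ord2_cases => [i||]; rewrite imsetE ?fs //.
case: ifP => [/hx//|iF]; case/orP: hF => [/eqP E|sF]; first by rewrite E inE in iF.
have [y hy] : exists y, forall i, i \notin F -> al (emb i) = y.
  by apply: const_contraction hB'; case/and3P: sF => /and4P[].
rewrite hy ?iF //; have /andP[Bb /eqP rB] := fB0.
have [e] : exists e, e \in B0 :\: F.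
  apply/set0Pn; rewrite -cards_eq0 cardsD rB (mrank_card Bb) subn_eq0 -ltnNge.
  by case/and3P: sF.
rewrite inE => /andP[eF eB]; rewrite -(hy e eF).
have Sb : ext_set (B0 :\ e) true true \in bases (series_free_lift M).
  rewrite lift_bases /= (indepS (subD1set _ _) (base_indep Bb)) /=.
  by rewrite -(mrank_card Bb) (cardsD1 e B0) eB.
have := h _ Sb; rewrite card_extI_emb sum_ext_set /= !mulr1n fs.
have -> : (B0 :\ e) :&: F = B0 :&: F.
  by apply/setP=> z; rewrite !inE; have [->|] := eqVneq z e; rewrite ?(negPf eF) ?andbF.
move=> /(_ rB); have := hB' _ fB0; rewrite (big_setD1 e eB) /= => E1 E2.
apply: (addIr (\sum_(i in B0 :\ e) al (emb i))); rewrite E1 -E2 addrK.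
by rewrite addrC.
Qed.

End LiftFaces.

(** * Matrices over a field representing a matroid *)

Section RowRank.
Variables (K : fieldType) (m k : nat) (B : 'M[K]_(m, k)).
Implicit Types (S T I J : {set 'I_m}).

(** Elements are rows here, whereas [realizable] has them as columns. The brackets give all summands
    one square type, as a big sum of row spaces requires. *)
Definition rowspan S : 'M[K]_k := (\sum_(i in S) <<row i B>>)%MS.
Definition rowrank S := \rank (rowspan S).

Lemma row_rowspan S i : i \in S -> (row i B <= rowspan S)%MS.
Proof. by move=> iS; apply: (sumsmx_sup i) => //; rewrite genmxE. Qed.

Lemma rowspan_sub S p (C : 'M_(p, k)) : (forall i, i \in S -> (row i B <= C)%MS) -> (rowspan S <= C)%MS.
Proof. by move=> h; apply/sumsmx_subP => i iS; rewrite genmxE h. Qed.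

Lemma rowrankS S T : S \subset T -> (rowrank S <= rowrank T)%N.
Proof.
move=> sST; apply/mxrankS/rowspan_sub => i iS; exact: row_rowspan (subsetP sST i iS).
Qed.

Lemma rowrankU1 x S : (rowrank (x |: S) <= (rowrank S).+1)%N.
Proof.
have sub : (rowspan (x |: S) <= rowspan S + row x B)%MS.
  apply: rowspan_sub => i; rewrite !inE => /orP[/eqP->|iS]; first exact: addsmxSr.
  by apply: submx_trans (addsmxSl _ _); apply: row_rowspan.
apply: leq_trans (mxrankS sub) _; apply: leq_trans (mxrank_adds_leqif _ _) _.
by apply: leq_trans (leq_add (leqnn _) (rank_leq_row _)) _; rewrite addn1.
Qed.

Lemma rowrankU_card S T : (rowrank (S :|: T) <= rowrank S + #|T|)%N.
Proof.
have [p] := ubnP #|T|; elim: p => // p IH in T *.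
case: (set_0Vmem T) => [->|[x xT]]; first by rewrite setU0 cards0 addn0.
rewrite (cardsD1 x T) xT add1n ltnS => lep; rewrite -{1}(setD1K xT) setUCA addnS.
by apply: leq_trans (rowrankU1 _ _) _; rewrite ltnS; apply: IH.
Qed.

Lemma rowrank0 : rowrank set0 = 0%N.
Proof. by rewrite /rowrank /rowspan big_set0 mxrank0. Qed.

Lemma rowrank_le_card S : (rowrank S <= #|S|)%N.
Proof.
by have := rowrankU_card set0 S; rewrite set0U rowrank0.
Qed.

Lemma rowrank_le S : (rowrank S <= k)%N. Proof. exact: rank_leq_row. Qed.

Lemma row_indepS I J : I \subset J -> rowrank J = #|J| -> rowrank I = #|I|.
Proof.
move=> sIJ rJ; apply/eqP; rewrite eqn_leq rowrank_le_card /=.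
have := rowrankU_card I (J :\: I); have -> : I :|: J :\: I = J.
  by rewrite -{1}(setIidPr sIJ) setID.
have := cardsID I J; rewrite (setIidPr sIJ) rJ; rank_lia.
Qed.

Lemma row_indep_extend I S : I \subset S -> rowrank I = #|I| ->
  exists J, [/\ I \subset J, J \subset S, rowrank J = #|J| & rowrank J = rowrank S].
Proof.
move=> sIS rI; pose P (J : {set 'I_m}) := [&& I \subset J, J \subset S & rowrank J == #|J|].
have PI : P I by rewrite /P subxx sIS rI eqxx.
case: (@arg_maxnP _ I P (fun J : {set 'I_m} => #|J|) PI) => J /and3P[sIJ sJS /eqP rJ] maxJ.
exists J; split=> //; apply/eqP; rewrite eqn_leq rowrankS //=.
apply/mxrankS/rowspan_sub => x xS; apply: contraT => xJ.
have xnJ : x \notin J by apply: contra xJ; apply: row_rowspan.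
have : P (x |: J).
  rewrite /P (subset_trans sIJ (subsetUr _ _)) subUset sub1set xS sJS /=.
  rewrite eqn_leq rowrank_le_card cardsU1 xnJ add1n -rJ /=.
  have : (rowspan J < rowspan (x |: J))%MS.
    rewrite /ltmx; apply/andP; split.
      by apply: rowspan_sub => i iJ; apply: row_rowspan; rewrite inE iJ orbT.
    apply: contra xJ; apply: submx_trans; apply: row_rowspan; by rewrite !inE eqxx.
  by rewrite ltmxErank => /andP[].
by move=> /maxJ; rewrite /= cardsU1 xnJ add1n ltnn.
Qed.

Lemma rank_rowsub p (f : 'I_p -> 'I_m) : \rank (rowsub f B) = rowrank (f @: setT).
Proof.
apply/eqP; rewrite eqn_leq; apply/andP; split; apply: mxrankS; last first.
  apply: rowspan_sub => _ /imsetP[j _ ->].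
  have -> : row (f j) B = row j (rowsub f B) by apply/rowP => l; rewrite !mxE.
  exact: row_sub.
apply/row_subP => j; have -> : row j (rowsub f B) = row (f j) B by apply/rowP => l; rewrite !mxE.
exact/row_rowspan/imset_f.
Qed.

Lemma rowrank_rk (N : matroid m) : mrank N = k ->
  (forall S, #|S| = k -> (rowrank S == k) = (S \in bases N)) -> forall T, rowrank T = rk N T.
Proof.
move=> rN h T; apply/eqP; rewrite eqn_leq; apply/andP; split.
  have [|J [_ sJT rJ rJT]] := @row_indep_extend set0 T (sub0set _).
    by rewrite rowrank0 cards0.
  have [J' [sJJ' _ rJ' rJ'T]] := row_indep_extend (subsetT J) rJ.
  have cJ' : #|J'| = k.
    rewrite -rJ' rJ'T; apply/eqP; rewrite eqn_leq rowrank_le /=.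
    have /set0Pn[B0 B0b] := bases_neq0 N; have cB0 := etrans (mrank_card B0b) rN.
    by have := h B0 cB0; rewrite B0b => /eqP <-; apply/rowrankS/subsetT.
  have J'b : J' \in bases N by rewrite -h // rJ' cJ'.
  by rewrite -rJT rJ -(rk_indep (indepS sJJ' (base_indep J'b))) rkS.
have [B0 B0b <-] := rk_attained N T; have cB0 := etrans (mrank_card B0b) rN.
have rB0 : rowrank B0 = #|B0| by have := h B0 cB0; rewrite B0b cB0 => /eqP.
by rewrite -(row_indepS (subsetIl B0 T) rB0) rowrankS ?subsetIr.
Qed.

Lemma rowrank_indep_rk (N : matroid m) :
  (forall S, indep N S = (rowrank S == #|S|)) -> forall T, rowrank T = rk N T.
Proof.
move=> h T; apply/eqP; rewrite eqn_leq; apply/andP; split.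
  have [|J [_ sJT rJ <-]] := @row_indep_extend set0 T (sub0set _).
    by rewrite rowrank0 cards0.
  have iJ : indep N J by rewrite h rJ eqxx.
  by rewrite rJ -(rk_indep iJ) rkS.
have [B0 B0b <-] := rk_attained N T.
have : indep N (B0 :&: T) := indepS (subsetIl _ _) (base_indep B0b).
by rewrite h => /eqP <-; rewrite rowrankS ?subsetIr.
Qed.

End RowRank.

Lemma rank_colsub (K : fieldType) k m p (A : 'M[K]_(k, m)) (f : 'I_p -> 'I_m) :
  \rank (colsub f A) = rowrank A^T (f @: setT).
Proof. by rewrite -mxrank_tr trmx_mxsub rank_rowsub. Qed.

Lemma enum_val_imset (T : finType) (S : {set T}) : (@enum_val _ (mem S)) @: setT = S.
Proof.
apply/setP=> x; apply/imsetP/idP => [[j _ ->]|xS]; first exact: enum_valP.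
by exists (enum_rank_in xS x); rewrite ?enum_rankK_in.
Qed.

(** A realization may have redundant rows; its row base keeps all ranks of column sets and has
    exactly [mrank M] rows. *)
Lemma realizable_rowrank (K : fieldType) n (M : matroid n) : realizable K M ->
  exists A : 'M[K]_(n, mrank M), forall S, rowrank A S = rk M S.
Proof.
move=> [r [A hA]]; have rA : forall S, rowrank A^T S = rk M S.
  by apply: rowrank_indep_rk => S; rewrite hA rank_colsub enum_val_imset.
have : exists A' : 'M[K]_(\rank A, n), forall S, rowrank A'^T S = rk M S.
  exists (row_base A) => S; rewrite -rA -(enum_val_imset S) -!rank_colsub.
  have <- : col_base A *m colsub (@enum_val _ (mem S)) (row_base A) = colsub (@enum_val _ (mem S)) A.
    by rewrite mulmx_colsub mulmx_base.
  by rewrite (eqmxMfull _ (col_base_full A)).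
have -> : \rank A = mrank M.
  rewrite -[RHS]/(rk M setT) -rA -(enum_val_imset setT) -rank_colsub.
  rewrite rank_colsub enum_val_imset -mxrank_tr; apply/eqP; rewrite eqn_leq.
  apply/andP; split; apply: mxrankS; last by apply: rowspan_sub => i _; apply: row_sub.
  by apply/row_subP => i; apply: row_rowspan; rewrite inE.
by move=> [A' hA']; exists A'^T.
Qed.

Lemma rowrank_realizable (K : fieldType) n k (M : matroid n) (A : 'M[K]_(n, k)) :
  (forall S, rowrank A S = rk M S) -> realizable K M.
Proof.
by move=> h; exists k, A^T => S; rewrite rank_colsub enum_val_imset trmxK h indepE.
Qed.

(** * Generic points over an algebraically closed field *)

Section Generic.
Variables (K : closedFieldType) (V : lmodType K).

(** If [p] is not constant, [p - 1] has a root, and there [p] takes the value 1. *)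
Lemma exists_nonroot (p : {poly K}) : p != 0 -> exists y, p.[y] != 0.
Proof.
move=> p0; have [/eqP/size_poly1P[c c0 ->]|sp] := eqVneq (size p) 1%N.
  by exists 0; rewrite hornerC.
have sp1 : (1 < size p)%N.
  by move: sp p0; rewrite -size_poly_eq0; case: (size p) => [|[]].
have /closed_rootP[y] : size (p - 1) != 1%N by rewrite size_polyDl // size_polyN size_poly1.
rewrite /root !hornerE subr_eq0 => /eqP E; exists y; by rewrite E oner_eq0.
Qed.

(** The only trace of being a polynomial in many variables that the choice of a generic point
    uses. *)
Definition poly_on_lines (f : V -> K) := forall u w, exists p : {poly K}, forall y, f (u + y *: w) = p.[y].

(** Join a point that is good for the functions treated so far to one that is good for the next
    function. On this line each function is a nonzero polynomial in one variable, and so is their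
    product. *)
Lemma generic_point (I : eqType) (s : seq I) (f : I -> V -> K) :
  (forall i, poly_on_lines (f i)) -> (forall i, i \in s -> exists u, f i u != 0) ->
  exists u, forall i, i \in s -> f i u != 0.
Proof.
move=> hf; elim: s => [|i s IH] h; first by exists 0.
have [|u hu] := IH; first by move=> j js; apply: h; rewrite inE js orbT.
have [w hw] := h i (mem_head _ _).
have pick j : exists p : {poly K}, forall y, f j (u + y *: (w - u)) = p.[y] by apply: hf.
have [q q0 hq] : exists2 q : {poly K}, q != 0 & forall y, q.[y] != 0 ->
    forall j, j \in i :: s -> f j (u + y *: (w - u)) != 0.
  have : forall j, j \in i :: s -> exists y, f j (u + y *: (w - u)) != 0.
    move=> j; rewrite inE => /orP[/eqP->|js]; first by exists 1; rewrite scale1r addrC subrK.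
    by exists 0; rewrite scale0r addr0 hu.
  elim: (i :: s) => [|j l IHl] hl; first by exists 1; rewrite ?oner_eq0.
  have [|q q0 hq] := IHl; first by move=> j' jl; apply: hl; rewrite inE jl orbT.
  have [p hp] := pick j; have [y0 hy0] := hl j (mem_head _ _).
  have p0 : p != 0 by apply: contraNneq hy0 => p0; rewrite hp p0 horner0.
  exists (p * q); first by rewrite mulf_neq0.
  move=> y; rewrite hornerM mulf_eq0 negb_or => /andP[py qy] j'.
  by rewrite inE => /orP[/eqP->|]; [rewrite hp | apply: hq].
have [y qy] := exists_nonroot q0.
by exists (u + y *: (w - u)); apply: hq.
Qed.

End Generic.

Section LiftRealization.
Variables (K : closedFieldType) (n d : nat) (M : matroid n) (A : 'M[K]_(n, d)).
Implicit Types (T : {set 'I_n}).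

(** A linear form vanishing on the rows in [T], nonzero if these do not span. Avoiding its kernel
    keeps a vector out of their span. *)
Definition annihilator T : 'cV[K]_d :=
  if [pick j | col j (cokermx (rowspan A T)) != 0] is Some j
  then col j (cokermx (rowspan A T)) else 0.

Lemma annihilatorP T : rowspan A T *m annihilator T = 0.
Proof.
rewrite /annihilator; case: pickP => [j _|_]; last by rewrite mulmx0.
by rewrite colE mulmxA mulmx_coker mul0mx.
Qed.

Lemma annihilator_neq0 T : (rowrank A T < d)%N -> annihilator T != 0.
Proof.
move=> lt; rewrite /annihilator; case: pickP => [//|h].
have : cokermx (rowspan A T) = 0.
  by apply/matrixP => i j; have /negbFE/eqP/matrixP/(_ i 0) := h j; rewrite !mxE.
move=> E; have := mxrank_coker (rowspan A T); rewrite E mxrank0 => /esym/eqP.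
by rewrite subn_eq0 leqNgt lt.
Qed.

Lemma generic_vector : exists v : 'rV[K]_d,
  forall T, (rowrank A T < d)%N -> ~~ (v <= rowspan A T)%MS.
Proof.
pose f T (v : 'rV[K]_d) : K := if (rowrank A T < d)%N then (v *m annihilator T) 0 0 else 1.
have [||v hv] := @generic_point K 'rV[K]_d {set 'I_n} (enum {set 'I_n}) f.
- move=> T u w; rewrite /f; case: (rowrank A T < d)%N; last by exists 1 => y; rewrite hornerE.
  exists (((u *m annihilator T) 0 0)%:P + ((w *m annihilator T) 0 0)%:P * 'X) => y.
  by rewrite !hornerE mulmxDl -scalemxAl !mxE mulrC.
- move=> T _; rewrite /f; case: (boolP (rowrank A T < d)%N) => lt; last by exists 0; rewrite oner_eq0.
  have /eqP/matrixP nz := annihilator_neq0 lt.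
  have [i hi] : exists i, annihilator T i 0 != 0.
    apply/existsP; apply: contraT; rewrite negb_exists => /forallP h; case: nz => i j.
    by rewrite ord1 [RHS]mxE; apply/eqP/negPn/h.
  by exists (delta_mx 0 i); rewrite -rowE mxE.
exists v => T lt; apply/negP => /submxP[D E]; have := hv T; rewrite mem_enum => /(_ isT).
by rewrite /f lt E -mulmxA annihilatorP mulmx0 mxE eqxx.
Qed.

Section WithVector.
Hypotheses (rankM : mrank M = d) (hA : forall S, rowrank A S = rk M S).
Variable v : 'rV[K]_d.
Hypothesis hv : forall T, (rowrank A T < d)%N -> ~~ (v <= rowspan A T)%MS.

Definition lift_matrix : 'M[K]_(n.+2, 1 + d) := \matrix_(x < n.+2)
  oapp (fun y => oapp (fun i => row_mx 0 (row i A)) (row_mx 1 0) (unlift ord_max y))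
       (row_mx 1 v) (unlift ord_max x).

Lemma lift_row_emb i : row (emb i) lift_matrix = row_mx 0 (row i A).
Proof. by rewrite rowK /emb liftK /= liftK. Qed.
Lemma lift_row_f : row (elt_f n) lift_matrix = row_mx 1 0.
Proof. by rewrite rowK liftK /= unlift_none. Qed.
Lemma lift_row_s : row (elt_s n) lift_matrix = row_mx 1 v.
Proof. by rewrite rowK unlift_none. Qed.

Local Notation W T := (rowspan A T).
Local Notation low X := (row_mx 0 X : 'M[K]_(_, 1 + d)).

Lemma lowE p (X : 'M[K]_(p, d)) : low X = X *m low 1%:M.
Proof. by rewrite mul_mx_row mulmx0 mulmx1. Qed.

Lemma lift_rowspan T (a b : bool) : (rowspan lift_matrix (ext_set T a b) :=:
  low (W T) + (if a then row_mx 1 0 else 0) + (if b then row_mx 1 v else 0))%MS.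
Proof.
apply/eqmxP/andP; split.
  apply: rowspan_sub; elim/ord2_cases => [i||]; rewrite mem_extE.
  - move=> iT; rewrite lift_row_emb -addsmxA; apply: submx_trans (addsmxSl _ _).
    by rewrite lowE [low (W T)]lowE submxMr // row_rowspan.
  - move=> ->; rewrite lift_row_f; apply: submx_trans (addsmxSl _ _); exact: addsmxSr.
  - move=> ->; rewrite lift_row_s; exact: addsmxSr.
rewrite !addsmx_sub; apply/andP; split; [apply/andP; split|].
- rewrite lowE /rowspan sumsmxMr_gen; apply/sumsmx_subP => i iT; rewrite genmxE.
  rewrite (eqmxMr _ (genmxE _)) -lowE -lift_row_emb; apply: row_rowspan; by rewrite mem_extE.
- case: a; rewrite ?sub0mx // -lift_row_f; apply: row_rowspan; by rewrite mem_extE.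
- case: b; rewrite ?sub0mx // -lift_row_s; apply: row_rowspan; by rewrite mem_extE.
Qed.

Lemma rank_low_one p (X : 'M[K]_(p, d)) (w : 'rV[K]_d) :
  \rank (low X + (row_mx 1 w : 'rV[K]_(1 + d)))%MS = (\rank X).+1.
Proof.
rewrite (addsmxC (low X)) addsmxE.
have -> : col_mx (row_mx 1 w) (low X) = block_mx 1%:M 0 0 X *m block_mx 1%:M w 0 1%:M.
  by rewrite mulmx_block !mul1mx !mul0mx !mulmx0 !mulmx1 !addr0 !add0r.
rewrite mxrankMfree ?rank_diag_block_mx ?mxrank1 // row_free_unit unitmxE.
by rewrite det_ublock !det1 mulr1 unitr1.
Qed.

(** Since (1, v) - (1, 0) = (0, v), the second new row only adjoins [v] to the span of [X]. *)
Lemma rank_low_two p (X : 'M[K]_(p, d)) :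
  \rank (low X + (row_mx 1 0 : 'rV[K]_(1 + d)) + row_mx 1 v)%MS = (\rank (X + v)%MS).+1.
Proof.
rewrite -(rank_low_one (X + v)%MS 0); apply/eqP; rewrite eqn_leq; apply/andP.
have sv : row_mx 1 v = low v + row_mx 1 0 :> 'rV[K]_(1 + d) by rewrite add_row_mx add0r addr0.
have lowS q q' (Y : 'M[K]_(q, d)) (Z : 'M[K]_(q', d)) : (Y <= Z)%MS -> (low Y <= low Z)%MS.
  by move=> YZ; rewrite lowE [low Z]lowE submxMr.
split; apply: mxrankS; rewrite !addsmx_sub.
  rewrite addsmxSr (submx_trans (lowS _ _ _ _ (addsmxSl X v)) (addsmxSl _ _)) /=.
  rewrite sv addmx_sub ?addsmxSr // (submx_trans _ (addsmxSl _ _)) // lowS ?addsmxSr //.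
apply/andP; split; last by rewrite -addsmxA (submx_trans _ (addsmxSr _ _)) // addsmxSl.
rewrite lowE addsmxMr addsmx_sub -!lowE; apply/andP; split.
  by rewrite -addsmxA addsmxSl.
have -> : low v = row_mx 1 v - row_mx 1 0 :> 'rV[K]_(1 + d) by rewrite sv addrK.
rewrite addmx_sub ?addsmxSr // eqmx_opp -addsmxA (submx_trans _ (addsmxSr _ _)) //.
exact: addsmxSl.
Qed.

Lemma lift_matrix_bases (S : {set 'I_n.+2}) : #|S| = d.+1 ->
  (rowrank lift_matrix S == d.+1) = (S \in bases (series_free_lift M)).
Proof.
rewrite -(ext_setK S); set T := oldset S.
move: (elt_f n \in S) (elt_s n \in S) => a b; rewrite card_ext_set lift_bases.
have basesE : #|T| = d -> (T \in bases M) = (rowrank A T == d).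
  by move=> cT; rewrite bases_rk rankM cT eqxx hA.
rewrite /rowrank lift_rowspan; case: a b => [] [] /=; rewrite ?addn0 ?addn1 ?addsmx0.
(* Genericity decides this case: [v] raises the rank of every span that is not full, so full rank is
   reached exactly when the [d - 1] rows in [T] are independent. *)
- rewrite rank_low_two eqSS => -[cT]; rewrite rankM cT eqxx andbT indepE -hA.
  have sub : (W T <= W T + v)%MS := addsmxSl _ _.
  have le1 : (\rank (W T + v)%MS <= (rowrank A T).+1)%N.
    apply: leq_trans (mxrank_adds_leqif _ _) _.
    by apply: leq_trans (leq_add (leqnn _) (rank_leq_row _)) _; rewrite addn1.
  have leT := rowrank_le_card A T.
  apply/eqP/eqP => [E|E].
    by apply/eqP; rewrite eqn_leq leT -ltnS cT; move: le1; rewrite E.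
  have lt : (rowrank A T < d)%N by rewrite E cT.
  apply/eqP; rewrite eqn_leq rank_leq_row /=.
  have : (W T < W T + v)%MS.
    by rewrite /ltmx sub /=; apply: contra (hv lt); apply: submx_trans; apply: addsmxSr.
  by rewrite ltmxErank -/(rowrank A T) E cT => /andP[].
- by rewrite rank_low_one eqSS => -[cT]; rewrite basesE.
- by rewrite (adds_eqmx (addsmx0 _ _) (eqmx_refl _)) rank_low_one eqSS => -[cT]; rewrite basesE.
move=> _; apply/negbTE; rewrite neq_ltn ltnS; apply/orP; left.
by rewrite lowE (leq_trans (mxrankM_maxl _ _)) // rank_leq_row.
Qed.

End WithVector.
End LiftRealization.

Lemma realizable_lift (K : closedFieldType) n (M : matroid n) : realizable K M ->
  exists B : 'M[K]_(n.+2, (mrank M).+1), forall S, rowrank B S = rk (series_free_lift M) S.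
Proof.
move=> /realizable_rowrank[A hA]; have [v hv] := generic_vector A.
exists (lift_matrix A v); apply: rowrank_rk; first exact: mrank_series_free_lift.
by move=> S cS; apply: (lift_matrix_bases erefl hA hv).
Qed.

(** * Determinants of the perturbation A + tG *)

Section Perturbation.
Variables (K : fieldType) (k : nat).
Implicit Types A G : 'M[K]_k.

Definition perturb p q (A G : 'M[K]_(p, q)) : 'M[{poly K}]_(p, q) :=
  map_mx polyC A + 'X *: map_mx polyC G.

Lemma perturbE p q (A G : 'M[K]_(p, q)) i j : perturb A G i j = (A i j)%:P + (G i j)%:P * 'X.
Proof. by rewrite !mxE mulrC. Qed.

Definition stair r : 'rV[{poly K}]_k := \row_i (if (i < r)%N then 1 else 'X).

Lemma det_stair r : \det (diag_mx (stair r)) = 'X^(k - r).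
Proof.
rewrite det_diag; under eq_bigr do rewrite mxE.
elim: k => [|p IH]; first by rewrite big_ord0.
rewrite big_ord_recr /= IH; case: ltnP => h.
  by rewrite mulr1; congr 'X^_; move: h; clear; lia.
by rewrite -exprSr subSn.
Qed.

Lemma perturb_mul A A' G' L U : A = L *m A' *m U ->
  perturb A (L *m G' *m U) = map_mx polyC L *m perturb A' G' *m map_mx polyC U.
Proof.
by move=> ->; rewrite /perturb mulmxDr mulmxDl !map_mxM -scalemxAr -scalemxAl.
Qed.

Lemma perturb_pid r G : perturb (pid_mx r) G = diag_mx (stair r) *m
  \matrix_(i, j) (if (i < r)%N then (pid_mx r i j)%:P + (G i j)%:P * 'X else (G i j)%:P).
Proof.
apply/matrixP => i j; rewrite perturbE mul_diag_mx !mxE; case: ltnP => h.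
  by rewrite mul1r andbT.
by rewrite andbF add0r mulrC.
Qed.

(** In coordinates where [A] becomes [pid_mx (\rank A)], every row beyond the rank is a multiple of
    the variable and gives up one factor. *)
Lemma det_perturb A G : exists q, \det (perturb A G) = q * 'X^(k - \rank A).
Proof.
have E := mulmx_ebase A; set L := col_ebase A in E; set U := row_ebase A in E.
have {1}-> : G = L *m (invmx L *m G *m invmx U) *m U.
  by rewrite !mulmxA mulmxV ?col_ebase_unit // mul1mx mulmxKV ?row_ebase_unit.
rewrite (perturb_mul _ (esym E)) perturb_pid !det_mulmx det_stair.
set a := \det _; set b := \det _; set c := \det _; exists (a * b * c).
by rewrite (mulrC 'X^_) mulrA mulrAC.
Qed.

(** In the same coordinates the complementary projection makes the perturbed matrix diagonal, and
    its determinant is a nonzero constant times the required power. *)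
Lemma det_perturb_attained A : exists G, (\det (perturb A G))`_(k - \rank A) != 0.
Proof.
have E := mulmx_ebase A; set L := col_ebase A in E; set U := row_ebase A in E.
exists (L *m copid_mx (\rank A) *m U); rewrite (perturb_mul _ (esym E)).
have -> : perturb (pid_mx (\rank A)) (copid_mx (\rank A)) = diag_mx (stair (\rank A)).
  apply/matrixP => i j; rewrite perturbE !mxE.
  have [<-|/negPf ne] := eqVneq i j; rewrite ?eqxx ?ne /=; last first.
    by rewrite -val_eqE /= in ne; rewrite ne subr0 mul0r addr0 mulr0n.
  by case: (i < _)%N; rewrite /= ?subrr ?subr0 ?mul0r ?mul1r ?addr0 ?add0r.
rewrite !det_mulmx det_stair !det_map_mx coefMC coefCM coefXn eqxx mulr1.
by rewrite mulf_neq0 // -unitfE -unitmxE ?col_ebase_unit ?row_ebase_unit.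
Qed.

Lemma det_perturb_lines A G G' e :
  exists p : {poly K}, forall y, (\det (perturb A (G + y *: G')))`_e = p.[y].
Proof.
(* The outer variable is the perturbation parameter, the inner one the parameter [y] of the line. *)
pose Q : 'M[{poly {poly K}}]_k := \matrix_(i, j)
  ((A i j)%:P%:P + ((G i j)%:P + (G' i j)%:P * 'X)%:P * 'X).
exists (\det Q)`_e => y; rewrite -horner_evalE -coef_map -det_map_mx.
congr nth; congr (polyseq (\det _)); apply/matrixP => i j; rewrite perturbE !mxE.
rewrite [RHS]rmorphD [in RHS]rmorphM /= !map_polyC map_polyX /= /horner_eval !hornerE.
by rewrite (mulrC y).
Qed.

End Perturbation.

Lemma generic_perturbation (K : closedFieldType) (I : finType) k m (f : I -> 'I_k -> 'I_m)
    (A : 'M[K]_(k, m)) : (forall i, injective (f i)) ->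
  exists G : 'M[K]_(k, m), forall i,
    exists2 q : {poly K}, q`_0 != 0 &
      \det (colsub (f i) (perturb A G)) = q * 'X^(k - rowrank A^T (f i @: setT)).
Proof.
move=> inj.
have subE i G : colsub (f i) (perturb A G) = perturb (colsub (f i) A) (colsub (f i) G).
  by apply/matrixP => a b; rewrite !mxE.
pose e i := (k - \rank (colsub (f i) A))%N.
have [||G hG] := @generic_point K 'M[K]_(k, m) I (enum I)
    (fun i G => (\det (perturb (colsub (f i) A) (colsub (f i) G)))`_(e i)).
- move=> i u w; have [p hp] := det_perturb_lines (colsub (f i) A) (colsub (f i) u) (colsub (f i) w) (e i).
  exists p => y; rewrite -hp.
  have -> // : colsub (f i) (u + y *: w) = colsub (f i) u + y *: colsub (f i) w.
  by apply/matrixP => a b; rewrite !mxE.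
- move=> i _; have [G hG] := det_perturb_attained (colsub (f i) A).
  (* Injectivity of [f i] allows a square witness to be placed in the selected columns, with zeros
     elsewhere. *)
  exists (\matrix_(a, j) oapp (G a) 0 [pick b | f i b == j]).
  have -> // : colsub (f i) (\matrix_(a, j) oapp (G a) 0 [pick b | f i b == j]) = G.
  apply/matrixP => a b; rewrite !mxE.
  by case: pickP => [c /eqP/inj -> //|/(_ b)]; rewrite eqxx.
exists G => i; have := hG i; rewrite mem_enum => /(_ isT).
have [q E] := det_perturb (colsub (f i) A) (colsub (f i) G).
rewrite subE E coefMXn ltnn subnn => q0; exists q => //.
by rewrite -rank_colsub.
Qed.

From mathcomp Require Import all_classical all_reals all_analysis.
Import Defs.
Import Order.TTheory GRing.Theory Num.Theory.
Import numFieldNormedType.Exports.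
Local Open Scope classical_set_scope.
Local Open Scope ring_scope.

(** * Convex hulls and splits of the hypersimplex *)

Section Hull.
Variables (R : realType) (T : finType) (E : lmodType R) (v : T -> E).
Implicit Types (Q : pred T).

(** The weights live on all of [T] and vanish off [Q], so passing to a face only shrinks the
    predicate and keeps the index type. *)
Definition hull Q : set E := [set x | exists a : T -> R,
  [/\ forall i, 0 <= a i, forall i, a i != 0 -> Q i, \sum_i a i = 1
    & x = \sum_i a i *: v i]].

Lemma conv_hull_reindex (J : finType) (f : J -> T) Q : injective f ->
  (forall i, Q i <-> exists j, f j = i) -> conv_hull (v \o f) = hull Q.
Proof.
move=> injf Qf; apply/seteqP; split=> x [b].
  move=> [b0 b1 ->].
  have sumE (U : lmodType R) (F : T -> U) :
      \sum_i (\sum_(j | f j == i) b j) *: F i = \sum_j b j *: F (f j).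
    under eq_bigr do rewrite scaler_suml.
    rewrite (exchange_big_dep predT) //=; apply: eq_bigr => j _.
    by rewrite (big_pred1 (f j)) // => i; rewrite /= eq_sym.
  exists (fun i => \sum_(j | f j == i) b j); split.
  - by move=> i; apply: sumr_ge0 => j _.
  - move=> i; apply: contra_neqP => nQ; apply: big1 => j /eqP ji.
    by case: nQ; apply/Qf; exists j.
  - have := sumE R^o (fun=> 1); rewrite /GRing.scale /=.
    by under eq_bigr do rewrite mulr1; under [in RHS]eq_bigr do rewrite mulr1; rewrite b1.
  - by rewrite (sumE E).
move=> [a0 aQ a1 ->].
have sumE (U : nmodType) (F : T -> U) : (forall i, F i != 0 -> Q i) ->
    \sum_j F (f j) = \sum_i F i.
  move=> FQ; rewrite [RHS](bigID [pred i | i \in f @: [set: J]%SET]) /= [X in _ = _ + X]big1 ?addr0.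
    by rewrite big_imset /=; [apply: eq_bigl => j; rewrite inE | move=> ? ? _ _; apply: injf].
  move=> i; apply: contraNeq => /FQ /Qf[j <-]; exact/imset_f.
exists (b \o f); split=> //=.
  by rewrite (sumE R b).
rewrite (sumE E (fun i => b i *: v i)) // => i; apply: contra_neqP => nQ.
have -> : b i = 0 by apply: contra_notP nQ => /eqP/aQ.
by rewrite scale0r.
Qed.

Lemma conv_hull_sig Q : conv_hull (fun i : {i | Q i} => v (val i)) = hull Q.
Proof.
apply: (@conv_hull_reindex _ val) => [|i]; first exact: val_inj.
by split=> [Qi|[[j Qj] <-]//]; exists (exist _ i Qi).
Qed.

Lemma hull_gen Q i : Q i -> hull Q (v i).
Proof.
move=> Qi; exists (fun j => (j == i)%:R); split=> [j|j||].
- exact: ler0n.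
- by have [->//|_] := eqVneq j i; rewrite eqxx.
- by rewrite (bigD1 i) //= eqxx big1 ?addr0 // => j /negPf ->.
- by rewrite (bigD1 i) //= eqxx scale1r big1 ?addr0 // => j /negPf ->; rewrite scale0r.
Qed.

Lemma hull_convex Q x y (t : R) : hull Q x -> hull Q y -> 0 <= t <= 1 ->
  hull Q (t *: x + (1 - t) *: y).
Proof.
move=> [a [a0 aQ a1 ->]] [b [b0 bQ b1 ->]] /andP[t0 t1].
exists (fun i => t * a i + (1 - t) * b i); split.
- by move=> i; rewrite addr_ge0 ?mulr_ge0 ?subr_ge0.
- move=> i; apply: contra_neqP => nQ.
  have -> : a i = 0 by apply: contra_notP nQ => /eqP/aQ.
  have -> : b i = 0 by apply: contra_notP nQ => /eqP/bQ.
  by rewrite !mulr0 addr0.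
- by rewrite big_split /= -!mulr_sumr a1 b1 !mulr1 addrC subrK.
- rewrite !scaler_sumr -big_split /=; apply: eq_bigr => i _.
  by rewrite [in RHS]scalerDl -!scalerA.
Qed.

End Hull.

Lemma eq_hull (R : realType) (T : finType) (E : lmodType R) (v : T -> E) (Q Q' : pred T) :
  Q =1 Q' -> hull v Q = hull v Q'.
Proof. by move=> /funext ->. Qed.

Section HullFaces.
Variables (R : realType) (n : nat).
Implicit Types (a x y : 'rV[R]_n) (P F G W : set 'rV[R]_n).

Lemma dotpDl a b x : dotp (a + b) x = dotp a x + dotp b x.
Proof. by rewrite /dotp -big_split; apply: eq_bigr => i _; rewrite !mxE mulrDl. Qed.
Lemma dotpZl c a x : dotp (c *: a) x = c * dotp a x.
Proof. by rewrite /dotp mulr_sumr; apply: eq_bigr => i _; rewrite !mxE mulrA. Qed.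
Lemma dotpDr a x y : dotp a (x + y) = dotp a x + dotp a y.
Proof. by rewrite /dotp -big_split; apply: eq_bigr => i _; rewrite !mxE mulrDr. Qed.
Lemma dotpZr c a x : dotp a (c *: x) = c * dotp a x.
Proof. by rewrite /dotp mulr_sumr; apply: eq_bigr => i _; rewrite !mxE mulrCA. Qed.
Lemma dotp0r a : dotp a 0 = 0.
Proof. by rewrite /dotp big1 // => i _; rewrite mxE mulr0. Qed.
Lemma dotp0l x : dotp 0 x = 0.
Proof. by rewrite /dotp big1 // => i _; rewrite mxE mul0r. Qed.
Lemma dotpNr a x : dotp a (- x) = - dotp a x.
Proof. by rewrite -scaleN1r dotpZr mulN1r. Qed.
Lemma dotpNl a x : dotp (- a) x = - dotp a x.
Proof. by rewrite -scaleN1r dotpZl mulN1r. Qed.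
Lemma dotp_sumr a (I : Type) (r : seq I) (f : I -> 'rV[R]_n) :
  dotp a (\sum_(i <- r) f i) = \sum_(i <- r) dotp a (f i).
Proof. by elim/big_rec2: _ => [|i x y _ <-]; rewrite ?dotp0r ?dotpDr. Qed.

Variables (T : finType) (v : T -> 'rV[R]_n).
Implicit Types (Q : pred T).

Lemma dotp_comb a (b : T -> R) :
  dotp a (\sum_i b i *: v i) = \sum_i b i * dotp a (v i).
Proof. by rewrite dotp_sumr; apply: eq_bigr => i _; rewrite dotpZr. Qed.

Lemma hull_le Q a c : (forall i, Q i -> dotp a (v i) <= c) ->
  forall x, hull v Q x -> dotp a x <= c.
Proof.
move=> h x [b [b0 bQ b1 ->]]; rewrite dotp_comb -[c]mul1r -b1 mulr_suml.
apply: ler_sum => i _; have [->|/bQ/h] := eqVneq (b i) 0; first by rewrite !mul0r.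
exact: ler_wpM2l.
Qed.

Lemma hull_level Q a c : (forall i, Q i -> dotp a (v i) <= c) ->
  [set x | hull v Q x /\ dotp a x = c] = hull v [pred i | Q i && (dotp a (v i) == c)].
Proof.
move=> h; apply/seteqP; split=> [x [[b [b0 bQ b1 ->]]]|x [b [b0 bQ b1 ->]]]; last first.
  split; first by exists b; split=> // i /bQ /andP[].
  rewrite dotp_comb -[c]mul1r -b1 mulr_suml; apply: eq_bigr => i _.
  by have [->|/bQ/andP[_ /eqP->//]] := eqVneq (b i) 0; rewrite !mul0r.
rewrite dotp_comb => E; exists b; split=> // i bi; rewrite /= bQ //=.
have : \sum_i b i * (c - dotp a (v i)) = 0.
  under eq_bigr do rewrite mulrBr.
  by rewrite sumrB -mulr_suml b1 mul1r E subrr.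
move/eqP; rewrite psumr_eq0 => [/allP/(_ i)|j _].
  by rewrite mem_index_enum => /(_ isT); rewrite mulf_eq0 (negPf bi) subr_eq0 eq_sym.
have [->|/bQ/h] := eqVneq (b j) 0; first by rewrite mul0r.
by move=> le; rewrite mulr_ge0 ?subr_ge0.
Qed.

Lemma polytope_hull Q : polytope (hull v Q).
Proof.
exists #|Q|, (v \o @enum_val _ Q); apply/esym/conv_hull_reindex; first exact: enum_val_inj.
move=> i; split=> [Qi|[j <-]]; last exact: (enum_valP j).
by exists (enum_rank_in (Qi : i \in Q) i); rewrite enum_rankK_in.
Qed.

Lemma face_hullP Q F : face (hull v Q) F <-> exists a c,
  (forall i, Q i -> dotp a (v i) <= c) /\ F = hull v [pred i | Q i && (dotp a (v i) == c)].
Proof.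
split=> -[a [c [h ->]]]; exists a, c; split.
- by move=> i /(hull_gen v); apply: h.
- by apply: hull_level => i /(hull_gen v); apply: h.
- exact: hull_le.
- by rewrite hull_level.
Qed.

Lemma face_trans Q F G : face (hull v Q) F -> face F G -> face (hull v Q) G.
Proof.
move=> /face_hullP[a [c [h ->]]] /face_hullP[b [e [h' ->]]]; apply/face_hullP.
(* A large multiple of the functional that cuts out [F] outweighs whatever [b] gains on the finitely
   many generators outside [F]. *)
have [K K0 hK] : exists2 K : R, 0 <= K & forall i, Q i -> dotp a (v i) != c ->
    dotp b (v i) - e < K * (c - dotp a (v i)).
  pose r i := if dotp a (v i) == c then 0 else `|dotp b (v i) - e| / (c - dotp a (v i)).
  have r0 i : Q i -> 0 <= r i.
    by move=> Qi; rewrite /r; case: eqP => // _; rewrite divr_ge0 // subr_ge0 h.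
  exists (1 + \sum_(i | Q i) r i); first by rewrite addr_ge0 ?sumr_ge0.
  move=> i Qi ne; have lt : 0 < c - dotp a (v i) by rewrite subr_gt0 lt_neqAle ne h.
  have : r i < 1 + \sum_(i | Q i) r i.
    rewrite (bigD1 i) //= addrCA ltrDl ltr_pwDl //.
    by apply: sumr_ge0 => j /andP[Qj _]; apply: r0.
  rewrite -(ltr_pM2r lt); apply: le_lt_trans.
  by rewrite /r (negPf ne) divfK ?gt_eqF // ler_norm.
exists (K *: a + b), (K * c + e); split.
  move=> i Qi; rewrite dotpDl dotpZl; have [E|/(hK i Qi)] := eqVneq (dotp a (v i)) c.
    by rewrite E lerD2l h' //= Qi E eqxx.
  by lra.
apply: eq_hull => i /=; rewrite -andbA; case Qi: (Q i) => //=; rewrite dotpDl dotpZl.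
have [->|/(hK i Qi) lt] := eqVneq (dotp a (v i)) c; first by rewrite (inj_eq (addrI _)).
by apply/esym/negbTE/eqP => E; move: lt; lra.
Qed.

End HullFaces.

Lemma faceI (R : realType) n (P F G : set 'rV[R]_n) :
  face P F -> face P G -> face P (F `&` G).
Proof.
move=> [a [c [ha ->]]] [b [e [hb ->]]]; exists (a + b), (c + e); split.
  by move=> x Px; rewrite dotpDl lerD ?ha ?hb.
apply/seteqP; split=> x /=; rewrite dotpDl; first by move=> [[Px ->] [_ ->]].
by move=> [Px E]; have := ha x Px; have := hb x Px; move: E => E h1 h2; do !split=> //; lra.
Qed.

Lemma face_self (R : realType) n (P : set 'rV[R]_n) : face P P.
Proof.
by exists 0, 0; split=> [x _|]; [rewrite dotp0l | apply/seteqP; split=> x; rewrite /= dotp0l // => -[]].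
Qed.

Lemma face_subset (R : realType) n (P F : set 'rV[R]_n) : face P F -> F `<=` P.
Proof. by move=> [a [c [_ ->]]] x []. Qed.

Lemma face_sub (R : realType) n (P W F : set 'rV[R]_n) : face P F -> F `<=` W -> W `<=` P -> face W F.
Proof.
move=> [a [c [h ->]]] FW WP; exists a, c; split=> [x /WP/h //|].
by apply/seteqP; split=> x /= [xP E]; split=> //; [apply: FW | apply: WP].
Qed.

Section Gluing.
Variables (R : realType) (n : nat) (T : finType) (v : T -> 'rV[R]_n) (Q1 Q2 : pred T).
Local Notation P1 := (hull v Q1).
Local Notation P2 := (hull v Q2).
Hypotheses (W1 : face P1 (P1 `&` P2)) (W2 : face P2 (P1 `&` P2)).

Definition glued : set (set 'rV[R]_n) := [set C | face P1 C \/ face P2 C].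

(** A face of one polytope and a face of the other can meet only within the common face. There both
    traces are faces of it, hence so is their intersection, and being a face is transitive. *)
Lemma glued_subdivision : subdivision (P1 `|` P2) glued.
Proof.
have WQ : exists Q, P1 `&` P2 = hull v Q.
  by case/face_hullP: W1 => a [c [_ ->]]; eexists.
have faceWI C D : face P1 C -> face P2 D -> face P1 (C `&` D) /\ face P2 (C `&` D).
  move=> fC fD; have -> : C `&` D = (C `&` (P1 `&` P2)) `&` (D `&` (P1 `&` P2)).
    apply/seteqP; split=> x; last by move=> [[? _] [? _]].
    by move=> [Cx Dx]; do !split => //; by [apply: face_subset fC _ _ | apply: face_subset fD _ _].
  have f1 : face (P1 `&` P2) (C `&` (P1 `&` P2)).
    by apply: face_sub (faceI fC W1) _ _ => x [].
  have f2 : face (P1 `&` P2) (D `&` (P1 `&` P2)).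
    by apply: face_sub (faceI fD W2) _ _ => x [].
  by split; [apply: face_trans W1 _ | apply: face_trans W2 _]; apply: faceI.
split.
- have fin Q : finite_set [set C | face (hull v Q) C].
    apply: (@sub_finite_set _ _ ((fun A : {set T} => hull v (mem A)) @` [set: {set T}])).
      move=> C /face_hullP[a [c [_ ->]]]; exists [set i | Q i && (dotp a (v i) == c)]%SET => //.
      by apply: eq_hull => i /=; rewrite inE.
    by apply: finite_image; apply: finite_finset.
  rewrite (_ : glued = [set C | face P1 C] `|` [set C | face P2 C]) //.
  by rewrite finite_setU.
- by move=> C [] /face_hullP[a [c [_ ->]]]; apply: polytope_hull.
- by move=> C F [] fC fF; [left|right]; apply: face_trans fC fF.
- have aux C D : face P1 C -> face P2 D -> face C (C `&` D) /\ face D (C `&` D).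
    move=> fC fD; have [f1 f2] := faceWI C D fC fD.
    by split; [apply: face_sub f1 _ (face_subset fC) | apply: face_sub f2 _ (face_subset fD)] => x [].
  have aux' Q C D : face (hull v Q) C -> face (hull v Q) D -> face C (C `&` D) /\ face D (C `&` D).
    by move=> fC fD; split; [apply: face_sub (faceI fC fD) _ (face_subset fC) | apply: face_sub (faceI fC fD) _ (face_subset fD)] => x [].
  move=> C D [fC|fC] [fD|fD]; [exact: (aux' Q1) | exact: aux | | exact: (aux' Q2)].
  by rewrite setIC; have [] := aux D C fD fC.
apply/seteqP; split=> [x [C [fC|fC] Cx]|x [Px|Px]].
- by left; apply: face_subset fC _ Cx.
- by right; apply: face_subset fC _ Cx.
- by exists P1 => //; left; apply: face_self.
- by exists P2 => //; right; apply: face_self.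
Qed.

Lemma glued_maximal E : ~ (P1 `<=` P2) -> ~ (P2 `<=` P1) ->
  maximal_cell glued E <-> E = P1 \/ E = P2.
Proof.
move=> n12 n21; have g1 : glued P1 by left; apply: face_self.
have g2 : glued P2 by right; apply: face_self.
split=> [[[fE|fE] mE]|[->|->]]; [left|right|split=> //|split=> //].
- by apply/esym/mE => //; apply: face_subset.
- by apply/esym/mE => //; apply: face_subset.
- move=> D [fD|fD] s; first by apply/seteqP; split=> //; apply: face_subset.
  by case: n12; apply: subset_trans s (face_subset fD).
- move=> D [fD|fD] s; last by apply/seteqP; split=> //; apply: face_subset.
  by case: n21; apply: subset_trans s (face_subset fD).
Qed.

Lemma hull_vertex Q x : vertex (hull v Q) x -> exists2 i, Q i & x = v i.
Proof.
move=> /face_hullP[a [c [h E]]].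
have : hull v [pred i | Q i && (dotp a (v i) == c)] x by rewrite -E.
move=> [b [b0 bQ b1 _]].
have [i bi] : exists i, b i != 0.
  apply: contrapT => /forallNP h0; move: b1; rewrite big1 => [/esym/eqP|i _].
    by rewrite oner_eq0.
  by apply/eqP/negPn/negP/h0.
have Qi := bQ i bi; exists i; first by case/andP: Qi.
by have := hull_gen v Qi; rewrite -E => /= ->.
Qed.

Lemma glued_vertices P : (forall i, Q1 i || Q2 i -> vertex P (v i)) ->
  no_new_vertices P glued.
Proof.
move=> h C x [fC|fC] vx.
  by have [i Qi ->] := hull_vertex (face_trans fC vx); apply: h; rewrite Qi.
by have [i Qi ->] := hull_vertex (face_trans fC vx); apply: h; rewrite Qi orbT.
Qed.

End Gluing.

(** * Integrality of slabs of the hypersimplex *)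

Section Slab.
Variables (R : realType) (n d : nat).
Implicit Types (x y : 'rV[R]_n) (F B : {set 'I_n}).

Lemma dotp_indic F x : dotp (indic R F) x = \sum_(i in F) x 0 i.
Proof.
rewrite /dotp [RHS]big_mkcond; apply: eq_bigr => i _; rewrite mxE.
by case: (i \in F); rewrite ?mul1r ?mul0r.
Qed.

Lemma dotp_indic2 F B : dotp (indic R F) (indic R B) = #|B :&: F|%:R.
Proof.
rewrite dotp_indic (eq_bigr (fun i => if i \in B then 1 else 0)) => [|i _].
  by rewrite -big_mkcondr sumr_const; congr (_ *+ _); apply: eq_card => i; rewrite !inE andbC.
by rewrite mxE; case: ifP.
Qed.

Lemma sum_indic B : \sum_i indic R B 0 i = #|B|%:R.
Proof. by have := dotp_indic2 [set: 'I_n]%SET B; rewrite dotp_indic finset.setIT => <-; apply: eq_bigl => i; rewrite inE. Qed.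

Lemma indic_ge0 B i : 0 <= indic R B 0 i <= 1.
Proof. by rewrite mxE ler0n lern1 leq_b1. Qed.

Lemma indic_hypersimplex B : #|B| = d -> @hypersimplex R d n (indic R B).
Proof. by move=> cB; split; [apply: indic_ge0 | rewrite sum_indic cB]. Qed.

Definition slab_set F (lo hi : nat) : pred {set 'I_n} :=
  fun B => [&& #|B| == d, lo <= #|B :&: F| & #|B :&: F| <= hi]%N.

Definition fractional x : {set 'I_n} := [set i | (0 < x 0 i) && (x 0 i < 1)]%SET.

Definition shift_size x (i j : 'I_n) : R := Num.min (1 - x 0 i) (x 0 j).
Definition shift x (i j : 'I_n) : 'rV[R]_n :=
  \row_l (x 0 l + shift_size x i j * ((l == i)%:R - (l == j)%:R)).

Lemma sum_delta F (i : 'I_n) : \sum_(l in F) (l == i)%:R = (i \in F)%:R :> R.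
Proof.
case: (boolP (i \in F)) => iF.
  by rewrite (bigD1 i) //= eqxx big1 ?addr0 // => j /andP[_ /negPf ->].
by rewrite big1 // => j jF; case: eqP => // ji; rewrite ji (negPf iF) in jF.
Qed.

Lemma shift_sum F x i j :
  \sum_(l in F) shift x i j 0 l =
    \sum_(l in F) x 0 l + shift_size x i j * ((i \in F)%:R - (j \in F)%:R).
Proof.
under eq_bigr do rewrite mxE; rewrite big_split -mulr_sumr sumrB /=.
by rewrite !sum_delta.
Qed.

Section Shift.
Variables (x : 'rV[R]_n) (i j : 'I_n).
Hypotheses (cube : forall l, 0 <= x 0 l <= 1) (ij : i != j).
Hypotheses (fi : i \in fractional x) (fj : j \in fractional x).

Lemma shift_size_gt0 : 0 < shift_size x i j.
Proof. by move: fi fj; rewrite !inE lt_min subr_gt0 => /andP[_ ->] /andP[->]. Qed.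

Lemma shift_size_le : shift_size x i j <= 1 - x 0 i /\ shift_size x i j <= x 0 j.
Proof. by rewrite /shift_size !ge_min !lexx orbT. Qed.

Lemma shift_i : shift x i j 0 i = x 0 i + shift_size x i j.
Proof. by rewrite mxE eqxx (negPf ij) subr0 mulr1. Qed.
Lemma shift_j : shift x i j 0 j = x 0 j - shift_size x i j.
Proof. by rewrite mxE eqxx eq_sym (negPf ij) sub0r mulrN1. Qed.
Lemma shift_other l : l != i -> l != j -> shift x i j 0 l = x 0 l.
Proof. by move=> /negPf li /negPf lj; rewrite mxE li lj subrr mulr0 addr0. Qed.

Lemma shift_cube l : 0 <= shift x i j 0 l <= 1.
Proof.
have [h1 h2] := shift_size_le; have h0 := shift_size_gt0.
have /andP[xi0 xi1] := cube i; have /andP[xj0 xj1] := cube j.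
have [->|li] := eqVneq l i; first by rewrite shift_i; apply/andP; split; lra.
have [->|lj] := eqVneq l j; first by rewrite shift_j; apply/andP; split; lra.
by rewrite shift_other.
Qed.

Lemma shift_fractional : (#|fractional (shift x i j)| < #|fractional x|)%N.
Proof.
apply/proper_card/properP; split.
  apply/fintype.subsetP => l; rewrite inE.
  have [->|li] := eqVneq l i; first by rewrite fi.
  have [->|lj] := eqVneq l j; first by rewrite fj.
  by rewrite shift_other // inE.
have [le|lt] := leP (1 - x 0 i) (x 0 j).
  exists i => //; rewrite inE shift_i /shift_size min_l //.
  by rewrite addrC subrK ltxx andbF.
exists j => //; rewrite inE shift_j /shift_size min_r ?ltW //.
by rewrite subrr ltxx.
Qed.

End Shift.

(** Induction on the number of fractional coordinates. Shifting weight between two of them, as far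
    as possible in either direction, makes one integral, and the point lies between the two results.
    If no two are on the same side of [F], there is exactly one on each side. *)
Lemma slab_hull F (lo hi : nat) x : @hypersimplex R d n x ->
  lo%:R <= \sum_(i in F) x 0 i <= hi%:R -> hull (@indic R n) (slab_set F lo hi) x.
Proof.
have [k] := ubnP #|fractional x|; elim: k => // k IH in x *.
move=> lek [cube sumx] bnd.
have step i j : i \in fractional x -> j \in fractional x -> i != j ->
    lo%:R <= \sum_(l in F) shift x i j 0 l <= hi%:R ->
    lo%:R <= \sum_(l in F) shift x j i 0 l <= hi%:R ->
    hull (@indic R n) (slab_set F lo hi) x.
  move=> fi fj ij b1 b2; have ji : j != i by rewrite eq_sym.
  have H u w : u \in fractional x -> w \in fractional x -> u != w ->
      lo%:R <= \sum_(l in F) shift x u w 0 l <= hi%:R ->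
      hull (@indic R n) (slab_set F lo hi) (shift x u w).
    move=> fu fw uw b; apply: IH => //.
      by apply: leq_trans (shift_fractional uw fu fw) _; rewrite -ltnS.
    split; first by move=> l; apply: shift_cube.
    have := shift_sum [set: 'I_n]%SET x u w; rewrite !inE subrr mulr0 addr0.
    by under eq_bigl do rewrite inE; under [in RHS]eq_bigl do rewrite inE; rewrite sumx.
  pose s := shift_size x i j; pose s' := shift_size x j i.
  have s0 : 0 < s := shift_size_gt0 fi fj; have s'0 : 0 < s' := shift_size_gt0 fj fi.
  have ss : s + s' != 0 by rewrite gt_eqF ?addr_gt0.
  have -> : x = (s' / (s + s')) *: shift x i j + (1 - s' / (s + s')) *: shift x j i.
    apply/rowP => l; rewrite !mxE -/s -/s'; move: (l == i)%:R (l == j)%:R => p q.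
    by field.
  apply: hull_convex; [exact: H|exact: H|].
  have sp : 0 < s + s' by rewrite addr_gt0.
  by rewrite divr_ge0 ?(ltW s'0) ?(ltW sp) //= ler_pdivrMr // mul1r lerDr ltW.
have same i j : i \in fractional x -> j \in fractional x -> i != j -> (i \in F) = (j \in F) ->
    hull (@indic R n) (slab_set F lo hi) x.
  by move=> fi fj ij E; apply: (step i j) => //; rewrite shift_sum E subrr mulr0 addr0.
have integral (A : {set 'I_n}) : (forall l, l \in A -> l \notin fractional x) ->
    exists m : nat, \sum_(l in A) x 0 l = m%:R.
  move=> h; exists (\sum_(l in A) nat_of_bool (x 0%R l == 1%R))%N; rewrite natr_sum; apply: eq_bigr => l /h.
  have /andP[l0 l1] := cube l; rewrite inE negb_and -!leNgt => /orP[le|le].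
    have -> : x 0 l = 0 by apply/eqP; rewrite eq_le le l0.
    by rewrite eq_sym oner_eq0.
  have -> : x 0 l = 1 by apply/eqP; rewrite eq_le le l1.
  by rewrite eqxx.
have notint i (m p : nat) : i \in fractional x -> x 0 i + m%:R = p%:R -> False.
  rewrite inE => /andP[i0 i1] E; have : (m < p)%N by rewrite -(ltr_nat R) -E; lra.
  by rewrite -(ler_nat R) -E -natr1; lra.
have [/eqP fr0|[i0 fi0]] := finset.set_0Vmem (fractional x).
  pose B := [set i | x 0 i == 1]%SET; have xE : x = indic R B.
    apply/rowP => l; rewrite mxE inE; have /andP[l0 l1] := cube l.
    have : l \notin fractional x by rewrite (eqP fr0) inE.
    rewrite inE negb_and -!leNgt => /orP[le|le].
      have -> : x 0 l = 0 by apply/eqP; rewrite eq_le le l0.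
      by rewrite eq_sym oner_eq0.
    have -> : x 0 l = 1 by apply/eqP; rewrite eq_le le l1.
    by rewrite eqxx.
  move: sumx bnd; rewrite xE; move: B {xE} => B; rewrite sum_indic -dotp_indic dotp_indic2 !ler_nat.
  by move=> /eqP; rewrite eqr_nat => cB /andP[h1 h2]; apply: hull_gen; rewrite /slab_set cB h1.
have [/existsP[i /existsP[j /and4P[fi fj ij /eqP E]]]|] := boolP [exists i, [exists j,
    [&& i \in fractional x, j \in fractional x, i != j & (i \in F) == (j \in F)]]].
  exact: same fi fj ij E.
move=> /existsPn uniq'; have {uniq'} uniq i j : i \in fractional x -> j \in fractional x ->
    (i \in F) = (j \in F) -> i = j.
  move=> fi fj E; apply/eqP; apply: contraT => ij.
  by have /existsPn/(_ j) := uniq' i; rewrite fi fj ij E eqxx.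
have alone : exists2 j, j \in fractional x & (j \in F) != (i0 \in F).
  have [/exists_inP//|h] := boolP [exists j in fractional x, (j \in F) != (i0 \in F)].
  have [|m E] := integral [set~ i0]%SET.
    move=> l; rewrite !inE => li; apply/negP => fl; case/negP: h.
    apply/exists_inP; exists l; first by rewrite inE.
    by apply: contraNN li => /eqP E; rewrite (uniq l i0) ?eqxx // inE.
  case: (notint i0 m d fi0); rewrite -sumx (bigD1 i0) //= -E; congr (_ + _).
  by apply: eq_bigl => l; rewrite !inE.
have [i [j [fi fj iF jF]]] : exists i j,
    [/\ i \in fractional x, j \in fractional x, i \in F & j \notin F].
  have [j fj ne] := alone; case: (boolP (i0 \in F)) => i0F.
    by exists i0, j; split=> //; move: ne; rewrite i0F eqb_id.
  by exists j, i0; split=> //; move: ne; rewrite (negPf i0F) eqbF_neg negbK.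
have ij : i != j by apply: contraNneq jF => <-.
have [|m E] := integral (F :\ i)%SET.
  move=> l; rewrite !inE => /andP[li lF]; apply/negP => fl.
  by move: li; rewrite (uniq l i) ?eqxx // ?lF ?iF // inE.
have sF : \sum_(l in F) x 0 l = x 0 i + m%:R by rewrite (big_setD1 i) //= E.
(* The sum over [F] is an integer [m] plus a fractional coordinate, so the integer bounds give
   [lo <= m] and [m + 1 <= hi]. A shift keeps the sum between [m] and [m + 1]. *)
move: (fi) bnd; rewrite sF inE => /andP[xi0 xi1] /andP[blo bhi].
have mhi : (m < hi)%N by rewrite -(ltr_nat R); lra.
have mlo : (lo <= m)%N by rewrite -ltnS -(ltr_nat R) -natr1; lra.
move: mhi mlo; rewrite -(ler_nat R) -(ler_nat R lo) -natr1 => mhi mlo.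
have [h1 h2] := shift_size_le x i j; have [h3 h4] := shift_size_le x j i.
have h5 := shift_size_gt0 fi fj; have h6 := shift_size_gt0 fj fi.
by apply: (step i j) => //; rewrite shift_sum sF iF (negPf jF) /=; apply/andP; split; lra.
Qed.

Lemma hull_slab F (lo hi : nat) x : hull (@indic R n) (slab_set F lo hi) x ->
  @hypersimplex R d n x /\ lo%:R <= \sum_(i in F) x 0 i <= hi%:R.
Proof.
move=> hx; have bound a c : (forall B, slab_set F lo hi B -> dotp a (indic R B) <= c) -> dotp a x <= c.
  by move=> h; apply: hull_le hx.
have boundN a c : (forall B, slab_set F lo hi B -> c <= dotp a (indic R B)) -> c <= dotp a x.
  by move=> h; rewrite -lerN2 -dotpNl; apply: bound => B /h; rewrite dotpNl lerN2.
have sum1 (i : 'I_n) y : dotp (indic R [set i]%SET) y = y 0 i by rewrite dotp_indic big_set1.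
have sumT y : dotp (indic R [set: 'I_n]%SET) y = \sum_i y 0 i.
  by rewrite dotp_indic; apply: eq_bigl => i; rewrite inE.
split; [split=> [i|]|].
- by rewrite -!sum1; apply/andP; split; [apply: boundN | apply: bound] => B _; rewrite sum1; have /andP[] := indic_ge0 B i.
- rewrite -sumT; apply/eqP; rewrite eq_le; apply/andP.
  by split; [apply: bound | apply: boundN] => B /and3P[/eqP cB _ _]; rewrite sumT sum_indic cB.
rewrite -dotp_indic; apply/andP.
by split; [apply: boundN | apply: bound] => B /and3P[_ h1 h2]; rewrite dotp_indic2 ler_nat.
Qed.

Lemma indic_vertex B : #|B| = d -> vertex (@hypersimplex R d n) (indic R B).
Proof.
move=> cB; have le (x : 'rV[R]_n) : @hypersimplex R d n x -> \sum_(i in B) x 0 i <= d%:R.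
  move=> [cube _]; rewrite -cB -sumr_const; apply: ler_sum => i _.
  by have /andP[] := cube i.
exists (indic R B), d%:R; split; first by move=> x /le; rewrite dotp_indic.
apply/seteqP; split=> [x ->|x [[cube sumx]]].
  by split; [apply: indic_hypersimplex | rewrite dotp_indic2 finset.setIid cB].
rewrite dotp_indic => E; apply/rowP => i; rewrite mxE.
have sB : \sum_(i in B) (1 - x 0 i) = 0.
  by rewrite sumrB E -cB sumr_const subrr.
have sC : \sum_(i | i \notin B) x 0 i = 0.
  by move: sumx; rewrite (bigID (mem B)) /= E => /(canRL (addKr _)); rewrite addNr.
case: (boolP (i \in B)) => iB.
  move/eqP: sB; rewrite psumr_eq0 => [/allP/(_ i)|j _]; last by rewrite subr_ge0; have /andP[] := cube j.
  by rewrite mem_index_enum iB subr_eq0 eq_sym => /(_ isT)/eqP.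
move/eqP: sC; rewrite psumr_eq0 => [/allP/(_ i)|j _]; last by have /andP[] := cube j.
by rewrite mem_index_enum iB => /(_ isT)/eqP.
Qed.

Lemma hypersimplex_relint x : (forall i, 0 < x 0 i < 1) -> \sum_i x 0 i = d%:R ->
  relint (@hypersimplex R d n) x.
Proof.
move=> int sumx; split; first by split=> // i; have /andP[/ltW -> /ltW ->] := int i.
have near_i : \forall y \near x, forall i : 'I_n, 0 < (y : 'rV[R]_n) 0 i < 1.
  apply: (@filter_forall _ _ (fun i => [set y : 'rV[R]_n | 0 < y 0 i < 1]) (nbhs x)) => i; have /andP[x0 x1] := int i.
  have : \forall t \near x 0 i, 0 < t < 1.
    near=> t; apply/andP; split; near: t; [exact: lt_nbhsr | exact: lt_nbhsl].
  exact: (@coord_continuous _ 1 n 0 i x).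
apply: filterS near_i => y int_y [k [a [v [vP a1 yE]]]]; split.
  by move=> i; have /andP[/ltW -> /ltW ->] := int_y i.
have sumT (z : 'rV[R]_n) : \sum_i z 0 i = dotp (indic R [set: 'I_n]%SET) z.
  by rewrite dotp_indic; apply: eq_bigl => i; rewrite inE.
rewrite yE sumT dotp_comb (eq_bigr (fun i => a i * d%:R)) -?mulr_suml ?a1 ?mul1r // => i _.
by rewrite -sumT; have [_ ->] := vP i.
Unshelve. all: by end_near. Qed.

End Slab.

Lemma dim_add_line (K : fieldType) (V : vectType K) (U : {vspace V}) v :
  v \notin U -> \dim (U + <[v]>)%VS = (\dim U).+1.
Proof.
move=> vU; rewrite dimv_disjoint_sum ?dim_vline; last first.
  apply/eqP; rewrite -subv0; apply/subvP => w; rewrite memv_cap memv0 => /andP[wU /vlineP[c E]].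
  move: wU; rewrite E; have [->|c0] := eqVneq c 0; first by rewrite scale0r.
  by rewrite rpredZeq (negPf c0) (negPf vU).
by have [E|] := eqVneq v 0; [rewrite E mem0v in vU | rewrite addn1].
Qed.

(** * Split sets are split flacets *)

Section SplitFlacet.
Variables (R : realType) (n : nat) (M : matroid n).
Hypotheses (conM : mconnected M) (n_ge2 : (2 <= n)%N).
Implicit Types (F G B : {set 'I_n}).
Local Notation d := (mrank M).
Local Notation polyM := (@matroid_polytope R n M).
Local Notation flatM := (@flat_face R n M).
Local Notation e i := (delta_mx 0 i : 'rV[R]_n).

Lemma matroid_polytope_hull (N : matroid n) :
  @matroid_polytope R n N = hull (@indic R n) (mem (bases N)).
Proof. exact: (conv_hull_sig (@indic R n) (mem (bases N))). Qed.

Lemma base_card_le (N : matroid n) F B : B \in bases N ->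
  dotp (indic R F) (indic R B) <= (rk N F)%:R.
Proof. by move=> Bb; rewrite dotp_indic2 ler_nat rk_ge. Qed.

Lemma flat_face_hull F : flatM F = hull (@indic R n) (face_base M F).
Proof.
rewrite /flat_face matroid_polytope_hull.
under eq_set do rewrite -dotp_indic.
rewrite hull_level; last by move=> B; apply: base_card_le.
by apply: eq_hull => B; rewrite /= dotp_indic2 eqr_nat.
Qed.

Lemma flat_face_face F : face polyM (flatM F).
Proof.
exists (indic R F), (rk M F)%:R; split.
  by rewrite matroid_polytope_hull; apply: hull_le => B; apply: base_card_le.
by apply/seteqP; split=> x /=; rewrite dotp_indic.
Qed.

Lemma exch_indic B x y : x \in B -> y \notin B ->
  indic R (y |: B :\ x)%SET - indic R B = e y - e x.
Proof.
move=> xB yB; apply/rowP => i; rewrite !mxE !inE !eqxx /=.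
have yx : (y == x) = false by apply: contraNF yB => /eqP ->.
have [->|iy] := eqVneq i y; first by rewrite (negPf yB) yx.
have [->|ix] := eqVneq i x; first by rewrite xB /=; lra.
by rewrite /=; lra.
Qed.

(** For a split set this is the direction space of its facet, whose matroid has the two components
    [F] and [~: F]. *)
Definition side_span F : {vspace 'rV[R]_n} :=
  <<[seq e p.1 - e p.2 | p <- enum [pred p : 'I_n * 'I_n | (p.1 \in F) == (p.2 \in F)]]>>%VS.

Lemma mem_side_span F i j : (i \in F) = (j \in F) -> e i - e j \in side_span F.
Proof. by move=> E; apply/memv_span/mapP; exists (i, j); rewrite ?mem_enum ?inE /= ?E. Qed.

Lemma side_span_sub F (W : {vspace 'rV[R]_n}) :
  (forall i j, (i \in F) = (j \in F) -> e i - e j \in W) -> (side_span F <= W)%VS.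
Proof.
by move=> h; apply/span_subvP => v /mapP[[i j]]; rewrite mem_enum inE => /eqP/h + ->.
Qed.

Lemma side_span_dotp F v : v \in side_span F -> dotp (indic R F) v = 0.
Proof.
move=> /(@coord_span _ _ _ (in_tuple _)) ->; rewrite dotp_sumr big1 // => k _; rewrite dotpZr.
have /mapP[[i j]] := mem_nth 0 (ltn_ord k); rewrite mem_enum inE /= => /eqP E ->.
by rewrite dotpDr dotpNr !dotp_indic !(eq_bigr _ (fun l _ => mxE _ _ _ _)) /= !sum_delta E subrr mulr0.
Qed.

Lemma sum_zero_side_span F i0 j0 (v : 'rV[R]_n) : i0 \in F -> j0 \notin F ->
  \sum_(i in F) v 0 i = 0 -> \sum_i v 0 i = 0 -> v \in side_span F.
Proof.
move=> iF jF sF sT; pose rep i := if i \in F then i0 else j0.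
have sC : \sum_(i | i \notin F) v 0 i = 0.
  by move: sT; rewrite (bigID (mem F)) /= sF add0r.
have -> : v = \sum_i v 0 i *: (e i - e (rep i)).
  under eq_bigr do rewrite scalerBr; rewrite sumrB -row_sum_delta.
  rewrite [X in _ - X](bigID (mem F)) /=.
  rewrite (eq_bigr (fun i => v 0 i *: e i0)) => [|i iF']; last by rewrite /rep iF'.
  rewrite [X in _ - (_ + X)](eq_bigr (fun i => v 0 i *: e j0)) => [|i iF']; last by rewrite /rep (negPf iF').
  by rewrite -!scaler_suml sF sC !scale0r addr0 subr0.
apply: memv_suml => i _; apply/memvZ/mem_side_span.
by rewrite /rep; case: ifP => iF'; rewrite ?iF ?(negPf jF).
Qed.

Lemma split_set_elts F : split_set M F -> exists i j, i \in F /\ j \notin F.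
Proof.
move=> sF; have /finset.set0Pn[i iF] := split_set_neq0 sF.
have := split_set_neqT sF; rewrite -finset.subTset => /subsetPn[j _ jF].
by exists i, j.
Qed.

Section Directions.
Variables (F : {set 'I_n}) (W : {vspace 'rV[R]_n}).
Hypothesis hW : forall B B', face_base M F B -> face_base M F B' ->
  indic R B - indic R B' \in W.

(** An exchange of [x] for [y] inside the face contributes the direction [e y - e x], so membership
    passes from [x] to [y]. *)
Lemma exchange_closed_direction (Y : {set 'I_n}) i0 : Y = F \/ Y = (~: F)%SET ->
  exchange_closed M F [set j in Y | e j - e i0 \in W]%SET.
Proof.
move=> hY B x y fB xB yB fy; rewrite !inE => /andP[xY xW].
have := hW fy fB; rewrite exch_indic // => yx; apply/andP; split; last first.
  by rewrite -(subrKA (e x)) addrC memvD // addrC.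
have side := face_exchange_side fB xB yB fy.
by case: hY xY => ->; rewrite ?inE side.
Qed.

Lemma restriction_direction i j : restriction_connected M F -> i \in F -> j \in F -> e i - e j \in W.
Proof.
move=> conF iF jF; pose X := [set l in F | e l - e j \in W]%SET.
have XF : X = F.
  apply: (exchange_closed_restriction conF).
  - by apply/fintype.subsetP=> l; rewrite inE => /andP[].
  - by apply/finset.set0Pn; exists j; rewrite inE jF subrr mem0v.
  exact: exchange_closed_direction (or_introl erefl).
by move: iF; rewrite -XF inE => /andP[].
Qed.

Lemma contraction_direction i j : contraction_connected M F -> i \notin F -> j \notin F -> e i - e j \in W.
Proof.
move=> conF; rewrite -![_ \notin F]finset.in_setC => iF jF; pose X := [set l in ~: F | e l - e j \in W]%SET.
have XF : X = (~: F)%SET.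
  apply: (exchange_closed_contraction conF).
  - by apply/fintype.subsetP=> l; rewrite inE => /andP[].
  - by apply/finset.set0Pn; exists j; rewrite inE jF subrr mem0v.
  exact: exchange_closed_direction (or_intror erefl).
by move: iF; rewrite -XF inE => /andP[].
Qed.

End Directions.

Lemma polytope_sum x : polyM x -> \sum_i x 0 i = d%:R.
Proof.
have sumT (y : 'rV[R]_n) : \sum_i y 0 i = dotp (indic R [set: 'I_n]%SET) y.
  by rewrite dotp_indic; apply: eq_bigl => i; rewrite inE.
rewrite matroid_polytope_hull => hx; rewrite sumT; apply/eqP; rewrite eq_le; apply/andP; split.
  by apply: (hull_le _ hx) => B Bb; rewrite -sumT sum_indic (mrank_card Bb).
rewrite -lerN2 -dotpNl; apply: (hull_le _ hx) => B Bb.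
by rewrite dotpNl lerN2 -sumT sum_indic (mrank_card Bb).
Qed.

Lemma indic_flat_face F B : face_base M F B -> flatM F (indic R B).
Proof. by move=> fB; rewrite flat_face_hull; apply: hull_gen. Qed.

Lemma indic_polytope B : B \in bases M -> polyM (indic R B).
Proof. by move=> Bb; rewrite matroid_polytope_hull; apply: hull_gen. Qed.

Lemma split_set_facet F : split_set M F -> facet polyM (flatM F).
Proof.
move=> sF; split; first exact: flat_face_face.
have [i0 [j0 [i0F j0F]]] := split_set_elts sF.
have /and3P[/and4P[_ _ resF conF] _ _] := sF.
have [B0 fB0] := face_base_exists M F.
have diff x y G : \sum_(i in G) (x - y : 'rV[R]_n) 0 i = \sum_(i in G) x 0 i - \sum_(i in G) y 0 i.
  by rewrite -sumrB; apply: eq_bigr => i _; rewrite !mxE.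
have diffT x y : \sum_i (x - y : 'rV[R]_n) 0 i = \sum_i x 0 i - \sum_i y 0 i.
  by rewrite -sumrB; apply: eq_bigr => i _; rewrite !mxE.
have faceW (W : {vspace 'rV[R]_n}) :
    (forall x y, flatM F x -> flatM F y -> x - y \in W) -> (side_span F <= W)%VS.
  move=> hW; have hW' B B' : face_base M F B -> face_base M F B' -> indic R B - indic R B' \in W.
    by move=> fB fB'; apply: hW; apply: indic_flat_face.
  apply: side_span_sub => i j; case: (boolP (i \in F)) => iF /esym jF.
    exact: restriction_direction hW' _ _ resF iF jF.
  by apply: contraction_direction hW' _ _ conF iF _; rewrite jF.
exists (\dim (side_span F)); split; last first.
  split; first by exists (indic R B0); apply: indic_flat_face.
  exists (side_span F) => //; split=> [_ [x [Px xF]] [y [Py yF]] <-|W hW].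
    apply: (sum_zero_side_span i0F j0F); first by rewrite diff xF yF subrr.
    by rewrite diffT !polytope_sum // subrr.
  by apply: faceW => x y hx hy; apply: hW; exists x => //; exists y.
split; first by exists (indic R B0); apply: indic_polytope; case/andP: fB0.
(* The polytope has one more direction than the face, namely one that changes the sum over [F]. *)
exists (side_span F + <[e i0 - e j0]>)%VS; last first.
  apply: dim_add_line; apply/negP => /side_span_dotp; rewrite dotpDr dotpNr !dotp_indic.
  rewrite !(eq_bigr _ (fun l _ => mxE _ _ _ _)) /= !sum_delta i0F (negPf j0F) subr0 => /eqP.
  by rewrite oner_eq0.
split=> [_ [x Px] [y Py] <-|W hW].
  set v := x - y; pose c := \sum_(i in F) v 0 i.
  rewrite -(subrK (c *: (e i0 - e j0)) v) memv_add ?memvZ ?memv_line //.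
  apply: (sum_zero_side_span i0F j0F).
    rewrite diff -/c; under [X in _ - X]eq_bigr do rewrite !mxE !eqxx /=.
    by rewrite -mulr_sumr sumrB !sum_delta i0F (negPf j0F) subr0 mulr1 subrr.
  have sv : \sum_i v 0 i = 0 by rewrite /v diffT !polytope_sum // subrr.
  rewrite diffT sv sub0r; apply/eqP; rewrite oppr_eq0; apply/eqP.
  under eq_bigr do rewrite !mxE !eqxx /=.
  rewrite -mulr_sumr sumrB; have h i : \sum_l (l == i)%:R = 1 :> R.
    by rewrite (bigD1 i) //= eqxx big1 ?addr0 // => l /negPf ->.
  by rewrite !h subrr mulr0.
rewrite subv_add -memvE; apply/andP; split.
  by apply: faceW => x y [Px _] [Py _]; apply: hW; exists x => //; exists y.
(* The whole polytope is the face of the ground set, so connectedness of [M] supplies the direction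
   across [F]. *)
apply: (@restriction_direction [set: 'I_n]%SET); rewrite ?inE //; last exact/mconnectedP.
move=> B B' /andP[Bb _] /andP[Bb' _]; apply: hW.
by exists (indic R B); [exact: indic_polytope | exists (indic R B') => //; exact: indic_polytope].
Qed.

(** If both faces agree, the indicator of [G] has constant sum on the face of [F], hence is constant
    on [F], so [G] is empty. Then the face is the whole polytope, and a basis that is optimal for
    [~: F] makes [F] a separator. *)
Lemma split_set_minimal F G : split_set M F -> G \proper F -> flatM G <> flatM F.
Proof.
move=> sF GF E; have /and3P[/and4P[F0 FT resF _] _ _] := sF.
have GB B : face_base M F B -> #|B :&: G| = rk M G.
  move=> /indic_flat_face; rewrite -E => -[_]; rewrite -dotp_indic dotp_indic2 => /eqP.
  by rewrite eqr_nat => /eqP.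
have [x hx] : exists x : R, forall i, i \in F -> (i \in G)%:R = x.
  apply: (const_restriction (c := (rk M G)%:R) resF) => B /GB <-.
  rewrite -[RHS](dotp_indic2 R G B) dotp_indic big_mkcond [RHS]big_mkcond /=.
  by apply: eq_bigr => i _; rewrite mxE; do 2 case: ifP.
have [j jF jG] : exists2 j, j \in F & j \notin G by case/fintype.properP: GF.
have G0 : G = finset.set0.
  apply/finset.setP => i; rewrite inE; apply/negbTE/negP => iG.
  have iF : i \in F by apply: (fintype.subsetP (fintype.proper_sub GF)).
  have := hx i iF; rewrite -(hx j jF) iG (negPf jG) => /eqP.
  by rewrite oner_eq0.
have [B Bb rB] := rk_attained M (~: F)%SET.
have : flatM F (indic R B).
  rewrite -E; split; first exact: indic_polytope.
  by rewrite G0 big_set0 rk0.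
move=> [_]; rewrite -dotp_indic dotp_indic2 => /eqP; rewrite eqr_nat => /eqP rBF.
have := mconnected_lt conM F0 FT; rewrite -rB -rBF -(mrank_card Bb).
by rewrite -finset.setDE cardsID ltnn.
Qed.

Lemma choose_sides F p q : (p <= #|F|)%N -> (q <= #|~: F|%SET)%N ->
  exists2 B : {set 'I_n}, #|B :&: F| = p & #|B| = (p + q)%N.
Proof.
move=> /subset_of_card[A sA cA] /subset_of_card[D sD cD].
have AF : (A :&: F)%SET = A by apply/finset.setIidPl.
have DF : (D :&: F)%SET = finset.set0.
  by apply/eqP; rewrite finset.setI_eq0 finset.disjoints_subset.
exists (A :|: D)%SET; first by rewrite finset.setIUl AF DF finset.setU0.
rewrite cardsU cA cD; suff -> : (A :&: D)%SET = finset.set0 by rewrite cards0 subn0.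
by rewrite -AF -finset.setIA (finset.setIC F) DF finset.setI0.
Qed.

Lemma aff_hull_level (A : set 'rV[R]_n) a c : (forall y, A y -> dotp a y = c) ->
  forall x, aff_hull A x -> dotp a x = c.
Proof.
move=> h x [k [b [v [vA b1 ->]]]]; rewrite dotp_comb.
by rewrite (eq_bigr (fun i => b i * c)) -?mulr_suml ?b1 ?mul1r // => i _; rewrite h.
Qed.

Lemma aff_hull_sub (A A' : set 'rV[R]_n) : A `<=` A' -> aff_hull A `<=` aff_hull A'.
Proof. by move=> AA x [k [b [v [vA b1 ->]]]]; exists k, b, v; split=> // i; apply: AA. Qed.

Lemma aff_hull2 (A : set 'rV[R]_n) p q (t : R) : A p -> A q -> aff_hull A (t *: p + (1 - t) *: q).
Proof.
move=> Ap Aq; exists 2%N, (fun i : 'I_2 => if i == ord0 then t else 1 - t),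
  (fun i : 'I_2 => if i == ord0 then p else q).
split; first by move=> i; case: ifP.
  by rewrite big_ord_recl big_ord1 /= addrC subrK.
by rewrite big_ord_recl big_ord1.
Qed.

Section DefinesSplit.
Variable F : {set 'I_n}.
Hypothesis sF : split_set M F.
Local Notation r := (rk M F).
Local Notation Delta := (@hypersimplex R d n).
Local Notation P1 := (hull (@indic R n) (slab_set d F 0 r)).
Local Notation P2 := (hull (@indic R n) (slab_set d F r n)).

Lemma split_bounds : [/\ (0 < r)%N, (r < #|F|)%N, (r < d)%N & (d - r < #|~: F|%SET)%N].
Proof.
have /and3P[_ h1 h2] := sF; split=> //; last exact: split_set_contraction_card.
exact: rk_gt0 (split_set_neq0 sF).
Qed.

Lemma slab_sum_bounds x : Delta x -> 0 <= \sum_(i in F) x 0 i <= n%:R.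
Proof.
move=> [cube _]; rewrite sumr_ge0 => [|i _]; last by have /andP[] := cube i.
apply: (@le_trans _ _ #|F|%:R); last by rewrite ler_nat -[X in (_ <= X)%N](card_ord n) max_card.
by rewrite -sumr_const; apply: ler_sum => i _; have /andP[] := cube i.
Qed.

Lemma P1E x : P1 x <-> Delta x /\ \sum_(i in F) x 0 i <= r%:R.
Proof.
split=> [/hull_slab[? /andP[]]//|[Dx le]]; apply: slab_hull => //.
by rewrite le andbT; have /andP[] := slab_sum_bounds Dx.
Qed.

Lemma P2E x : P2 x <-> Delta x /\ r%:R <= \sum_(i in F) x 0 i.
Proof.
split=> [/hull_slab[? /andP[]]//|[Dx le]]; apply: slab_hull => //.
by rewrite le /=; have /andP[] := slab_sum_bounds Dx.
Qed.

Lemma P12E x : (P1 `&` P2) x <-> Delta x /\ \sum_(i in F) x 0 i = r%:R.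
Proof.
split=> [[/P1E[Dx h1] /P2E[_ h2]]|[Dx E]]; first by split=> //; apply/eqP; rewrite eq_le h1.
by split; [apply/P1E | apply/P2E]; rewrite E.
Qed.

Lemma split_common_face : face P1 (P1 `&` P2) /\ face P2 (P1 `&` P2).
Proof.
split.
  exists (indic R F), r%:R; split=> [x /P1E[]|]; rewrite ?dotp_indic //.
  apply/seteqP; split=> x; first by move=> [Px Qx]; rewrite /= dotp_indic; split=> //; have /P12E[] : (P1 `&` P2) x by [].
  by move=> [/= Px]; rewrite dotp_indic => E; apply/P12E; split=> //; have /P1E[] := Px.
exists (- indic R F), (- r%:R); split=> [x /P2E[_]|]; first by rewrite dotpNl dotp_indic lerN2.
apply/seteqP; split=> x.
  by move=> [Px Qx]; rewrite /= dotpNl dotp_indic; split=> //; have /P12E[_ ->] : (P1 `&` P2) x by [].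
by move=> [/= Px]; rewrite dotpNl dotp_indic => /oppr_inj E; apply/P12E; split=> //; have /P2E[] := Px.
Qed.

Lemma DeltaE : Delta = P1 `|` P2.
Proof.
apply/seteqP; split=> x; last by move=> [/P1E[]|/P2E[]].
by move=> Dx; have [le|/ltW le] := leP (\sum_(i in F) x 0 i) r%:R; [left; apply/P1E | right; apply/P2E].
Qed.

Lemma split_strict : ~ (P1 `<=` P2) /\ ~ (P2 `<=` P1).
Proof.
have [r0 rF rd dF] := split_bounds; split=> sub.
  have [B cBF cB] := @choose_sides F r.-1 (d - r.-1) (leq_trans (leq_pred _) (ltnW rF)) ltac:(by rewrite -subn1 subnBA // addn1 subSn // ltnW).
  have {}cB : #|B| = d by rewrite cB subnKC // (leq_trans (leq_pred _)) // ltnW.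
  have /sub/P2E[_] : P1 (indic R B).
    by apply: hull_gen; rewrite /slab_set cB eqxx cBF /= leq_pred.
  by rewrite -dotp_indic dotp_indic2 cBF ler_nat -ltnS prednK // ltnn.
have [B cBF cB] := @choose_sides F r.+1 (d - r.+1) rF (leq_trans (leq_sub2l d (leqnSn r)) (ltnW dF)).
have {}cB : #|B| = d by rewrite cB subnKC.
have /sub/P1E[_] : P2 (indic R B).
  apply: hull_gen; rewrite /slab_set cB eqxx cBF leqnSn /=.
  by rewrite (leq_trans rF) // -[X in (_ <= X)%N](card_ord n) max_card.
by rewrite -dotp_indic dotp_indic2 cBF ler_nat ltnn.
Qed.

Lemma flat_hyperplaneE (x : 'rV[R]_n) : \sum_i x 0 i = d%:R ->
  flat_hyperplane M F x <-> \sum_(i in F) x 0 i = r%:R.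
Proof.
have [r0 rF rd dF] := split_bounds; move=> sx; rewrite /flat_hyperplane /=.
have -> : \sum_(j | j \notin F) x 0 j = d%:R - \sum_(i in F) x 0 i.
  by rewrite -sx [X in _ = X - _](bigID (mem F)) /= [X in _ = X - _]addrC addrK.
have d0 : d%:R != 0 :> R by rewrite pnatr_eq0 -lt0n (leq_trans r0) // ltnW.
move: (\sum_(i in F) x 0 i) (d%:R : R) d0 (r%:R : R) => s D D0 q; split=> [E|->]; last by ring.
by apply: (mulfI D0); move: E; rewrite -/(_ = _); lra.
Qed.

(** Coordinates constant on [F] and on [~: F] work: the strict bounds of a split set put both values
    strictly between 0 and 1. *)
Lemma split_center : exists p : 'rV[R]_n, exists2 dl : R, 0 < dl &
  [/\ forall i, dl <= p 0 i <= 1 - dl, \sum_i p 0 i = d%:R & \sum_(i in F) p 0 i = r%:R].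
Proof.
have [r0 rF rd dF] := split_bounds.
pose a : R := r%:R / #|F|%:R; pose b : R := (d - r)%:R / #|~: F|%SET%:R.
have F0 : 0 < #|F|%:R :> R by rewrite ltr0n (leq_ltn_trans _ rF).
have C0 : 0 < #|~: F|%SET%:R :> R by rewrite ltr0n (leq_ltn_trans _ dF).
have a01 : 0 < a < 1 
  by apply/andP; split; [rewrite divr_gt0 // ltr0n | rewrite ltr_pdivrMr // mul1r ltr_nat].
have b01 : 0 < b < 1 
  by apply/andP; split; [rewrite divr_gt0 // ltr0n subn_gt0 | rewrite ltr_pdivrMr // mul1r ltr_nat].
exists (\row_i if i \in F then a else b), (Num.min (Num.min a (1 - a)) (Num.min b (1 - b))).
  by move: a01 b01 => /andP[h1 h2] /andP[h3 h4]; rewrite !lt_min !subr_gt0 h1 h2 h3 h4.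
have sumF : \sum_(i in F) (\row_i if i \in F then a else b) 0 i = r%:R.
  rewrite (eq_bigr (fun=> a)) => [|i iF]; last by rewrite mxE iF.
  by rewrite sumr_const -[LHS]mulr_natr /a divfK // gt_eqF.
split=> //.
  move=> i; rewrite mxE lerBrDl -lerBrDr.
  by case: ifP => _; rewrite !ge_min !lexx ?orbT.
rewrite (bigID (mem F)) /= sumF (eq_bigr (fun=> b)) => [|i iF]; last by rewrite mxE (negPf iF).
rewrite sumr_const -[X in _ + X]mulr_natr; have -> : #|[pred i | i \notin F]| = #|~: F|%SET.
  by apply: eq_card => i; rewrite !inE.
by rewrite /b divfK ?gt_eqF // -natrD subnKC // ltnW.
Qed.

Lemma split_hyperplane : flat_hyperplane M F `&` aff_hull Delta = aff_hull (P1 `&` P2).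
Proof.
have sumT (y : 'rV[R]_n) : \sum_i y 0 i = dotp (indic R [set: 'I_n]%SET) y.
  by rewrite dotp_indic; apply: eq_bigl => i; rewrite inE.
have affT x : aff_hull Delta x -> \sum_i x 0 i = d%:R.
  by rewrite sumT; apply: aff_hull_level => y [_]; rewrite sumT.
apply/seteqP; split=> x; last first.
  move=> hx; have hx' : aff_hull Delta x by apply: aff_hull_sub hx => y /P12E[].
  split=> //; apply/(flat_hyperplaneE (affT _ hx')); rewrite -dotp_indic.
  by apply: aff_hull_level hx => y /P12E[_]; rewrite dotp_indic.
move=> [hF hx]; have sx := affT x hx; move/(flat_hyperplaneE sx): hF => xF.
have [p [dl dl0 [pd sp pF]]] := split_center.
(* [K] bounds every coordinate of [x - p], so moving from [p] by [dl / K] times this vector stays in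
   the cube. Then [x] lies on the line through two points of the common cell. *)
pose K : R := 1 + \sum_i `|x 0 i - p 0 i|.
have K0 : 0 < K by rewrite ltr_pwDl // sumr_ge0.
pose ep := dl / K; have ep0 : 0 < ep by rewrite divr_gt0.
pose q := p + ep *: (x - p).
have qsum (A : pred 'I_n) : \sum_(i | A i) q 0 i =
    \sum_(i | A i) p 0 i + ep * (\sum_(i | A i) x 0 i - \sum_(i | A i) p 0 i).
  by rewrite -sumrB mulr_sumr -big_split; apply: eq_bigr => i _; rewrite !mxE.
have inP (z : 'rV[R]_n) : (forall i, 0 <= z 0 i <= 1) -> \sum_i z 0 i = d%:R ->
    \sum_(i in F) z 0 i = r%:R -> (P1 `&` P2) z.
  by move=> cube sz zF; apply/P12E.
have hp : (P1 `&` P2) p.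
  apply: inP => // i; have /andP[h1 h2] := pd i.
  by apply/andP; split; lra.
have hq : (P1 `&` P2) q.
  apply: inP; rewrite ?qsum ?sp ?pF ?sx ?xF ?subrr ?mulr0 ?addr0 // => i.
  have : `|ep * (x 0 i - p 0 i)| <= dl.
    rewrite normrM (gtr0_norm ep0) /ep mulrAC ler_pdivrMr // ler_pM2l //.
    rewrite /K (bigD1 i) //= addrCA lerDl addr_ge0 // sumr_ge0 //.
  rewrite ler_norml => /andP[h3 h4]; have /andP[h1 h2] := pd i.
  by rewrite !mxE; apply/andP; split; lra.
have -> : x = ep^-1 *: q + (1 - ep^-1) *: p.
  by apply/rowP => i; rewrite /q !mxE; field; rewrite gt_eqF.
exact: aff_hull2.
Qed.

Lemma split_set_defines_split : defines_split Delta (flat_hyperplane M F).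
Proof.
have [W1 W2] := split_common_face; have [n12 n21] := split_strict.
exists (glued (@indic R n) (slab_set d F 0 r) (slab_set d F r n)), P1, P2; split; last exact: split_hyperplane.
split.
- by rewrite DeltaE; apply: glued_subdivision.
- apply: glued_vertices => // B /orP[] /and3P[/eqP cB _ _]; exact: indic_vertex.
- by move=> E; apply: n12; rewrite E.
- by move=> E; apply: glued_maximal.
Qed.

Lemma split_set_split_flacet : split_flacet R M F.
Proof.
split; last exact: split_set_defines_split.
split; last by move=> G _; apply: split_set_minimal.
  by apply/forall_inP => x; apply: split_set_flat.
exact: split_set_facet.
Qed.

End DefinesSplit.

End SplitFlacet.

(** * Compatibility of splits as a rank inequality *)

Section InteriorWeights.
Variable R : realType.

(** Weight [u] can be spread evenly over [s] coordinates strictly between 0 and 1; an empty cell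
    takes weight 0. *)
Definition inside (u s : R) : Prop := 0 < u < s \/ u = 0 /\ s = 0.

Lemma inside_pos (u s : R) : 0 < u -> u < s -> inside u s.
Proof. by move=> h1 h2; left; rewrite h1. Qed.

(* [a], [b], [c], [e] are the sizes of the four cells cut out by two sets of prescribed
   weights [f] and [g] and total weight [d]. *)
Lemma interior_weights (a b c e f g d : R) :
  0 <= a -> 0 <= b -> 0 <= c -> 0 <= e ->
  f + g - d < a -> f - g < b -> g - f < c -> d - f - g < e ->
  0 < f < a + b -> 0 < g < a + c -> 0 < d - f < c + e -> 0 < d - g < b + e ->
  exists u : R, [/\ inside u a, inside (f - u) b, inside (g - u) c & inside (d - f - g + u) e].
Proof.
move=> a0 b0 c0 e0 h1 h2 h3 h4 /andP[h5 h6] /andP[h7 h8] /andP[h9 h10] /andP[h11 h12].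
(* An empty cell must receive weight 0, and this determines [u]. *)
have [az|an] := eqVneq a 0.
  exists 0; rewrite !subr0 addr0; split; [by right | apply: inside_pos | apply: inside_pos | apply: inside_pos]; lra.
have [bz|bn] := eqVneq b 0.
  exists f; split; [apply: inside_pos | by right; split=> //; rewrite subrr | apply: inside_pos | apply: inside_pos]; lra.
have [cz|cn] := eqVneq c 0.
  exists g; split; [apply: inside_pos | apply: inside_pos | by right; split=> //; rewrite subrr | apply: inside_pos]; lra.
have [ez|en] := eqVneq e 0.
  exists (f + g - d); split; [apply: inside_pos | apply: inside_pos | apply: inside_pos | by right; split=> //; ring]; lra.
have {a0 an}a0 : 0 < a by rewrite lt_neqAle eq_sym an.
have {b0 bn}b0 : 0 < b by rewrite lt_neqAle eq_sym bn.
have {c0 cn}c0 : 0 < c by rewrite lt_neqAle eq_sym cn.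
have {e0 en}e0 : 0 < e by rewrite lt_neqAle eq_sym en.
(* With no empty cell, the conditions are four lower and four upper bounds on [u]; the hypotheses
   make each lower bound smaller than each upper one. *)
pose l := Num.max (Num.max 0 (f - b)) (Num.max (g - c) (f + g - d)).
pose m := Num.min (Num.min a f) (Num.min g (e - d + f + g)).
have lm : l < m by rewrite /l /m !gt_max !lt_min; do !(apply/andP; split); lra.
have : l < (l + m) / 2 by rewrite ltr_pdivlMr //; lra.
have : (l + m) / 2 < m by rewrite ltr_pdivrMr //; lra.
move: ((l + m) / 2) => u; rewrite /l /m !gt_max !lt_min.
move=> /andP[/andP[u1 u2] /andP[u3 u4]] /andP[/andP[u5 u6] /andP[u7 u8]].
by exists u; split; apply: inside_pos; lra.
Qed.

End InteriorWeights.

Section Compatibility.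
Variables (R : realType) (n : nat) (M : matroid n).
Hypotheses (n_ge2 : (2 <= n)%N) (splitM : split_matroid R M).
Implicit Types (F G : {set 'I_n}).
Local Notation d := (mrank M).
Local Notation rk := (rk M).

Definition cell_point F G (u1 u2 u3 u4 : R) : 'rV[R]_n := \row_i
  if i \in F then (if i \in G then u1 / #|F :&: G|%SET%:R else u2 / #|F :\: G|%SET%:R)
  else (if i \in G then u3 / #|G :\: F|%SET%:R else u4 / #|~: (F :|: G)|%SET%:R).

Lemma sum_const_div (A : {set 'I_n}) (x : 'I_n -> R) u : inside u #|A|%:R ->
  (forall i, i \in A -> x i = u / #|A|%:R) -> \sum_(i in A) x i = u.
Proof.
move=> hu h; rewrite (eq_bigr _ h) sumr_const -[LHS]mulr_natr.
case: hu => [/andP[u0 us]|[-> _]]; last by rewrite !mul0r.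
by rewrite divfK // gt_eqF // (lt_trans u0 us).
Qed.

(** If the inequality fails, it joins [split_set_setD], in both orders, and [split_set_setU] as the
    four conditions of [interior_weights]. Spreading the weights over the cells gives an interior
    point on both hyperplanes. *)
Lemma split_sets_compatible F G : split_set M F -> split_set M G -> F <> G ->
  (#|F :&: G|%SET + d <= rk F + rk G)%N.
Proof.
move=> sF sG FG; have [conM disj] := splitM; rewrite leqNgt; apply/negP => h.
have {disj} disj := disj F G (split_set_split_flacet R conM n_ge2 sF)
  (split_set_split_flacet R conM n_ge2 sG) FG.
have [rF0 rF rFd dF] := split_bounds conM n_ge2 sF.
have [rG0 rG rGd dG] := split_bounds conM n_ge2 sG.
have h2 : (rk F < rk G + #|F :\: G|%SET)%N.
  by rewrite ltnNge; apply/negP => /(split_set_setD conM n_ge2 sF sG).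
have h3 : (rk G < rk F + #|G :\: F|%SET)%N.
  by rewrite ltnNge; apply/negP => /(split_set_setD conM n_ge2 sG sF) /esym.
have h4 := split_set_setU conM n_ge2 sF sG.
have cF : #|F| = (#|F :&: G|%SET + #|F :\: G|%SET)%N by rewrite cardsID.
have cG : #|G| = (#|F :&: G|%SET + #|G :\: F|%SET)%N by rewrite finset.setIC cardsID.
have cFc : #|~: F|%SET = (#|G :\: F|%SET + #|~: (F :|: G)|%SET)%N.
  rewrite -(cardsID G (~: F)%SET) !finset.setDE finset.setCU (finset.setIC G).
  by [].
have cGc : #|~: G|%SET = (#|F :\: G|%SET + #|~: (F :|: G)|%SET)%N.
  rewrite -(cardsID F (~: G)%SET) !finset.setDE finset.setCU (finset.setIC F).
  by rewrite (finset.setIC (~: G)%SET (~: F)%SET).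
have [||||||||||||u [u1 u2 u3 u4]] := @interior_weights R #|F :&: G|%SET%:R #|F :\: G|%SET%:R
   #|G :\: F|%SET%:R #|~: (F :|: G)|%SET%:R (rk F)%:R (rk G)%:R d%:R; rewrite ?ler0n //.
- by rewrite ltrBlDr -!natrD ltr_nat.
- by rewrite ltrBlDr -!natrD ltr_nat addnC.
- by rewrite ltrBlDr -!natrD ltr_nat addnC.
- by rewrite !ltrBlDl -!natrD ltr_nat addnA.
- by rewrite -natrD -cF !ltr_nat ltr0n rF0.
- by rewrite -natrD -cG !ltr_nat ltr0n rG0.
- by rewrite -natrD -cFc -natrB ?ltr_nat ?ltr0n ?subn_gt0 ?rFd // ltnW.
- by rewrite -natrD -cGc -natrB ?ltr_nat ?ltr0n ?subn_gt0 ?rGd // ltnW.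
pose x := cell_point F G u ((rk F)%:R - u) ((rk G)%:R - u) (d%:R - (rk F)%:R - (rk G)%:R + u).
have s1 : \sum_(i in (F :&: G)%SET) x 0 i = u.
  by apply: sum_const_div => // i; rewrite inE mxE => /andP[-> ->].
have s2 : \sum_(i in (F :\: G)%SET) x 0 i = (rk F)%:R - u.
  by apply: sum_const_div => // i; rewrite inE mxE => /andP[/negPf -> ->].
have s3 : \sum_(i in (G :\: F)%SET) x 0 i = (rk G)%:R - u.
  by apply: sum_const_div => // i; rewrite inE mxE => /andP[/negPf -> ->].
have s4 : \sum_(i in (~: (F :|: G))%SET) x 0 i = d%:R - (rk F)%:R - (rk G)%:R + u.
  by apply: sum_const_div => // i; rewrite !inE mxE negb_or => /andP[/negPf -> /negPf ->].
have sumF : \sum_(i in F) x 0 i = (rk F)%:R.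
  by rewrite (big_setID G) /= s1 s2 addrC subrK.
have sumG : \sum_(i in G) x 0 i = (rk G)%:R.
  by rewrite (big_setID F) /= finset.setIC s1 s3 addrC subrK.
have sumT : \sum_i x 0 i = d%:R.
  rewrite (bigID (mem F)) /= sumF; have -> : \sum_(i | i \notin F) x 0 i = \sum_(i in (~: F)%SET) x 0 i.
    by apply: eq_bigl => i; rewrite inE.
  rewrite (big_setID G) /=; have -> : (~: F :&: G)%SET = (G :\: F)%SET by rewrite finset.setDE finset.setIC.
  have -> : (~: F :\: G)%SET = (~: (F :|: G))%SET by rewrite finset.setDE finset.setCU.
  by rewrite s3 s4; ring.
have cell (v : R) (s : nat) : inside v s%:R -> (0 < s)%N -> 0 < v / s%:R < 1.
  move=> hv s0; have s0' : 0 < s%:R :> R by rewrite ltr0n.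
  case: hv => [/andP[v0 vs]|[_ E]]; last by rewrite E ltxx in s0'.
  by rewrite divr_gt0 //= ltr_pdivrMr // mul1r.
have int i : 0 < x 0 i < 1.
  rewrite mxE; case: (boolP (i \in F)) => iF; case: (boolP (i \in G)) => iG; apply: cell => //;
    by apply/card_gt0P; exists i; rewrite !inE ?iF ?iG ?(negPf iF) ?(negPf iG).
have : (flat_hyperplane M F `&` flat_hyperplane M G `&` relint (@hypersimplex R d n)) x.
  split; last exact: hypersimplex_relint.
  by split; apply/flat_hyperplaneE.
by rewrite disj.
Qed.

End Compatibility.

(** * Regular subdivisions and the Dressian *)

Lemma conv_hull_gen (R : realType) (T : finType) (E : lmodType R) (v : T -> E) i :
  conv_hull v (v i).
Proof.
have <- : hull v predT = conv_hull v; last exact: hull_gen.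
by apply/esym/(@conv_hull_reindex _ _ _ v T id) => // j; split=> // _; exists j.
Qed.

Section RegularSubdivision.
Variables (R : realType) (k m : nat).
Local Notation lifting := {ffun ksub k m -> R^o}.
Implicit Types (w u : lifting) (S : ksub k m) (a : 'rV[R]_m).
Local Notation pt := (fun S : ksub k m => indic R (val S)).

(** A generator other than [S] with positive weight would spoil a coordinate in which it differs
    from [S]. *)
Lemma indic_hull (Q : pred {set 'I_m}) (S : {set 'I_m}) : hull (@indic R m) Q (indic R S) -> Q S.
Proof.
move=> [b [b0 bQ b1 E]]; apply: contrapT => nQ.
have coord i : (i \in S)%:R = \sum_T b T * (i \in T)%:R :> R.
  have := congr1 (fun x : 'rV[R]_m => x 0 i) E; rewrite mxE summxE => ->.
  by apply: eq_bigr => T _; rewrite !mxE.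
have bS : b S = 0 by apply: contra_notP nQ => /eqP/bQ.
have b_eq0 T : b T = 0.
  have [->//|TS] := eqVneq T S; apply: contrapT => /eqP bT.
  have bT0 : 0 < b T by rewrite lt_neqAle eq_sym bT b0.
  have [[i iT iS]|[i iS iT]] : (exists2 i, i \in T & i \notin S) \/ (exists2 i, i \in S & i \notin T).
    have [/fintype.subsetPn[i]|sTS] := boolP (~~ (T \subset S)); first by left; exists i.
    have [/fintype.subsetPn[i]|sST] := boolP (~~ (S \subset T)); first by right; exists i.
    by case/negP: TS; rewrite finset.eqEsubset (negbNE sTS) (negbNE sST).
  - have := coord i; rewrite (negPf iS) (bigD1 T) //= iT mulr1 => /esym/eqP.
    rewrite gt_eqF // ltr_pwDl // sumr_ge0 // => T' _; exact: mulr_ge0.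
  have /eqP : \sum_U b U = \sum_U b U * (i \in U)%:R by rewrite b1 -coord iS.
  rewrite (bigD1 T) //= [X in _ == X](bigD1 T) //= (negPf iT) mulr0 add0r.
  rewrite gt_eqF // ltr_pwDl // ler_sum // => T' _.
  by rewrite -[leRHS]mulr1 ler_wpM2l // lern1 leq_b1.
by move/eqP: b1; rewrite big1 // eq_sym oner_eq0.
Qed.

Definition tight_set w a (b c : R) : pred (ksub k m) :=
  fun S => dotp a (pt S) + b * w S == c.

(** A lower face is spanned by the lifted vertices that minimise its supporting functional, so cells
    are determined by sets of vertices. *)
Lemma regular_subdivisionE w (C : set 'rV[R]_m) : regular_subdivision w C <->
  exists a (b c : R), [/\ 0 < b, forall S, c <= dotp a (pt S) + b * w S,
    C = hull pt (tight_set w a b c) & exists S, tight_set w a b c S].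
Proof.
have main a (b c : R) : (forall S, c <= dotp a (pt S) + b * w S) ->
    [set p.1 | p in [set p | lifted_polytope w p /\ dotp a p.1 + b * p.2 = c]] =
    hull pt (tight_set w a b c).
  move=> h; have comb (t : ksub k m -> R) : \sum_S t S = 1 ->
      dotp a (\sum_S t S *: pt S) + b * (\sum_S t S *: w S) =
      c + \sum_S t S * (dotp a (pt S) + b * w S - c).
    move=> t1; rewrite dotp_comb mulr_sumr -big_split /=.
    under [in RHS]eq_bigr do rewrite mulrBr.
    rewrite sumrB -mulr_suml t1 mul1r [RHS]addrC subrK; apply: eq_bigr => S _.
    by rewrite /GRing.scale /=; ring.
  have fstE (t : ksub k m -> R) : (\sum_S t S *: (pt S, w S : R^o)) =
      (\sum_S t S *: pt S, \sum_S t S *: (w S : R^o)).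
    elim/big_rec3: _ => [//|S x y z _ ->]; by [].
  apply/seteqP; split=> x.
    move=> [_ [[t [t0 t1 ->]] E] <-]; rewrite fstE /= in E *; exists t; split=> // S tS.
    rewrite comb // in E; have {}E : \sum_S t S * (dotp a (pt S) + b * w S - c) = 0.
      by apply: (addrI c); rewrite E addr0.
    move/eqP: E; rewrite psumr_eq0 => [/allP/(_ S)|S' _]; last by rewrite mulr_ge0 // subr_ge0.
    by rewrite mem_index_enum mulf_eq0 (negPf tS) subr_eq0 => /(_ isT).
  move=> [t [t0 tQ t1 ->]]; exists (\sum_S t S *: pt S, \sum_S t S *: (w S : R^o)) => //; split.
    by exists t; split=> //; rewrite fstE.
  rewrite /= comb // big1 ?addr0 // => S _; have [->|/tQ/eqP->] := eqVneq (t S) 0; first by rewrite mul0r.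
  by rewrite subrr mulr0.
have vertex_le a (b c : R) : (forall p, lifted_polytope w p -> c <= dotp a p.1 + b * p.2) <->
    (forall S, c <= dotp a (pt S) + b * w S).
  split=> h; first by move=> S; apply: (h (pt S, w S)); apply: (conv_hull_gen (fun S => (pt S, w S : R^o))).
  move=> p [t [t0 t1 ->]]; have -> : (\sum_S t S *: (pt S, w S : R^o)) =
      (\sum_S t S *: pt S, \sum_S t S *: (w S : R^o)) by elim/big_rec3: _ => [//|S x y z _ ->].
  rewrite /= dotp_comb mulr_sumr -big_split /= -[c]mul1r -t1 mulr_suml; apply: ler_sum => S _.
  have := ler_wpM2l (t0 S) (h S); rewrite mulrDr /GRing.scale /=; lra.
split=> -[a [b [c [b0 h CE C0]]]]; exists a, b, c; split=> //.
- exact/vertex_le.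
- by rewrite CE main //; apply/vertex_le.
- move: C0; rewrite CE main; last exact/vertex_le.
  move=> [x [t [t0 tQ t1 _]]]; apply: contrapT => /forallNP nS.
  move/eqP: t1; rewrite big1 => [|S _]; first by rewrite eq_sym oner_eq0.
  by apply: contra_notP (nS S) => /eqP/tQ.
- exact/vertex_le.
- by rewrite CE main.
- by rewrite CE; have [S TS] := C0; exists (pt S); apply: hull_gen.
Qed.

Lemma hull_ksub (Q : pred (ksub k m)) :
  hull pt Q = hull (@indic R m) [pred S | if insub S is Some T then Q T else false].
Proof.
rewrite -(conv_hull_sig pt Q).
apply: (@conv_hull_reindex _ _ _ _ _ (fun i : {i | Q i} => val (val i))).
  by move=> i j /val_inj/val_inj.
move=> S /=; split=> [|[[T QT] <-]]; last by rewrite /= valK.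
by case: insubP => [T _ <- QT|//]; exists (exist _ T QT).
Qed.

Lemma indic_ksub_hull (Q : pred (ksub k m)) S : hull pt Q (indic R (val S)) -> Q S.
Proof. by rewrite hull_ksub => /indic_hull /=; rewrite valK. Qed.

Hypothesis k_gt0 : (0 < k)%N.

Definition linear_lifting (a : 'rV[R]_m) : lifting := [ffun S => dotp a (pt S)].

Lemma linear_lifting_is_linear : linear linear_lifting.
Proof. by move=> c a b; apply/ffunP => S; rewrite !ffunE dotpDl dotpZl. Qed.
HB.instance Definition _ := GRing.isLinear.Build R 'rV[R]_m lifting _ linear_lifting linear_lifting_is_linear.

(** Linear forms cover the affine ones: the coordinates of every vertex sum to [k > 0], so a
    constant is itself linear. *)
Definition lineality : {vspace lifting} := limg (linfun linear_lifting).

Lemma linealityP u : reflect (exists a, u = linear_lifting a) (u \in lineality).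
Proof.
by apply: (iffP memv_imgP) => [[a _ ->]|[a ->]]; exists a; rewrite ?lfunE ?memvf.
Qed.

Lemma lineality_affine u a (b c : R) : b != 0 -> (forall S, dotp a (pt S) + b * u S = c) ->
  u \in lineality.
Proof.
move=> b0 h; apply/linealityP; exists ((c / k%:R / b) *: indic R [set: 'I_m]%SET - b^-1 *: a).
apply/ffunP => S; rewrite ffunE dotpDl dotpNl !dotpZl dotp_indic2 finset.setIT (eqP (valP S)).
rewrite -(h S); have k0 : k%:R != 0 :> R by rewrite pnatr_eq0 -lt0n.
by field; rewrite b0.
Qed.

Lemma regular_subdivision_shift w u : u \in lineality ->
  regular_subdivision (w + u) = regular_subdivision w.
Proof.
have sub w' u' : u' \in lineality -> regular_subdivision (w' + u') `<=` regular_subdivision w'.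
  move=> /linealityP[a' ->] C /regular_subdivisionE[a [b [c [b0 h CE C0]]]].
  have E S : dotp (a + b *: a') (pt S) + b * w' S = dotp a (pt S) + b * (w' + linear_lifting a') S.
    by rewrite dotpDl dotpZl !ffunE; ring.
  have tE : tight_set w' (a + b *: a') b c =1 tight_set (w' + linear_lifting a') a b c.
    by move=> S; rewrite /tight_set E.
  apply/regular_subdivisionE; exists (a + b *: a'), b, c; split=> //.
  - by move=> S; rewrite E.
  - by rewrite CE; apply/esym/eq_hull.
  - by have [S TS] := C0; exists S; rewrite tE.
move=> uL; apply/seteqP; split; first exact: sub.
by rewrite -{1}[w](addrK u); apply: sub; rewrite memvN.
Qed.

Lemma secondary_linealityE u : secondary_lineality u <-> u \in lineality.
Proof.
split=> [h|uL w c]; last by apply: regular_subdivision_shift; apply: memvZ.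
have [S0|nS] := pselect (exists S : ksub k m, True); last first.
  have -> : u = 0 by apply/ffunP => S; case: nS; exists S.
  exact: mem0v.
(* The zero lifting has the whole hypersimplex as a cell. Invariance makes it a cell of [u] as well,
   which forces [u] to be affine on the vertices. *)
have all0 : regular_subdivision (0 : lifting) (hull pt predT).
  apply/regular_subdivisionE; exists 0, 1, 0; split=> //.
  - by move=> S; rewrite dotp0l ffunE mulr0 addr0.
  - by apply: eq_hull => S; rewrite /tight_set dotp0l ffunE mulr0 addr0 eqxx.
  - by have [S _] := S0; exists S; rewrite /tight_set dotp0l ffunE mulr0 addr0 eqxx.
have := h 0 1; rewrite scale1r add0r => E; rewrite -E in all0.
have [a [b [c [b0 _ CE _]]]] := (regular_subdivisionE _ _).1 all0.
apply: (@lineality_affine u a b c); first by rewrite gt_eqF.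
by move=> S; apply/eqP/(indic_ksub_hull (Q := tight_set u a b c)); rewrite -CE; apply: hull_gen.
Qed.

(** A cell of [w] is also a cell of [w'], and on each of its cells a lifting is affine. *)
Lemma secondary_cone_sub w w' a (b c : R) :
  secondary_cone w w' -> 0 < b -> (forall S, c <= dotp a (pt S) + b * w S) ->
  (exists S, tight_set w a b c S) ->
  exists2 l, l \in lineality & forall S, tight_set w a b c S -> w' S = l S.
Proof.
move=> ww' b0 h C0.
have : regular_subdivision w (hull pt (tight_set w a b c)).
  by apply/regular_subdivisionE; exists a, b, c.
rewrite -ww' => /regular_subdivisionE[a' [b' [c' [b'0 _ CE _]]]].
exists [ffun S => (c' - dotp a' (pt S)) / b'].
  apply: (@lineality_affine _ a' b' c'); first by rewrite gt_eqF.
  by move=> S; rewrite ffunE mulrC divfK ?gt_eqF // addrC subrK.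
move=> S TS; have : tight_set w' a' b' c' S.
  by apply: indic_ksub_hull; rewrite -CE; apply: hull_gen.
by rewrite ffunE => /eqP <-; rewrite addrC addKr mulrC mulKf ?gt_eqF.
Qed.

End RegularSubdivision.

Section CorankDressian.
Variables (R : realType) (k m : nat) (N : matroid m).
Local Notation rho := (corank_vector R k N).
Local Notation pt := (fun S : ksub k m => indic R (val S)).

Section Cell.
Variables (a : 'rV[R]_m) (b c : R).
Hypotheses (b0 : 0 < b) (h : forall S, c <= dotp a (pt S) + b * rho S).

Definition cell_bases : {set {set 'I_m}} :=
  [set B | if insub B is Some T then tight_set rho a b c T else false]%SET.

Lemma cell_basesP (B : {set 'I_m}) : reflect (#|B| = k /\ dotp a (indic R B) + b * (k%:R - (rk N B)%:R) = c)
  (B \in cell_bases).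
Proof.
rewrite inE; apply: (iffP idP) => [|[cB E]].
  by case: insubP => // T _ <- /eqP; rewrite ffunE => E; split=> //; apply/eqP/(valP T).
by rewrite insubT ?cB // => cB'; rewrite /tight_set ffunE /= E.
Qed.

Lemma cell_ge (B : {set 'I_m}) : #|B| = k -> c <= dotp a (indic R B) + b * (k%:R - (rk N B)%:R).
Proof. by move/eqP => cB; have := h (exist _ B cB); rewrite ffunE. Qed.

(** Exchanging between [B] and [C] keeps the total of the linear part and, by [rk_exchange], does
    not raise the total corank. As [B] and [C] attain the minimum [c], so do both new sets. *)
Lemma cell_bases_exchange (B C : {set 'I_m}) x : B \in cell_bases -> C \in cell_bases -> x \in (B :\: C)%SET ->
  exists2 y, y \in (C :\: B)%SET & (y |: B :\ x)%SET \in cell_bases.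
Proof.
move=> /cell_basesP[cB eB] /cell_basesP[cC eC] xBC.
have [y yCB] := rk_exchange N (etrans cB (esym cC)) xBC.
move: (xBC) (yCB); rewrite !inE => /andP[xC xB] /andP[yB yC].
set B' := (y |: B :\ x)%SET; set C' := (x |: C :\ y)%SET => le; exists y => //.
have cB' : #|B'| = k by rewrite card_exch.
have cC' : #|C'| = k by rewrite card_exch.
apply/cell_basesP; split=> //.
move: le; rewrite -(ler_nat R) !natrD => le.
have dE : dotp a (indic R B') + dotp a (indic R C') = dotp a (indic R B) + dotp a (indic R C).
  have dotpC (X : {set 'I_m}) : dotp a (indic R X) = \sum_(i in X) a 0 i.
    by rewrite -dotp_indic; apply: eq_bigr => i _; rewrite mulrC.
  by rewrite !dotpC !sum_exch //; lra.
have := ler_wpM2l (ltW b0) le; have := cell_ge cB'; have := cell_ge cC'.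
rewrite -/B'; move: dE eB eC; rewrite ![b * (_ - _)]mulrBr ![b * (_ + _)]mulrDr; lra.
Qed.

End Cell.

Lemma corank_dressian : dressian rho.
Proof.
move=> C /regular_subdivisionE[a [b [c [b0 h -> [S TS]]]]].
have ne : cell_bases a b c != finset.set0.
  by apply/finset.set0Pn; exists (val S); rewrite inE valK.
exists (Matroid ne (cell_bases_exchange b0 h)); split.
  have Sb : val S \in bases (Matroid ne (cell_bases_exchange b0 h)) by rewrite inE valK.
  by rewrite -(mrank_card Sb); apply/eqP/(valP S).
rewrite matroid_polytope_hull hull_ksub; apply: eq_hull => B /=.
by rewrite inE.
Qed.

End CorankDressian.

(** * The secondary cone of the corank vector *)

Section Ray.
Variables (R : realType) (n : nat) (M : matroid n).
Hypotheses (n_ge2 : (2 <= n)%N) (splitM : split_matroid R M).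
Implicit Types (F : {set 'I_n}).
Local Notation d := (mrank M).
Local Notation N := (series_free_lift M).
Local Notation rho := (corank_vector R d.+1 N).
Local Notation pt := (fun S : ksub d.+1 n.+2 => indic R (val S)).
Local Notation L := (lineality R d.+1 n.+2).
Local Notation embs F := (@emb n @: F)%SET.

Let conM : mconnected M := splitM.1.
Let compat := split_sets_compatible n_ge2 splitM.

Lemma ksub_card (S : ksub d.+1 n.+2) : #|val S| = d.+1.
Proof. exact/eqP/(valP S). Qed.

Lemma rho_eq0 (S : ksub d.+1 n.+2) : (rho S == 0) = (val S \in bases N).
Proof.
by rewrite ffunE subr_eq0 eqr_nat bases_rk ksub_card mrank_series_free_lift eqxx eq_sym.
Qed.

Lemma rho_ge0 (S : ksub d.+1 n.+2) : 0 <= rho S.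
Proof. by have := rk_le_card N (val S); rewrite ksub_card ffunE subr_ge0 ler_nat. Qed.

Lemma rho_ge F (S : ksub d.+1 n.+2) : #|val S :&: embs F|%SET%:R - (rk M F)%:R <= rho S.
Proof.
have := rk_lift_ge M (val S) F; rewrite ksub_card ffunE.
by rewrite -(ler_nat R) !natrD; lra.
Qed.

Lemma base_ksub (S : {set 'I_n.+2}) : S \in bases N -> exists2 T : ksub d.+1 n.+2, val T = S & rho T = 0.
Proof.
move=> Sb; have /eqP cS := etrans (mrank_card Sb) (mrank_series_free_lift M).
by exists (exist _ S cS) => //; apply/eqP; rewrite rho_eq0.
Qed.

Lemma lineality_face F l : (F == [set: 'I_n])%SET || split_set M F -> l \in L ->
  (forall S : ksub d.+1 n.+2, rho S = 0 -> #|val S :&: embs F|%SET = rk M F -> l S = 0) ->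
  exists lam : R, forall S : ksub d.+1 n.+2, l S = lam * (#|val S :&: embs F|%SET%:R - (rk M F)%:R).
Proof.
move=> hF /(linealityP _)[a ->] h.
have lE (S : ksub d.+1 n.+2) : linear_lifting d.+1 a S = \sum_(i in val S) a 0 i.
  by rewrite ffunE -dotp_indic; apply: eq_bigr => i _; rewrite mulrC.
have h' S : S \in bases N -> #|S :&: embs F|%SET = rk M F -> \sum_(j in S) a 0 j = 0.
  by move=> /base_ksub[T <- rT] rS; rewrite -lE h.
have [x [y xy]] := lift_face_const conM hF h'.
have sumE (S : {set 'I_n.+2}) : #|S| = d.+1 ->
    \sum_(j in S) a 0 j = x * #|S :&: embs F|%SET%:R + y * (d.+1%:R - #|S :&: embs F|%SET%:R).
  move=> cS; rewrite (big_setID (embs F)) /= (eq_bigr (fun=> x)) => [|j]; last first.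
    by rewrite inE xy => /andP[_ ->].
  rewrite [X in _ + X](eq_bigr (fun=> y)) => [|j]; last by rewrite inE xy => /andP[/negPf ->].
  have -> : d.+1%:R = #|S :&: embs F|%SET%:R + #|S :\: embs F|%SET%:R :> R.
    by rewrite -cS -(cardsID (embs F) S) natrD.
  by rewrite !sumr_const -[x *+ _]mulr_natr -[y *+ _]mulr_natr; ring.
have [B /andP[Bb /eqP rB]] := face_base_exists M F.
have Sb : ext_set B true false \in bases N by rewrite lift_bases.
have cS := etrans (mrank_card Sb) (mrank_series_free_lift M).
have := h' _ Sb; rewrite sumE // card_extI_emb => /(_ rB) E; rewrite rB in E.
(* The basis gives x r + y (d + 1 - r) = 0 with r the rank of [F]; this turns x a + y (d + 1 - a)
   into (x - y)(a - r). *)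
exists (x - y) => S; rewrite lE sumE ?ksub_card //.
by move: E; lra.
Qed.

(** Take a basis of [M] that is optimal for [F] and add an element of [F]. This exceeds both [F] and
    the whole ground set by exactly one, so it compares the factors of their two cells. *)
Lemma lift_corank_common F : (F == [set: 'I_n])%SET || split_set M F ->
  exists S : ksub d.+1 n.+2, [/\ rho S = 1, #|val S :&: embs F|%SET = (rk M F).+1 &
    #|val S :&: embs [set: 'I_n]|%SET = d.+1].
Proof.
move=> hF; have rF : (rk M F < #|F|)%N.
  case/orP: hF => [/eqP->|/and3P[_ ->//]]; rewrite cardsT card_ord -/d.
  pose x : 'I_n := Ordinal (ltnW n_ge2).
  rewrite -(rk_setC1 conM n_ge2 x); apply: leq_ltn_trans (rk_le_card _ _) _.
  by have := cardsC [set x]%SET; rewrite cards1 card_ord add1n => E; apply: eq_leq E.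
have [B Bb rB] := rk_attained M F.
have [e eF eB] : exists2 e, e \in F & e \notin B.
  apply/fintype.subsetPn; apply: contraTN rF => sFB.
  by rewrite -rB (finset.setIidPr sFB) ltnn.
have cT : #|e |: B|%SET = d.+1 by rewrite cardsU1 eB (mrank_card Bb).
have cS : #|embs (e |: B)| == d.+1 by rewrite card_imset ?cT //; apply: emb_inj.
have rT : rk M (e |: B) = d.
  apply/eqP; rewrite eqn_leq rk_le_mrank -(mrank_card Bb) -(rk_indep (base_indep Bb)).
  by rewrite rkS // finset.subsetUr.
have cI (G : {set 'I_n}) : #|embs (e |: B) :&: embs G| = #|(e |: B) :&: G|%SET.
  by rewrite -finset.imsetI ?card_imset //; [apply: emb_inj | move=> ? ? _ _; apply: emb_inj].
exists (exist (fun S : {set 'I_n.+2} => #|S| == d.+1) _ cS); split; rewrite /= ?cI ?finset.setIT //.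
  by rewrite ffunE /= rk_lift_emb rT -natrB // subSnn.
have -> : ((e |: B) :&: F)%SET = (e |: (B :&: F))%SET.
  by rewrite finset.setIUl; congr (_ :|: _)%SET; apply/finset.setIidPl; rewrite finset.sub1set.
by rewrite cardsU1 inE (negPf eB) rB.
Qed.

(** Otherwise the ground set yields a factor valid for all sets. A basis with both new elements
    meets the ground set in [d - 1] elements and forces this factor to be 0, but the corank 1 also
    occurs. *)
Lemma rho_not_linear : rho \notin L.
Proof.
apply/negP => rL; have hT : ([set: 'I_n] == [set: 'I_n])%SET || split_set M [set: 'I_n]%SET by rewrite eqxx.
have [lam hl] := lineality_face hT rL (fun S E _ => E).
have [S [rS _ cS]] := lift_corank_common hT.
have /finset.set0Pn[B Bb] := bases_neq0 M.
have [e eB] : exists e, e \in B.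
  apply/finset.set0Pn; rewrite -card_gt0 (mrank_card Bb); apply: rk_gt0 => //.
  by apply/finset.set0Pn; exists (Ordinal (ltnW n_ge2)); rewrite inE.
have : ext_set (B :\ e)%SET true true \in bases N.
  rewrite lift_bases /= (indepS (subD1set _ _) (base_indep Bb)) /=.
  by rewrite -(mrank_card Bb) (cardsD1 e B) eB.
move=> /base_ksub[T vT rT].
have := hl T; rewrite rT vT card_extI_emb finset.setIT.
have cB : #|B| = #|B :\ e|%SET.+1 by rewrite (cardsD1 e B) eB.
rewrite -/d -(mrank_card Bb) cB -natr1 => E.
have := hl S; rewrite rS cS -/d -natr1 => E'.
by move: E E'; move: (#|_|%:R : R) => q; lra.
Qed.

Lemma secondary_cone_rho w : secondary_cone rho w -> exists2 l, l \in L & exists lam, w = l + lam *: rho.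
Proof.
move=> cw; have cell F : (F == [set: 'I_n])%SET || split_set M F -> exists2 l, l \in L &
    forall S : ksub d.+1 n.+2, rho S = #|val S :&: embs F|%SET%:R - (rk M F)%:R -> w S = l S.
  move=> hF; have tightE (S : ksub d.+1 n.+2) : tight_set rho (- indic R (embs F)) 1 (- (rk M F)%:R) S =
      (rho S == #|val S :&: embs F|%SET%:R - (rk M F)%:R).
    rewrite /tight_set dotpNl dotp_indic2 mul1r; apply/eqP/eqP; lra.
  have [|||l lL hl] := @secondary_cone_sub R d.+1 n.+2 isT rho w (- indic R (embs F)) 1 (- (rk M F)%:R) cw.
  - exact: ltr01.
  - by move=> S; rewrite dotpNl dotp_indic2 mul1r; have := rho_ge F S; lra.
  - by have [S [rS cS _]] := lift_corank_common hF; exists S; rewrite tightE rS cS -natr1 addrC addKr.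
  by exists l => // S E; apply: hl; rewrite tightE E.
have [l0 l0L hl0] : exists2 l, l \in L & forall S : ksub d.+1 n.+2, rho S = 0 -> w S = l S.
  have tightE (S : ksub d.+1 n.+2) : tight_set rho 0 1 0 S = (rho S == 0).
    by rewrite /tight_set dotp0l add0r mul1r.
  have [|||l lL hl] := @secondary_cone_sub R d.+1 n.+2 isT rho w 0 1 0 cw.
  - exact: ltr01.
  - by move=> S; rewrite dotp0l add0r mul1r rho_ge0.
  - have /finset.set0Pn[S /base_ksub[T _ rT]] := bases_neq0 N.
    by exists T; rewrite tightE rT.
  by exists l => // S E; apply: hl; rewrite tightE E.
have ray F : (F == [set: 'I_n])%SET || split_set M F -> exists lam : R,
    forall S : ksub d.+1 n.+2, rho S = #|val S :&: embs F|%SET%:R - (rk M F)%:R -> w S = l0 S + lam * rho S.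
  move=> hF; have [l lL hl] := cell F hF.
  have [|lam hlam] := lineality_face hF (memvB lL l0L).
    by move=> S rS cS; rewrite !ffunE -hl ?rS ?cS ?subrr // -hl0 // subrr.
  by exists lam => S E; rewrite hl // E -hlam !ffunE addrC subrK.
have hT : ([set: 'I_n] == [set: 'I_n])%SET || split_set M [set: 'I_n]%SET by rewrite eqxx.
have [lam hlam] := ray _ hT; exists l0 => //; exists lam; apply/ffunP => S.
transitivity (l0 S + lam * rho S); last by rewrite [RHS]ffunE [X in _ = _ + X]ffunE.
have [rS|nS] := eqVneq (rho S) 0; first by rewrite hl0 // rS mulr0 addr0.
rewrite rho_eq0 in nS; have [F hF le] := lift_corank_attained conM n_ge2 compat (ksub_card S) nS.
have [mu hmu] := ray F hF.
have rS : rho S = #|val S :&: embs F|%SET%:R - (rk M F)%:R.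
  apply/eqP; rewrite eq_le rho_ge andbT; move: le; rewrite -(ler_nat R) !natrD ffunE; lra.
have [T [rT cF cT]] := lift_corank_common hF.
have e1 := hlam T; rewrite rT cT -/d -natr1 addrC addKr mulr1 in e1.
have e2 := hmu T; rewrite rT cF -natr1 addrC addKr mulr1 in e2.
have -> : lam = mu by apply: (addrI (l0 T)); rewrite -e1 // -e2.
exact: hmu.
Qed.

Lemma rho_spans_ray : spans_ray rho.
Proof.
exists (L + <[rho]>)%VS, L; split; last exact: dim_add_line rho_not_linear.
  split=> [w /secondary_cone_rho[l lL [lam ->]]|W hW].
    by rewrite memv_add // memvZ // memv_line.
  rewrite subv_add -memvE; have rW : rho \in W by apply: hW.
  rewrite rW andbT; apply/subvP => l lL.
  (* A lineality vector is the difference of the two cone members [rho + l] and [rho]. *)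
  rewrite -(addKr rho l) memvD ?memvN //; apply: hW.
  exact: regular_subdivision_shift.
split=> [u|W hW]; first by move/secondary_linealityE; apply.
by apply/subvP => u uL; apply: hW; apply/secondary_linealityE.
Qed.

Theorem corank_lift_ray : ray_of_dressian rho.
Proof. by split; [apply: corank_dressian | apply: rho_spans_ray]. Qed.

End Ray.

(** * Puiseux series and the lifting problem *)

Section PuiseuxTerms.
Variable K : fieldType.
Local Notation P := (puiseux K).
Implicit Types x y : P.

Definition bounded_below x (p : rat) := forall a, x a != 0 -> p <= a.

(** Stated for lower bounds rather than exact valuations, so that it also covers vanishing
    coefficients, as reduction to the residue field requires. *)
Lemma bounded_belowM x y p q : bounded_below x p -> bounded_below y q ->
  (x * y) (p + q) = x p * y q /\ bounded_below (x * y) (p + q).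
Proof.
move=> hx hy; split; last first.
  by move=> r; rewrite pcoefM => /cauchy_neq0[a /andP[/hx pa /hy qa]]; lra.
rewrite pcoefM (fsum_widen (A := [set p])); first by rewrite fsbig_set1 addrAC subrr add0r.
move=> a /=; rewrite mulf_eq0 negb_or => /andP[/hx pa /hy qa].
by apply/eqP; rewrite eq_le pa andbT; lra.
Qed.

Lemma bounded_belowN x p : bounded_below x p -> bounded_below (- x) p.
Proof. by move=> h a; rewrite -[(- x) a]/(- (x a)) oppr_eq0; apply: h. Qed.

Lemma lowestM x y p q : lowest x p -> lowest y q -> lowest (x * y) (p + q).
Proof.
move=> [xp hx] [yq hy]; have [E low] := bounded_belowM hx hy.
by split=> //; rewrite E mulf_neq0.
Qed.

Definition term (c : K) (r : rat) : P := mkP (monomial_supp c r).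

Lemma termE c r q : term c r q = if q == r then c else 0. Proof. by []. Qed.

Lemma termM b c p q : term b p * term c q = term (b * c) (p + q).
Proof.
have below a s : bounded_below (term a s) s.
  by move=> r; rewrite termE; case: (r =P s) => [->|_]; rewrite ?eqxx.
apply: pext => r; rewrite termE pcoefM (fsum_widen (A := [set p])).
  rewrite fsbig_set1 !termE eqxx subr_eq [q + p]addrC.
  by case: (r == p + q); rewrite ?mulr0.
by move=> a; rewrite mulf_eq0 negb_or !termE => /andP[]; case: (a =P p) => // _; rewrite eqxx.
Qed.

Definition constant c := term c 0.

Lemma constant_is_additive : zmod_morphism constant.
Proof.
move=> b c; apply: pext => q; rewrite pcoefD !termE.
rewrite -[(- constant c) q]/(- (constant c q)) termE.
by case: eqP => // _; rewrite subr0.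
Qed.

Lemma constant_is_multiplicative : monoid_morphism constant.
Proof. by split=> // b c; rewrite /constant termM addr0. Qed.

HB.instance Definition _ := GRing.isZmodMorphism.Build K P constant constant_is_additive.
HB.instance Definition _ := GRing.isMonoidMorphism.Build K P constant constant_is_multiplicative.

Definition of_poly : {poly K} -> P :=
  horner_morph (fun c => mulrC (term 1 1) (constant c)).
HB.instance Definition _ := GRing.RMorphism.on of_poly.

Lemma term_exp n : term 1 1 ^+ n = term 1 n%:R.
Proof.
elim: n => [|n IH]; first by [].
by rewrite exprS IH termM mulr1 -natr1 addrC.
Qed.

Lemma pcoef_sum (I : finType) (F : I -> P) q : (\sum_i F i) q = \sum_i (F i) q.
Proof.
apply: (big_ind2 (fun (x : P) (y : K) => x q = y)) => //; first exact: pcoef0.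
by move=> x1 x2 y1 y2 <- <-; apply: pcoefD.
Qed.

Lemma of_poly_coef p q : of_poly p q = \sum_(i < size p) (if q == i%:R then p`_i else 0).
Proof.
rewrite /of_poly /horner_morph horner_poly pcoef_sum; apply: eq_bigr => i _.
by rewrite term_exp termM mulr1 add0r termE.
Qed.

Lemma lowest_of_poly (p : {poly K}) e : p`_0 != 0 -> lowest (of_poly (p * 'X^e)) e%:R.
Proof.
move=> p0; have ce i : (p * 'X^e)`_i = if (i < e)%N then 0 else p`_(i - e) by rewrite coefMXn.
split.
  have se : (e < size (p * 'X^e)%R)%N.
    by rewrite ltnNge; apply: contra p0 => /(nth_default 0); rewrite ce ltnn subnn => ->.
  rewrite of_poly_coef (bigD1 (Ordinal se)) //= eqxx ce ltnn subnn big1 ?addr0 // => i.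
  by rewrite eqr_nat -val_eqE /= eq_sym => /negPf ->.
move=> q; rewrite of_poly_coef; apply: contraNT; rewrite -ltNge => lt.
rewrite big1 // => i _; case: eqP => // E; rewrite ce.
by move: lt; rewrite E ltr_nat => ->.
Qed.

Definition residue x (c : K) := bounded_below x 0 /\ x 0 = c.

Lemma residueM x y b c : residue x b -> residue y c -> residue (x * y) (b * c).
Proof.
by move=> [hx <-] [hy <-]; have [] := bounded_belowM hx hy; rewrite addr0.
Qed.

Lemma residueD x y b c : residue x b -> residue y c -> residue (x + y) (b + c).
Proof.
move=> [hx <-] [hy <-]; split=> // a; rewrite pcoefD => h.
have [xa|/hx //] := eqVneq (x a) 0.
by apply: hy; move: h; rewrite xa add0r.
Qed.

Lemma residue_nat n : residue n%:R n%:R.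
Proof.
have r1 : residue 1 1 by split=> // a; rewrite -[(1 : P) a]/(term 1 0 a) termE; case: (a =P 0) => [->//|]; rewrite eqxx.
elim: n => [|n IH]; last by rewrite -!natr1; apply: residueD.
by split=> [a|]; rewrite pcoef0 ?eqxx.
Qed.

Lemma residueN x c : residue x c -> residue (- x) (- c).
Proof.
by move=> [hx <-]; split=> //; apply: bounded_belowN.
Qed.

Lemma residue_det k (A : 'M[P]_k) (B : 'M[K]_k) :
  (forall i j, residue (A i j) (B i j)) -> residue (\det A) (\det B).
Proof.
move=> h; apply: (big_ind2 residue); [exact: (residue_nat 0)|by move=> ? ? ? ?; apply: residueD|].
move=> s _; apply: residueM.
  by case: (odd_perm s); rewrite ?expr0 ?expr1; [apply: residueN|]; apply: (residue_nat 1).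
by apply: (big_ind2 residue); [exact: (residue_nat 1)|by move=> ? ? ? ?; apply: residueM|].
Qed.

Lemma lowest_inv0 x : lowest x 0 -> lowest x^-1 0.
Proof.
move=> lx; have x0 : x != 0 by apply: contraTneq lx.1 => ->; rewrite pcoef0 eqxx.
have [p lp] := lowest_ex (invr_neq0 x0).
have := lowestM lx lp; rewrite divff // add0r => l1.
have <- // : p = 0; apply: lowest_inj l1 _.
split; last by have [] := residue_nat 1.
by have [_ ->] := residue_nat 1; apply: oner_neq0.
Qed.

End PuiseuxTerms.

(** This turns each entry of a matrix that is the identity on a basis into a maximal minor. *)
Lemma det_replaced_col (R : comNzRingType) k (i : 'I_k) (v : 'I_k -> R) :
  \det (\matrix_(a, b) (if b == i then v a else (a == b)%:R)) = v i.
Proof.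
rewrite (expand_det_row _ i) (bigD1 i) //= mxE eqxx big1 ?addr0 => [|b bi]; last first.
  by rewrite mxE (negPf bi) eq_sym (negPf bi) mul0r.
rewrite /cofactor -signr_odd oddD addbb expr0 mul1r.
set Q := row' _ _; have -> : Q = 1%:M; last by rewrite det1 mulr1.
apply/matrixP => a b; rewrite !mxE eq_sym (negPf (neq_lift i b)).
by rewrite (inj_eq (@lift_inj _ i)).
Qed.

Lemma same_image_perm k (T : finType) (f g : 'I_k -> T) :
  injective g -> (forall b, exists c, f c = g b) -> exists s : {perm 'I_k}, forall b, g b = f (s b).
Proof.
move=> ginj h; have {}h b : exists c, f c == g b by have [c <-] := h b; exists c.
pose t b := xchoose (h b).
have ht b : f (t b) = g b by apply/eqP; apply: (xchooseP (h b)).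
have tinj : injective t by move=> a b E; apply: ginj; rewrite -!ht E.
by exists (perm tinj) => b; rewrite permE ht.
Qed.

Section LiftRepresentation.
Variables (R : realType) (k m : nat) (N : matroid m).
Hypothesis rankN : mrank N = k.

Lemma rk_le_rank T : (rk N T <= k)%N.
Proof. by rewrite -rankN; apply: rk_le_mrank. Qed.

Lemma ksub_enum_inj (S : ksub k m) : injective (ksub_enum S).
Proof. by move=> a b /enum_val_inj /cast_ord_inj. Qed.

Lemma ksub_enum_image (S : ksub k m) : (ksub_enum S @: finset.setT)%SET = val S.
Proof.
apply/setP => x; apply/imsetP/idP => [[b _ ->]|xS]; first exact: enum_valP.
have cS := eqP (valP S); exists (cast_ord cS (enum_rank_in xS x)) => //.
by rewrite /ksub_enum (_ : cast_ord _ _ = enum_rank_in xS x) ?enum_rankK_in //; apply: val_inj.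
Qed.

Lemma representation_lift (K : closedFieldType) (B : 'M[K]_(m, k)) :
  (forall S, rowrank B S = rk N S) -> liftable K (corank_vector R k N).
Proof.
move=> hB; have [G hG] := @generic_perturbation K (ksub k m) k m (@ksub_enum k m) B^T ksub_enum_inj.
exists (map_mx (@of_poly K) (perturb B^T G)) => S; exists (k - rk N (val S))%:R.
  apply/pvalP; have [q q0 E] := hG S.
  rewrite -map_mxsub det_map_mx E trmxK ksub_enum_image hB.
  exact: lowest_of_poly.
by rewrite ffunE ratr_nat natrB ?rk_le_rank.
Qed.

Lemma lift_representation (K : fieldType) : liftable K (corank_vector R k N) ->
  exists B : 'M[K]_(m, k), forall S, rowrank B S = rk N S.
Proof.
move=> [A hA].
have {}hA S : lowest (\det (colsub (ksub_enum S) A)) (k - rk N (val S))%:R.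
  have [q hq] := hA S; rewrite ffunE -natrB -?(ratr_nat R); last exact: rk_le_rank.
  by move=> /fmorph_inj Eq; apply/pvalP; rewrite hq Eq.
have /set0Pn[B0 B0b] := bases_neq0 N; have cB0 : #|B0| == k by rewrite (mrank_card B0b) rankN.
pose f0 := ksub_enum (exist _ B0 cB0 : ksub k m).
have low0 : lowest (\det (colsub f0 A)) 0.
  have := hA (exist _ B0 cB0); rewrite /= (_ : rk N B0 = k) ?subnn //.
  by rewrite (rk_indep (base_indep B0b)); apply/eqP.
have det0 : \det (colsub f0 A) != 0.
  by apply: contraTneq low0.1 => ->; rewrite pcoef0 eqxx.
have u0 : colsub f0 A \in unitmx by rewrite unitmxE unitfE.
pose A1 := invmx (colsub f0 A) *m A.
have A1f0 : colsub f0 A1 = 1%:M by rewrite -mulmx_colsub mulVmx.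
have hA1 S : lowest (\det (colsub (ksub_enum S) A1)) (k - rk N (val S))%:R.
  rewrite -mulmx_colsub det_mulmx det_inv -[_%:R]add0r.
  exact: lowestM (lowest_inv0 low0) (hA S).
(* Replacing one column of the basis need not respect the increasing order of [ksub_enum];
   reordering costs only a sign. *)
have below g : injective g -> bounded_below (\det (colsub g A1)) 0.
  move=> ginj; pose S : {set 'I_m} := (g @: finset.setT)%SET.
  have cS : #|S| == k by rewrite card_imset // cardsT card_ord.
  have [|s hs] := @same_image_perm k _ (ksub_enum (exist _ S cS : ksub k m)) g ginj.
    move=> b; have : g b \in (ksub_enum (exist _ S cS : ksub k m) @: finset.setT)%SET.
      by rewrite ksub_enum_image imset_f.
    by case/imsetP => c _ ->; exists c.
  have -> : colsub g A1 = col_perm s (colsub (ksub_enum (exist _ S cS : ksub k m)) A1).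
    by apply/matrixP => a b; rewrite !mxE hs.
  have [_ low] := hA1 (exist _ S cS).
  have b0 : bounded_below (\det (colsub (ksub_enum (exist _ S cS : ksub k m)) A1)) 0.
    by move=> a /low; apply: le_trans; apply: ler0n.
  rewrite col_permE det_mulmx det_perm mulrC mulr_sign.
  by case: (odd_perm _) => //; apply: bounded_belowN.
have entry i j : residue (A1 i j) (A1 i j 0).
  split=> //; have [/existsP[b /eqP <-]|Nj] := boolP [exists b, f0 b == j].
    have -> : A1 i (f0 b) = (i == b)%:R by have /matrixP/(_ i b) := A1f0; rewrite !mxE.
    by have [] := residue_nat K (i == b).
  (* Putting column [j] in place of the [i]-th basis column gives a maximal minor equal to the
     entry. *)
  pose g b := if b == i then j else f0 b.
  have ginj : injective g.
    move=> a b; rewrite /g; case: eqP => [->|_]; case: eqP => [->|_] // E.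
    - by case/existsP: Nj; exists b; rewrite -E.
    - by case/existsP: Nj; exists a; rewrite E.
    - exact: ksub_enum_inj E.
  have -> : A1 i j = \det (colsub g A1); last exact: below.
  rewrite -(det_replaced_col i (fun a => A1 a j)); congr (\det _).
  apply/matrixP => a b; rewrite [LHS]mxE [RHS]mxE /g; case: (b == i) => //.
  by have /matrixP/(_ a b) := A1f0; rewrite !mxE => ->.
pose C : 'M[K]_(k, m) := \matrix_(i, j) A1 i j 0.
exists C^T; apply: rowrank_rk => // S cS; have {}cS : #|S| == k by apply/eqP.
have -> : rowrank C^T S = \rank (colsub (ksub_enum (exist _ S cS : ksub k m)) C).
  by rewrite rank_colsub ksub_enum_image.
rewrite -/(row_free _) row_free_unit unitmxE unitfE bases_rk rankN cS /=.
have [low <-] : residue (\det (colsub (ksub_enum (exist _ S cS : ksub k m)) A1))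
    (\det (colsub (ksub_enum (exist _ S cS : ksub k m)) C)).
  apply: residue_det => i j.
  by rewrite [colsub _ A1 i j]mxE [colsub _ C i j]mxE [C _ _]mxE; apply: entry.
(* The minor has valuation [k - rk N S], so its coefficient at 0 survives exactly when [S] is a
   basis. *)
have [nz low'] := hA1 (exist _ S cS); rewrite /= in nz low'.
have le := rk_le_rank S.
apply/idP/eqP => [/low'|E]; last by move: nz; rewrite E subnn.
by rewrite lern0 subn_eq0 => ge; apply/eqP; rewrite eqn_leq le.
Qed.

End LiftRepresentation.

Lemma realizable_of_lift (K : fieldType) n (M : matroid n) k (B : 'M[K]_(n.+2, k)) :
  (forall S, rowrank B S = rk (series_free_lift M) S) -> realizable K M.
Proof.
move=> hB; apply: (@rowrank_realizable _ _ _ _ (rowsub (@emb n) B)) => S.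
rewrite -rk_lift_emb -hB.
rewrite /rowrank; apply/eqP; rewrite eqn_leq; apply/andP; split; apply: mxrankS; apply: rowspan_sub.
  move=> i iS; have -> : row i (rowsub (@emb n) B) = row (emb i) B by apply/rowP => l; rewrite !mxE.
  by apply: row_rowspan; apply: imset_f.
move=> _ /imsetP[i iS ->].
have -> : row (emb i) B = row i (rowsub (@emb n) B) by apply/rowP => l; rewrite !mxE.
exact: row_rowspan.
Qed.

Theorem theorem41 (R : realType) (n d : nat) (M : matroid n)
    (n_ge2 : (2 <= n)%N) (rankM : mrank M = d) (splitM : split_matroid R M) :
  ray_of_dressian (corank_vector R d.+1 (series_free_lift M)) /\
  forall K : closedFieldType,
    liftable K (corank_vector R d.+1 (series_free_lift M)) <-> realizable K M.
Proof.
subst d; have rankN := mrank_series_free_lift M.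
split=> [|K]; first exact: corank_lift_ray.
split=> [/(lift_representation rankN)[B hB]|]; first exact: realizable_of_lift hB.
by move=> /realizable_lift[B hB]; apply: representation_lift hB.
Qed.
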